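(* Let $g\in L^2(\mathbb{R})$ satisfy $g(-x)=-g(x)$. Then $$ \int_0^{2\pi}\int_{\mathbb{R}}\frac{|e^{-it(-\triangle+|x|^2)}g|^2}{|x|^2}\,dx\,dt=4\pi\|g\|_2^2 . $$ In particular, this identity (for all odd $g\in L^2(\mathbb{R})$) is equivalent to the following identity in the three-dimensional radial case: if $\psi\in L^2(\mathbb{R}^3)$ is a radial function, then $$ \int_0^{2\pi}\int_{\mathbb{R}^3}\frac{|e^{-it(-\triangle+|x|^2)}\psi|^2}{|x|^2}\,dx\,dt=4\pi\|\psi\|_{L^2(\mathbb{R}^3)}^2 . $$
   Context: $e^{-it(-\triangle+|x|^2)}$ denotes the unitary propagator on $L^2(\mathbb{R}^n)$ ($n=1$ in the first identity, $n=3$ in the second) of the equation $i\partial_t u=-\triangle u+|x|^2u$; i.e. $u(\cdot,t)=e^{-it(-\triangle+|x|^2)}f$ is the solution with $u(\cdot,0)=f$. Here $\triangle$ is the Laplacian on $\mathbb{R}^n$ (so $\triangle=d^2/dx^2$ when $n=1$), and $\|g\|_2=\|g\|_{L^2(\mathbb{R})}$. *)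

(* Defs.v *)
From HB Require Import structures.
From mathcomp Require Import all_boot all_order all_algebra.
From mathcomp Require Import complex.
From mathcomp Require Import all_classical all_reals all_analysis.
Set Implicit Arguments.
Unset Strict Implicit.
Unset Printing Implicit Defensive.
Import Order.TTheory GRing.Theory Num.Theory.
Import numFieldNormedType.Exports.
Local Open Scope classical_set_scope.
Local Open Scope ring_scope.
Local Open Scope complex_scope.

(* Elements of L^2(mu; C) are represented by functions T -> R[i]; identities
   between them are understood mu-almost everywhere. *)
Section complex_L2.
Context d (T : measurableType d) (R : realType).
Variable mu : {measure set T -> \bar R}.
Implicit Types f g : T -> R[i].

Definition L2norm f : \bar R :=
  'N[mu]_2%:E [EFin \o (fun x => ComplexField.Normc.normc (f x))]%E.

Definition L2 f : Prop :=
  [/\ measurable_fun setT (fun x => complex.Re (f x)),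
      measurable_fun setT (fun x => complex.Im (f x)) &
      (L2norm f < +oo)%E].

Definition pairing f (phi : T -> R) : R[i] :=
  (\int[mu]_x (complex.Re (f x) * phi x)) +i*
  (\int[mu]_x (complex.Im (f x) * phi x)).

Record unitary_group (U : R -> (T -> R[i]) -> T -> R[i]) : Prop := {
  ug_L2 : forall t f, L2 f -> L2 (U t f) ;
  ug_linear : forall t (a : R[i]) f g, L2 f -> L2 g ->
    ae_eq mu setT (U t (fun x => a * f x + g x))
                  (fun x => a * U t f x + U t g x) ;
  ug_isometry : forall t f, L2 f -> L2norm (U t f) = L2norm f ;
  ug0 : forall f, L2 f -> ae_eq mu setT (U 0 f) f ;
  ugD : forall s t f, L2 f -> ae_eq mu setT (U (s + t) f) (U s (U t f)) ;
  ug_continuous : forall f t0, L2 f ->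
    L2norm (fun x => U t f x - U t0 f x) @[t --> t0] --> 0%E }.

End complex_L2.

Definition is_cderive (R : realType) (m : R -> R[i]) (t : R) (z : R[i]) : Prop :=
  is_derive t 1 (fun s => complex.Re (m s)) (complex.Re z) /\
  is_derive t 1 (fun s => complex.Im (m s)) (complex.Im z).

(* U is the unitary propagator of the equation i u_t = H u: u(t) = U t f is the
   solution, continuous in time with values in L^2, with u(0) = f.  For data f
   in L^2 the equation is understood in the sense of distributions in x, tested
   against the functions of S.  H is assumed formally symmetric and real, so
   that it may be moved to the test function, and real-valued test functions
   suffice by linearity. *)
Definition unitary_propagator d (T : measurableType d) (R : realType)
    (mu : {measure set T -> \bar R})
    (S : set (T -> R)) (H : (T -> R) -> T -> R)
    (U : R -> (T -> R[i]) -> T -> R[i]) : Prop :=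
  unitary_group mu U /\
  forall f, L2 mu f -> forall phi, S phi -> forall t,
    exists2 z : R[i],
      is_cderive (fun s => pairing mu (U s f) phi) t z &
      'i%C * z = pairing mu (U t f) (H phi).

Section differential_operators.
Context (R : realType) (E : normedModType R).

Definition iter_derive (s : seq E) (phi : E -> R) : E -> R :=
  foldr (fun v psi => 'D_v psi) phi s.

(* The norm of E is only used up to equivalence here. *)
Definition schwartz : set (E -> R) := [set phi | forall s : seq E,
  (forall x, differentiable (iter_derive s phi) x) /\
  (forall k : nat, exists M : R, forall x,
     `|x| ^+ k * `|iter_derive s phi x| <= M)].

(* es is to be an orthonormal basis of the Euclidean space E. *)
Definition laplacian (es : seq E) (phi : E -> R) (x : E) : R :=
  \sum_(e <- es) 'D_e ('D_e phi) x.

Definition harmonic_oscillator (es : seq E) (enorm : E -> R)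
    (phi : E -> R) (x : E) : R :=
  - laplacian es phi x + enorm x ^+ 2 * phi x.

End differential_operators.

Section dimension_one_and_three.
Variable R : realType.

Definition mu1 : {measure set (measurableTypeR R) -> \bar R} := @lebesgue_measure R.
Definition mu3 :
    {measure set (measurableTypeR R * measurableTypeR R * measurableTypeR R)
       -> \bar R} :=
  ((@lebesgue_measure R \x @lebesgue_measure R) \x @lebesgue_measure R)%E.

(* The library norm of R * R * R is the sup norm, hence the explicit Euclidean
   norm. *)
Definition enorm1 (x : R) : R := `|x|.
Definition enorm3 (x : R * R * R) : R :=
  Num.sqrt (x.1.1 ^+ 2 + x.1.2 ^+ 2 + x.2 ^+ 2).

Definition basis1 : seq R := [:: 1].
Definition basis3 : seq (R * R * R) := [:: (1, 0, 0); (0, 1, 0); (0, 0, 1)].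

Definition harmonic_propagator1 (U : R -> (R -> R[i]) -> R -> R[i]) : Prop :=
  unitary_propagator mu1 (@schwartz R R) (harmonic_oscillator basis1 enorm1) U.

Definition harmonic_propagator3
    (U : R -> (R * R * R -> R[i]) -> R * R * R -> R[i]) : Prop :=
  unitary_propagator mu3 (@schwartz R (R * R * R)%type)
    (harmonic_oscillator basis3 enorm3) U.

Definition odd_fun (g : R -> R[i]) : Prop :=
  {ae mu1, forall x, g (- x) = - g x}.

Definition radial (psi : R * R * R -> R[i]) : Prop :=
  exists rho : R -> R[i], {ae mu3, forall x, psi x = rho (enorm3 x)}.

End dimension_one_and_three.

(* The value at x = 0 (where 0^-1 = 0) is irrelevant, {0} being a null set in
   the applications. *)
Definition weighted_spacetime_integral d (T : measurableType d) (R : realType)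
    (mu : {measure set T -> \bar R}) (enorm : T -> R) (u : R -> T -> R[i])
    : \bar R :=
  (\int[@lebesgue_measure R]_(t in `[0%R, (2 * pi)%R])
     \int[mu]_x
       ((ComplexField.Normc.normc (u t x)) ^+ 2 / (enorm x) ^+ 2)%:E)%E.

(* Main.v *)
(* Both identities are instances of one computation.  Put s(x) = x^2, b(x) = x
   on R and s(x) = |x|^2, b(x) = 1 on R^3; odd functions on R and radial ones
   on R^3 are of the form b F(s), and dilations give
   \int b^2 F(c^2 s) = c^-3 \int b^2 F(s).
   The functions phi_k = b p_k(s) e^(-s/2), with p_k the Laguerre polynomial of
   index 1/2, are eigenfunctions of -\Delta + |x|^2 with eigenvalue 4k+3, hence
   U_t phi_k = e^(-i(4k+3)t) phi_k: the pairings of U_t phi_k with phi_k solve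
   an ODE, and unitarity forces equality in the Cauchy-Schwarz inequality.  For
   f in the span of the phi_k the cross terms of |U_t f|^2 / s integrate to 0
   over [0, 2pi], and what remains is 2pi times the sum of
   |a_k|^2 \int phi_k^2 / s.  Differentiating the dilation identity in c yields
   the moment recursion \int b^2 s^j e^-s = (j + 1/2) \int b^2 s^(j-1) e^-s,
   from which \int phi_k^2 / s = 2 \int phi_k^2 for every k.  The span is dense
   among the functions b F(s), and both sides pass to the limit after truncation
   of the weight 1/s. *)
From HB Require Import structures.
From mathcomp Require Import all_boot all_order all_algebra.
From mathcomp Require Import complex ring lra.
From mathcomp Require Import all_classical all_reals all_analysis.
From mathcomp Require Import measurable_realfun.
Require Import Defs.
Set Implicit Arguments.
Unset Strict Implicit.
Unset Printing Implicit Defensive.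
Import Order.TTheory GRing.Theory Num.Theory.
Import numFieldNormedType.Exports.
Local Open Scope classical_set_scope.
Local Open Scope ring_scope.

(** The propagator is given by the group axioms and the weak equation alone, so what is known of [U]
    comes from pairings with Schwartz eigenfunctions; their orthogonality too is deduced from [U].
    The spacing 4 of the eigenvalues gives every cross term an integer frequency, and the factor 2
    in front of [\int phi_k^2] is the inverse of the 1/2 in the moment recursion at [j = 0]:
    orthogonality of [p_k] to its own derivative removes the rest. The weight [1/s] is unbounded, so
    the spacetime energy is not known beforehand to be finite or continuous on [L^2]. Hence the
    order of the limits: an upper bound for the truncated weights, then for [1/s], and only then
    equality, by applying the upper bound to the difference between [f] and an approximant. Moments
    and density both rest on the dilation identity and one finite Gaussian integral. Dimension three
    has one more obstacle: the profile of a radial function is arbitrary, whereas density concerns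
    Borel profiles, so a measurable one has to be found. *)

(** * Real square-integrable functions and their inner product *)

Section square_integrable.
Context d (T : measurableType d) (R : realType).
Variable mu : {measure set T -> \bar R}.
Implicit Types (f g h : T -> R) (a : R).

Definition sqint f : Prop :=
  measurable_fun setT f /\ (\int[mu]_x ((f x) ^+ 2)%:E < +oo)%E.

Definition ip f g : R := \int[mu]_x (f x * g x).

Lemma measurable_sqr f : measurable_fun setT f ->
  measurable_fun setT (fun x => ((f x) ^+ 2)%:E).
Proof. by move=> mf; apply/measurable_EFinP; exact: measurable_funX. Qed.

Lemma integral_sqr_lty_le f g (k : R) : 0 <= k -> measurable_fun setT f ->
  sqint g -> (forall x, (f x) ^+ 2 <= k * (g x) ^+ 2) -> sqint f.
Proof.
move=> k0 mf [mg ig] fg; split => //.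
apply: (@le_lt_trans _ _ (\int[mu]_x (k%:E * ((g x) ^+ 2)%:E))%E).
  apply: ge0_le_integral => //.
  - by move=> x _; rewrite lee_fin sqr_ge0.
  - exact: measurable_sqr.
  - by under eq_fun do rewrite -EFinM; apply/measurable_EFinP;
      apply: measurable_funM => //; exact: measurable_funX.
  - by move=> x _; rewrite -EFinM lee_fin.
rewrite ge0_integralZl_EFin//; last exact: measurable_sqr.
  by rewrite lte_mul_pinfty.
by move=> x _; rewrite lee_fin sqr_ge0.
Qed.

Lemma sqint_le f g : measurable_fun setT f -> sqint g ->
  (forall x, `|f x| <= `|g x|) -> sqint f.
Proof.
move=> mf sg fg; apply: (@integral_sqr_lty_le f g 1) => // x.
by rewrite mul1r -[leLHS]real_normK ?num_real// -[leRHS]real_normK ?num_real// ler_sqr ?nnegrE.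
Qed.

Lemma sqint0 : sqint (fun=> 0).
Proof.
by split => //; under eq_integral do rewrite expr0n/=; rewrite integral0.
Qed.

Lemma sqintZ a f : sqint f -> sqint (fun x => a * f x).
Proof.
move=> sf; apply: (@integral_sqr_lty_le _ f (a ^+ 2)) => //.
- exact: sqr_ge0.
- by apply: measurable_funM => //; case: sf.
- by move=> x; rewrite exprMn.
Qed.

Lemma sqintD f g : sqint f -> sqint g -> sqint (fun x => f x + g x).
Proof.
move=> [mf sf] [mg sg]; have mfg := measurable_funD mf mg; split => //.
apply: (@le_lt_trans _ _
    (\int[mu]_x (2%:E * ((f x) ^+ 2)%:E + 2%:E * ((g x) ^+ 2)%:E))%E).
  apply: ge0_le_integral => //.
  - by move=> x _; rewrite lee_fin sqr_ge0.
  - exact: measurable_sqr.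
  - under eq_fun do rewrite -!EFinM -EFinD.
    apply/measurable_EFinP; apply: measurable_funD;
    apply: measurable_funM => //; exact: measurable_funX.
  - move=> x _; rewrite -!EFinM -EFinD lee_fin.
    by have := sqr_ge0 (f x - g x); lra.
have ge0 (k : T -> R) x : setT x -> (0 <= 2%:E * ((k x) ^+ 2)%:E)%E.
  by rewrite -EFinM lee_fin mulr_ge0// sqr_ge0.
have mZ (k : T -> R) : measurable_fun setT k ->
    measurable_fun setT (fun x => 2%:E * ((k x) ^+ 2)%:E)%E.
  by move=> mk; apply: measurable_funeM; exact: measurable_sqr.
have ge0' (k : T -> R) x : setT x -> (0 <= ((k x) ^+ 2)%:E)%E.
  by rewrite lee_fin sqr_ge0.
rewrite ge0_integralD//; [|exact: ge0|exact: mZ|exact: ge0|exact: mZ].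
rewrite !ge0_integralZl_EFin//; try solve [exact: measurable_sqr | exact: ge0'].
by rewrite lte_add_pinfty// lte_mul_pinfty.
Qed.

Lemma sqintN f : sqint f -> sqint (fun x => - f x).
Proof. by move=> /(sqintZ (-1)); under eq_fun do rewrite mulN1r. Qed.

Lemma sqintB f g : sqint f -> sqint g -> sqint (fun x => f x - g x).
Proof. by move=> sf /sqintN; exact: sqintD. Qed.

Lemma sqint_sum n (f : nat -> T -> R) : (forall k, sqint (f k)) ->
  sqint (fun x => \sum_(k < n) f k x).
Proof.
move=> sf; elim: n => [|n ih].
  by under eq_fun do rewrite big_ord0; exact: sqint0.
by under eq_fun do rewrite big_ord_recr; exact: sqintD.
Qed.

(** Polarization: [f g] is a quarter of [(f + g)^2 - (f - g)^2], and sums and differences stay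
    square integrable. *)
Lemma integrable_ip f g : sqint f -> sqint g ->
  mu.-integrable setT (EFin \o (fun x => f x * g x)).
Proof.
move=> sf sg; have [[mf _] [mg _]] := (sf, sg).
have [mD iD] := sqintD sf sg; have [mB iB] := sqintB sf sg.
have isq h : measurable_fun setT h -> (\int[mu]_x ((h x) ^+ 2)%:E < +oo)%E ->
    mu.-integrable setT (fun x => ((h x) ^+ 2)%:E).
  move=> mh ih; apply/integrableP; split; first exact: measurable_sqr.
  by under eq_integral do rewrite gee0_abs ?lee_fin ?sqr_ge0//.
have i1 := integrableZl measurableT (4^-1) (isq _ mD iD).
have i2 := integrableZl measurableT (4^-1) (isq _ mB iB).
apply: eq_integrable (integrableB measurableT i1 i2) => // x _ /=.
by rewrite -!EFinM -EFinB; congr EFin; field.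
Qed.

Lemma ipC f g : ip f g = ip g f.
Proof. by apply: eq_Rintegral => x _; rewrite mulrC. Qed.

Lemma ipDl f g h : sqint f -> sqint g -> sqint h ->
  ip (fun x => f x + g x) h = ip f h + ip g h.
Proof.
move=> sf sg sh; rewrite /ip -RintegralD//; try exact: integrable_ip.
by apply: eq_Rintegral => x _; rewrite mulrDl.
Qed.

Lemma ipZl a f g : sqint f -> sqint g -> ip (fun x => a * f x) g = a * ip f g.
Proof.
move=> sf sg; rewrite /ip -RintegralZl//; last exact: integrable_ip.
by apply: eq_Rintegral => x _; rewrite mulrA.
Qed.

Lemma ipNl f g : sqint f -> sqint g -> ip (fun x => - f x) g = - ip f g.
Proof.
move=> sf sg; rewrite -mulN1r -ipZl//.
by apply: eq_Rintegral => x _; rewrite mulN1r.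
Qed.

Lemma ipBl f g h : sqint f -> sqint g -> sqint h ->
  ip (fun x => f x - g x) h = ip f h - ip g h.
Proof. by move=> sf sg sh; rewrite ipDl ?ipNl//; exact: sqintN. Qed.

Lemma ipZr a f g : sqint f -> sqint g -> ip f (fun x => a * g x) = a * ip f g.
Proof. by move=> sf sg; rewrite !(ipC f) ipZl. Qed.

Lemma ip_suml n (f : nat -> T -> R) g : (forall k, sqint (f k)) -> sqint g ->
  ip (fun x => \sum_(k < n) f k x) g = \sum_(k < n) ip (f k) g.
Proof.
move=> sf sg; elim: n => [|n ih].
  rewrite big_ord0 -[RHS](mul0r (ip g g)) -ipZl//.
  by apply: eq_Rintegral => x _; rewrite big_ord0 !mul0r.
rewrite big_ord_recr/= -ih -ipDl//; last exact: sqint_sum.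
by apply: eq_Rintegral => x _; rewrite big_ord_recr.
Qed.

Lemma ip_ge0 f : 0 <= ip f f.
Proof. by apply: Rintegral_ge0 => x _; rewrite -expr2 sqr_ge0. Qed.

Lemma ipE f : sqint f -> (\int[mu]_x ((f x) ^+ 2)%:E)%E = (ip f f)%:E.
Proof.
move=> [mf sf]; rewrite /ip /Rintegral fineK//.
under eq_integral do rewrite -expr2.
rewrite ge0_fin_numE// integral_ge0// => x _.
by rewrite lee_fin sqr_ge0.
Qed.

Lemma ae_eq_integral_sqr f g : measurable_fun setT f -> measurable_fun setT g ->
  ae_eq mu setT f g ->
  (\int[mu]_x ((f x) ^+ 2)%:E)%E = (\int[mu]_x ((g x) ^+ 2)%:E)%E.
Proof.
move=> mf mg fg; apply: ae_eq_integral => //; try exact: measurable_sqr.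
by apply: filterS fg => x /[apply] ->.
Qed.

Lemma ae_eq_ip f f' g : measurable_fun setT f -> measurable_fun setT f' ->
  measurable_fun setT g -> ae_eq mu setT f f' -> ip f g = ip f' g.
Proof.
move=> mf mf' mg ff'; congr fine; apply: ae_eq_integral => //.
- by apply/measurable_EFinP; exact: measurable_funM.
- by apply/measurable_EFinP; exact: measurable_funM.
- by apply: filterS ff' => x /[apply] ->.
Qed.

Lemma ip_eq0 f : sqint f -> ip f f = 0 -> ae_eq mu setT f (cst 0).
Proof.
move=> sf f0; have := ipE sf; rewrite f0 => i0.
have : (\int[mu]_x `|((f x) ^+ 2)%:E|)%E = 0%E.
  by rewrite -[RHS]i0; apply: eq_integral => x _; rewrite gee0_abs// lee_fin sqr_ge0.
move/(ae_eq_integral_abs mu measurableT (measurable_sqr (proj1 sf))).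
apply: filterS => x /(_ I) [] /eqP; rewrite sqrf_eq0 => /eqP h _.
by rewrite h.
Qed.

Lemma ip_sqrD f g : sqint f -> sqint g ->
  ip (fun x => f x + g x) (fun x => f x + g x) = ip f f + 2 * ip f g + ip g g.
Proof.
move=> sf sg; have sfg := sqintD sf sg.
rewrite ipDl// !(ipC _ (fun x => f x + g x)) !ipDl// (ipC g f); lra.
Qed.

Lemma ip_sqrB f g : sqint f -> sqint g ->
  ip (fun x => f x - g x) (fun x => f x - g x) = ip f f - 2 * ip f g + ip g g.
Proof.
move=> sf sg; have sfg := sqintB sf sg.
rewrite ipBl// !(ipC _ (fun x => f x - g x)) !ipBl// (ipC g f); lra.
Qed.

(** Expand [|a f - g|^2 >= 0] and divide by [a]. For small [a] the factor of [|f|^2] is close to 1,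
    so this stands in for the triangle inequality while all norms stay squared. *)
Lemma ip_sqrD_le f g (a : R) : 0 < a -> sqint f -> sqint g ->
  ip (fun x => f x + g x) (fun x => f x + g x)
  <= (1 + a) * ip f f + (1 + a^-1) * ip g g.
Proof.
move=> a0 sf sg; rewrite ip_sqrD//.
have := ip_ge0 (fun x => a * f x - g x).
rewrite ip_sqrB//; last exact: sqintZ.
rewrite ipZl//; last exact: sqintZ.
rewrite (ipC f (fun x => _)) ipZl// ipZl// => h.
have ai : a^-1 * a = 1 by rewrite mulVf// gt_eqF.
have : 0 <= a^-1 * (a * (a * ip f f) - 2 * (a * ip f g) + ip g g).
  by rewrite mulr_ge0// invr_ge0 ltW.
have -> : a^-1 * (a * (a * ip f f) - 2 * (a * ip f g) + ip g g) =
  a^-1 * a * a * ip f f - 2 * (a^-1 * a) * ip f g + a^-1 * ip g g by ring.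
rewrite ai; lra.
Qed.

End square_integrable.

(** * Complex [L^2] functions and the squared norm *)

Section complex_square_integrable.
Context d (T : measurableType d) (R : realType).
Variable mu : {measure set T -> \bar R}.
Implicit Types f g : T -> R[i].

Local Notation re f := (fun x => complex.Re (f x)).
Local Notation im f := (fun x => complex.Im (f x)).

(** The squared [L^2] norm as a real number, so that estimates are ordinary order and field
    arithmetic. *)
Definition nm f : R := ip mu (re f) (re f) + ip mu (im f) (im f).

Lemma sqr_normc (z : R[i]) :
  ComplexField.Normc.normc z ^+ 2 = complex.Re z ^+ 2 + complex.Im z ^+ 2.
Proof. by case: z => a b /=; rewrite sqr_sqrtr// addr_ge0// sqr_ge0. Qed.

Lemma normc_ge0 (z : R[i]) : 0 <= ComplexField.Normc.normc z.
Proof. by case: z => a b /=; exact: sqrtr_ge0. Qed.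

Lemma L2normE f : L2norm mu f =
  ((\int[mu]_x ((complex.Re (f x)) ^+ 2 + (complex.Im (f x)) ^+ 2)%:E) `^ 2^-1)%E.
Proof.
rewrite /L2norm unlock; congr (_ `^ _)%E; apply: eq_integral => x _ /=.
rewrite ger0_norm ?normc_ge0//= -sqr_normc.
by rewrite powR_mulrn// normc_ge0.
Qed.

Lemma measurable_sqr_normc f : measurable_fun setT (re f) ->
  measurable_fun setT (im f) ->
  measurable_fun setT
    (fun x => ((complex.Re (f x)) ^+ 2 + (complex.Im (f x)) ^+ 2)%:E).
Proof.
move=> mr mi; apply/measurable_EFinP.
by apply: measurable_funD; exact: measurable_funX.
Qed.

Lemma integral_sqr_normc f : measurable_fun setT (re f) ->
  measurable_fun setT (im f) ->
  (\int[mu]_x ((complex.Re (f x)) ^+ 2 + (complex.Im (f x)) ^+ 2)%:E =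
   \int[mu]_x ((complex.Re (f x)) ^+ 2)%:E +
   \int[mu]_x ((complex.Im (f x)) ^+ 2)%:E)%E.
Proof.
move=> mr mi; rewrite -ge0_integralD//; try exact: measurable_sqr;
  by move=> x _; rewrite lee_fin sqr_ge0.
Qed.

Lemma L2P f : L2 mu f <-> sqint mu (re f) /\ sqint mu (im f).
Proof.
have ge0 (g : T -> R) : (0 <= \int[mu]_x ((g x) ^+ 2)%:E)%E.
  by apply: integral_ge0 => x _; rewrite lee_fin sqr_ge0.
have ge0' : (0 <= \int[mu]_x ((complex.Re (f x)) ^+ 2 + (complex.Im (f x)) ^+ 2)%:E)%E.
  by apply: integral_ge0 => x _; rewrite lee_fin addr_ge0// sqr_ge0.
split=> [[mr mi]|[[mr fr] [mi fi]]]; last first.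
  split=> //; rewrite L2normE integral_sqr_normc//.
  have := lte_add_pinfty fr fi.
  by move=> /poweR_lty; apply.
rewrite L2normE => h.
(* An infinite integral would make the norm infinite, since [+oo] to the power 1/2 is [+oo]. *)
have : (\int[mu]_x ((complex.Re (f x)) ^+ 2 + (complex.Im (f x)) ^+ 2)%:E < +oo)%E.
  move: h ge0'; case: (integral _ _ _) => [r _ _|h _|//]; first exact: ltry.
  by move: h; rewrite poweRyr// invr_eq0 pnatr_eq0.
rewrite integral_sqr_normc// => {}h; split; split => //.
- by apply: le_lt_trans h; rewrite leeDl.
- by apply: le_lt_trans h; rewrite leeDr.
Qed.

Lemma nmE f : L2 mu f ->
  (\int[mu]_x ((complex.Re (f x)) ^+ 2 + (complex.Im (f x)) ^+ 2)%:E)%E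
  = (nm f)%:E.
Proof.
move=> /L2P[sr si]; rewrite integral_sqr_normc; [|by case: sr|by case: si].
by rewrite !ipE.
Qed.

Lemma nm_ge0 f : 0 <= nm f.
Proof. by rewrite addr_ge0// ip_ge0. Qed.

Lemma L2norm_sqrt f : L2 mu f -> L2norm mu f = (Num.sqrt (nm f))%:E.
Proof.
by move=> lf; rewrite L2normE nmE//= powR12_sqrt// nm_ge0.
Qed.

Lemma L2norm_sqr f : L2 mu f -> (L2norm mu f ^+ 2)%E = (nm f)%:E.
Proof.
by move=> lf; rewrite L2norm_sqrt// -EFin_expe sqr_sqrtr// nm_ge0.
Qed.

Lemma nm_eq_L2norm f g : L2 mu f -> L2 mu g -> L2norm mu f = L2norm mu g ->
  nm f = nm g.
Proof.
move=> lf lg /(congr1 (fun z => z ^+ 2)%E).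
by rewrite !L2norm_sqr// => -[].
Qed.

Lemma L2Zl (a : R[i]) f : L2 mu f -> L2 mu (fun x => a * f x).
Proof.
case: a => a b /L2P[sr si]; apply/L2P; split.
- have := sqintB (sqintZ a sr) (sqintZ b si); congr sqint.
  by apply/funext => x /=; case: (f x).
- have := sqintD (sqintZ a si) (sqintZ b sr); congr sqint.
  by apply/funext => x /=; case: (f x).
Qed.

Lemma L2D f g : L2 mu f -> L2 mu g -> L2 mu (fun x => f x + g x).
Proof.
move=> /L2P[sr si] /L2P[sr' si']; apply/L2P; split.
- have := sqintD sr sr'; congr sqint.
  by apply/funext => x /=; case: (f x) (g x) => ? ? [].
- have := sqintD si si'; congr sqint.
  by apply/funext => x /=; case: (f x) (g x) => ? ? [].
Qed.

Lemma L2B f g : L2 mu f -> L2 mu g -> L2 mu (fun x => f x - g x).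
Proof.
move=> lf lg; have := L2D lf (L2Zl (-1) lg).
by under eq_fun do rewrite mulN1r.
Qed.

Lemma L2_0 : L2 mu (fun=> 0).
Proof. by apply/L2P; split; exact: sqint0. Qed.

Lemma nm_eq0 f : L2 mu f -> nm f = 0 -> ae_eq mu setT f (fun=> 0).
Proof.
move=> /L2P[sr si] /eqP; rewrite paddr_eq0 ?ip_ge0// => /andP[/eqP r0 /eqP i0].
have := ip_eq0 si i0; apply: filterS2 (ip_eq0 sr r0) => x /(_ I) h1 /(_ I) h2 _.
by move: h1 h2; case: (f x) => a b /= -> ->.
Qed.

Lemma nmD_le f g (a : R) : 0 < a -> L2 mu f -> L2 mu g ->
  nm (fun x => f x + g x) <= (1 + a) * nm f + (1 + a^-1) * nm g.
Proof.
move=> a0 /L2P[sr si] /L2P[sr' si'].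
have -> : nm (fun x => f x + g x) =
  ip mu (fun x => complex.Re (f x) + complex.Re (g x))
        (fun x => complex.Re (f x) + complex.Re (g x)) +
  ip mu (fun x => complex.Im (f x) + complex.Im (g x))
        (fun x => complex.Im (f x) + complex.Im (g x)).
  by congr (_ + _); apply: eq_Rintegral => x _; case: (f x) (g x) => ? ? [].
have := lerD (ip_sqrD_le a0 sr sr') (ip_sqrD_le a0 si si').
by move=> /le_trans; apply; rewrite /nm; lra.
Qed.

End complex_square_integrable.

(** * Trigonometric integrals over a period *)

Section trigonometric_integrals.
Context {R : realType}.
Local Notation mu := (@lebesgue_measure R).

Lemma continuous_is_derive (f df : R -> R) :
  (forall x : R, is_derive x 1 f (df x)) -> continuous f.
Proof.
move=> fdf x; apply/differentiable_continuous/derivable1_diffP.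
exact: (@ex_derive _ _ _ _ _ _ _ (fdf x)).
Qed.

(** [df] provides the continuity of [f] that the fundamental theorem of calculus asks for. *)
Lemma integral_derive (F f df : R -> R) (a b : R) : a < b ->
  (forall x : R, is_derive x 1 F (f x)) -> (forall x : R, is_derive x 1 f (df x)) ->
  (\int[mu]_(x in `[a, b]) (f x)%:E)%E = (F b - F a)%:E.
Proof.
move=> ab dF df'; rewrite EFinB; apply: continuous_FTC2 => //.
- by apply: continuous_subspaceT; exact: continuous_is_derive df'.
- split.
  + by move=> x _; exact: (@ex_derive _ _ _ _ _ _ _ (dF x)).
  + by apply: cvg_at_right_filter; exact: continuous_is_derive dF a.
  + by apply: cvg_at_left_filter; exact: continuous_is_derive dF b.
- by move=> x _; rewrite derive1E; exact: (@derive_val _ _ _ _ _ _ _ (dF x)).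
Qed.

Lemma is_derive_mull (m t : R) : is_derive t 1 (fun t => m * t) m.
Proof.
have := is_deriveZ m (is_derive_id t (1 : R)).
by rewrite [X in is_derive _ _ _ X]mulr1.
Qed.

Lemma is_derive_cosM (m t : R) :
  is_derive t 1 (fun t => cos (m * t)) (- m * sin (m * t)).
Proof.
rewrite mulNr mulrC -mulNr.
exact: (is_derive1_comp (is_derive_cos (m * t)) (is_derive_mull m t)).
Qed.

Lemma is_derive_sinM (m t : R) :
  is_derive t 1 (fun t => sin (m * t)) (m * cos (m * t)).
Proof.
rewrite mulrC.
exact: (is_derive1_comp (is_derive_sin (m * t)) (is_derive_mull m t)).
Qed.

Lemma mulrn_2pi n : n%:R * (2 * pi) = 0 + pi *+ 2 *+ n :> R.
Proof. by rewrite add0r -[RHS]mulr_natl -[pi *+ 2]mulr_natl. Qed.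

Lemma cos_2pi_nat n : cos (n%:R * (2 * pi)) = 1 :> R.
Proof. by rewrite mulrn_2pi (periodicn (@cosD2pi R)) cos0. Qed.

Lemma sin_2pi_nat n : sin (n%:R * (2 * pi)) = 0 :> R.
Proof. by rewrite mulrn_2pi (periodicn (@sinD2pi R)) sin0. Qed.

Lemma is_derive_sumx n (h : 'I_n -> R -> R) (dh : 'I_n -> R) (x : R) :
  (forall i, is_derive x 1 (h i) (dh i)) ->
  is_derive x 1 (fun t => \sum_i h i t) (\sum_i dh i).
Proof.
move=> H; have := is_derive_sum H.
by congr is_derive; apply/funext => t; rewrite fct_sumE.
Qed.

(* The frequencies 4 (j - k) are integers, so only the diagonal survives. *)
Lemma integral_trigonometric n (c s : 'I_n -> 'I_n -> R) :
  (\int[mu]_(t in `[0%R, (2 * pi)%R]) (\sum_j \sum_k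
     (c j k * cos (4 * (j%:R - k%:R) * t) + s j k * sin (4 * (j%:R - k%:R) * t)))%:E)%E
  = (2 * pi * \sum_j c j j)%:E.
Proof.
pose m (j k : 'I_n) : R := 4 * (j%:R - k%:R).
pose G j k t := if j == k then c j k * t else
  (c j k / m j k) * sin (m j k * t) + (- s j k / m j k) * cos (m j k * t).
pose g j k t := c j k * cos (m j k * t) + s j k * sin (m j k * t).
pose dg j k t := c j k * (- m j k * sin (m j k * t)) + s j k * (m j k * cos (m j k * t)).
have m_neq0 j k : j != k -> m j k != 0.
  by move=> jk; rewrite mulf_neq0 ?pnatr_eq0// subr_eq0 eqr_nat.
have dG j k (t : R) : is_derive t 1 (G j k) (g j k t).
  rewrite /G /g; have [->|jk] := eqVneq j k.
    rewrite /m subrr mulr0 mul0r cos0 sin0 mulr0 addr0 mulr1.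
    exact: is_derive_mull.
  have h1 := is_deriveZ (c j k / m j k) (is_derive_sinM (m j k) t).
  have h2 := is_deriveZ (- s j k / m j k) (is_derive_cosM (m j k) t).
  apply: (@is_derive_eq _ _ _ _ _ _ _ _ (is_deriveD h1 h2)); rewrite /GRing.scale/=.
  by field; exact: m_neq0.
have dgj j k (t : R) : is_derive t 1 (g j k) (dg j k t).
  have h1 := is_deriveZ (c j k) (is_derive_cosM (m j k) t).
  have h2 := is_deriveZ (s j k) (is_derive_sinM (m j k) t).
  exact: (is_deriveD h1 h2).
have -> : (fun t => (\sum_j \sum_k (c j k * cos (4 * (j%:R - k%:R) * t) +
    s j k * sin (4 * (j%:R - k%:R) * t)))%:E) =
    (fun t => (\sum_j \sum_k g j k t)%:E) by [].
rewrite (integral_derive _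
  (fun t => is_derive_sumx (fun j => is_derive_sumx (fun k => dG j k t)))
  (fun t => is_derive_sumx (fun j => is_derive_sumx (fun k => dgj j k t)))).
  congr EFin; rewrite -sumrB mulr_sumr; apply: eq_bigr => j _.
  rewrite -sumrB (bigD1 j)//= /G eqxx big1 ?addr0; first by rewrite mulr0; ring.
  move=> k kj; rewrite eq_sym (negbTE kj) mulr0 cos0 sin0.
  have [jk|jk] := leqP k j.
    have -> : m j k * (2 * pi) = (4 * (j - k))%:R * (2 * pi).
      by rewrite /m natrM natrB.
    by rewrite cos_2pi_nat sin_2pi_nat; ring.
  have -> : m j k * (2 * pi) = - ((4 * (k - j))%:R * (2 * pi)).
    by rewrite /m natrM natrB 1?ltnW//; ring.
  by rewrite cosN sinN cos_2pi_nat sin_2pi_nat; ring.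
by rewrite mulr_gt0// pi_gt0.
Qed.

End trigonometric_integrals.

(** The right side tends to [N] as [a] tends to 0. Its shape comes from chaining estimates of the
    form [(1 + a) X + (1 + a^-1) Y] with an approximation error [a^2] in [Y], since
    [(1 + a^-1) a^2 = a^2 + a]. *)
Lemma le_of_quadratic_slack (R : realType) (A N B C : R) :
  0 <= N -> 0 <= B -> 0 <= C ->
  (forall a, 0 < a -> a <= 1 ->
     A <= (1 + a) * ((1 + a) * N + B * (a ^+ 2 + a)) + C * (a ^+ 2 + a)) ->
  A <= N.
Proof.
move=> N0 B0 C0 h; rewrite leNgt; apply/negP => NA.
(* For [a] in (0, 1] the right side exceeds [N] by at most [a (3 N + 4 B + 2 C)], because
   [a^2 <= a]; the extra 1 makes [L] positive. *)
pose L := 3 * N + 4 * B + 2 * C + 1.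
have L0 : 0 < L by rewrite /L; lra.
pose a := Num.min 1 ((A - N) / (2 * L)).
have a0 : 0 < a by rewrite lt_min ltr01 divr_gt0 ?subr_gt0// mulr_gt0.
have a1 : a <= 1 by rewrite ge_min lexx.
have aL : a * L <= (A - N) / 2.
  have : a <= (A - N) / (2 * L) by rewrite ge_min lexx orbT.
  move=> /(ler_wpM2r (ltW L0)) /le_trans; apply.
  by rewrite le_eqVlt; apply/orP; left; apply/eqP; field; rewrite gt_eqF.
have a2 : a ^+ 2 <= a by rewrite expr2 ler_piMl// ltW.
have sB : B * (a ^+ 2 + a) <= B * (2 * a) by rewrite ler_wpM2l//; lra.
have sC : C * (a ^+ 2 + a) <= C * (2 * a) by rewrite ler_wpM2l//; lra.
have sN : a ^+ 2 * N <= a * N by rewrite ler_wpM2r.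
have sB2 : (1 + a) * (B * (a ^+ 2 + a)) <= 2 * (B * (2 * a)).
  apply: ler_pM => //; [by rewrite addr_ge0// ltW| |lra].
  by rewrite mulr_ge0// addr_ge0 ?sqr_ge0// ltW.
have := h a a0 a1; rewrite mulrDr.
have -> : (1 + a) * ((1 + a) * N) = N + 2 * (a * N) + a ^+ 2 * N by ring.
have : a * L = 3 * (a * N) + 4 * (B * a) + 2 * (C * a) + a by rewrite /L; ring.
move: sB sC sN sB2 aL; rewrite (mulrCA B) (mulrCA C).
move: (a * L) (B * a) (C * a) (a * N) (a ^+ 2 * N) (B * _) (C * _) ((1 + a) * _).
by move=> *; lra.
Qed.

(** * Evolution of eigenfunctions under the propagator *)

Section phase.
Context {R : realType}.

(** This is [exp(- i a)]. *)
Definition phase (a : R) : R[i] := (cos a +i* - sin a)%C.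

(** Law of cosines: the bracket is the real part of [exp(i a)] times the pairing of [f] with
    [phi]. *)
Lemma nm_phaseE (d : measure_display) (T : measurableType d)
    (mu : {measure set T -> \bar R}) (f : T -> R[i]) (phi : T -> R) (a : R) :
  L2 mu f -> sqint mu phi ->
  nm mu (fun x => f x - phase a * (phi x)%:C%C) =
  nm mu f - 2 * (cos a * complex.Re (pairing mu f phi) -
                 sin a * complex.Im (pairing mu f phi)) + ip mu phi phi.
Proof.
move=> /L2P[sr si] sp.
have -> : nm mu (fun x => f x - phase a * (phi x)%:C%C) =
  ip mu (fun x => complex.Re (f x) - cos a * phi x)
        (fun x => complex.Re (f x) - cos a * phi x) +
  ip mu (fun x => complex.Im (f x) - (- sin a) * phi x)
        (fun x => complex.Im (f x) - (- sin a) * phi x).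
  congr (_ + _); apply: eq_Rintegral => x _; case: (f x) => u v /=; ring.
rewrite !ip_sqrB//; try exact: sqintZ.
rewrite !(ipC mu _ (fun x => _ * phi x)) !ipZl//; try exact: sqintZ.
rewrite !(ipC mu phi (fun x => _ * phi x)) !ipZl// !(ipC mu phi).
rewrite /nm /pairing /= -/(ip _ _ _) -/(ip _ _ _).
have : cos a ^+ 2 + sin a ^+ 2 = 1 by exact: cos2Dsin2.
set c := cos a; set s := sin a => cs.
have -> : c * (c * ip mu phi phi) = ip mu phi phi - s ^+ 2 * ip mu phi phi.
  by rewrite -[X in _ = X - _]mul1r -cs; ring.
ring.
Qed.

End phase.

Section eigenfunction_evolution.
Context d (T : measurableType d) (R : realType).
Variable mu : {measure set T -> \bar R}.
Variables (S : set (T -> R)) (H : (T -> R) -> T -> R).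
Variable U : R -> (T -> R[i]) -> T -> R[i].
Hypothesis hU : unitary_propagator mu S H U.

Lemma U_L2 t f : L2 mu f -> L2 mu (U t f).
Proof. exact: (ug_L2 (proj1 hU)). Qed.

Lemma nm_U t f : L2 mu f -> nm mu (U t f) = nm mu f.
Proof.
move=> lf; apply: nm_eq_L2norm => //; first exact: U_L2.
exact: (ug_isometry (proj1 hU)).
Qed.

Section one_eigenfunction.
Variables (phi : T -> R) (l : R).
Hypotheses (Sphi : S phi) (sphi : sqint mu phi).
Hypothesis Hphi : H phi = (fun x => l * phi x).

(** The weak equation gives [i z' = l z] for the pairing [z]. Its solution is found by undoing the
    rotation: [exp(i l t) z] has zero derivative, and [h1], [h2] express the constancy of its real
    and imaginary parts. *)
Lemma pairing_evolution t f : L2 mu f ->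
  complex.Re (pairing mu (U t f) phi) =
    cos (l * t) * complex.Re (pairing mu f phi) +
    sin (l * t) * complex.Im (pairing mu f phi) /\
  complex.Im (pairing mu (U t f) phi) =
    cos (l * t) * complex.Im (pairing mu f phi) -
    sin (l * t) * complex.Re (pairing mu f phi).
Proof.
move=> lf; pose a s := complex.Re (pairing mu (U s f) phi).
pose b s := complex.Im (pairing mu (U s f) phi).
have dab (s : R) : is_derive s 1 a (l * b s) /\ is_derive s 1 b (- l * a s).
  have [[x y] [/= da db]] := (proj2 hU) f lf phi Sphi s.
  rewrite /pairing Hphi.
  have /L2P[sr si] := U_L2 s lf.
  have hr : \int[mu]_x0 (complex.Re (U s f x0) * (l * phi x0)) = l * a s.
    by rewrite -[LHS]/(ip _ _ (fun x => l * phi x)) ipZr.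
  have hi : \int[mu]_x0 (complex.Im (U s f x0) * (l * phi x0)) = l * b s.
    by rewrite -[LHS]/(ip _ _ (fun x => l * phi x)) ipZr.
  rewrite hr hi => -[] /= e1 e2.
  have {}e1 : y = - l * a s by lra.
  have {}e2 : x = l * b s by lra.
  by split; [rewrite -e2|rewrite -e1].
have cst (F : R -> R) : (forall s : R, is_derive s 1 F 0) -> F t = F 0.
  by move=> h; exact: (@is_derive_0_is_cst R F t 0 h).
have h1 : cos (l * t) * a t - sin (l * t) * b t = a 0.
  pose F (s : R) := cos (l * s) * a s - sin (l * s) * b s.
  have := cst F; rewrite /F !mulr0 cos0 sin0 mul1r mul0r subr0; apply=> s.
  have [da db] := dab s.
  have h1 := is_deriveM (is_derive_cosM l s) da.
  have h2 := is_deriveM (is_derive_sinM l s) db.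
  apply: (@is_derive_eq _ _ _ _ _ _ _ _ (is_deriveB h1 h2)).
  rewrite /GRing.scale/=; ring.
have h2 : sin (l * t) * a t + cos (l * t) * b t = b 0.
  pose F (s : R) := sin (l * s) * a s + cos (l * s) * b s.
  have := cst F; rewrite /F !mulr0 cos0 sin0 mul1r mul0r add0r; apply=> s.
  have [da db] := dab s.
  have h1' := is_deriveM (is_derive_sinM l s) da.
  have h2 := is_deriveM (is_derive_cosM l s) db.
  apply: (@is_derive_eq _ _ _ _ _ _ _ _ (is_deriveD h1' h2)).
  rewrite /GRing.scale/=; ring.
have p0 : pairing mu (U 0 f) phi = pairing mu f phi.
  have /L2P[[mr _] [mi _]] := U_L2 0 lf.
  have /L2P[[mr' _] [mi' _]] := lf.
  have u0 := ug0 (proj1 hU) lf.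
  congr (_ +i* _)%C; apply: ae_eq_ip => //; try (by case: sphi);
    by apply: filterS u0 => x /[apply] ->.
move: h1 h2; rewrite /a /b p0.
have := cos2Dsin2 (l * t).
move: (complex.Re (pairing mu (U t f) phi)) (complex.Im (pairing mu (U t f) phi)).
move: (complex.Re _) (complex.Im _) (cos _) (sin _) => p q c s a' b' cs <- <-.
split.
- transitivity ((c ^+ 2 + s ^+ 2) * a'); [by rewrite cs mul1r|by ring].
- transitivity ((c ^+ 2 + s ^+ 2) * b'); [by rewrite cs mul1r|by ring].
Qed.

Local Notation cphi := (fun x => (phi x)%:C%C).

Lemma L2_real : L2 mu cphi.
Proof. by apply/L2P; split => //; exact: sqint0. Qed.

(* Equality in the Cauchy-Schwarz inequality, both sides having norm |phi|. *)
Lemma U_eigenfunction t :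
  ae_eq mu setT (U t cphi) (fun x => phase (l * t) * (phi x)%:C%C).
Proof.
have lU := U_L2 t L2_real.
have im0 : ip mu (fun=> 0) phi = 0.
  rewrite -[RHS](mul0r (ip mu phi phi)) -ipZl//.
  by apply: eq_Rintegral => x _; rewrite !mul0r.
have : nm mu (fun x => U t cphi x - phase (l * t) * (phi x)%:C%C) = 0.
  rewrite nm_phaseE// nm_U; last exact: L2_real.
  have [-> ->] := pairing_evolution t L2_real.
  have -> : complex.Re (pairing mu cphi phi) = ip mu phi phi by [].
  have -> : complex.Im (pairing mu cphi phi) = ip mu (fun=> 0) phi by [].
  have -> : nm mu cphi = ip mu phi phi.
    by rewrite /nm /= [X in _ + X](_ : _ = 0) ?addr0// -[RHS]im0;
      apply: eq_Rintegral => x _; rewrite !mul0r.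
  rewrite im0; have := cos2Dsin2 (l * t).
  move: (cos _) (sin _) (ip _ _ _) => c s N cs.
  transitivity (2 * N - 2 * ((c ^+ 2 + s ^+ 2) * N)); first by ring.
  by rewrite cs; ring.
move/nm_eq0; rewrite /ae_eq; move=> /(_ _)/wrap[].
  apply: L2B => //; apply: L2Zl; exact: L2_real.
by apply: filterS => x /[apply] /eqP; rewrite subr_eq0 => /eqP.
Qed.

End one_eigenfunction.

(** As initial datum, [phi] turns the pairing with [psi] by [exp(- i l t)]; as test function, [psi]
    turns it by [exp(- i m t)]. At [t = pi / (l - m)] the two phases are opposite, so the pairing
    vanishes. *)
Lemma eigenfunctions_orthogonal (phi psi : T -> R) (l m : R) :
  S phi -> sqint mu phi -> H phi = (fun x => l * phi x) ->
  S psi -> sqint mu psi -> H psi = (fun x => m * psi x) ->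
  l != m -> ip mu phi psi = 0.
Proof.
move=> Sp sp Hp Sq sq Hq lm.
pose t := pi / (l - m).
have lf := L2_real sp.
have [mr mi] : measurable_fun setT (fun x => complex.Re (U t (fun x => (phi x)%:C%C) x))
   /\ measurable_fun setT (fun x => complex.Im (U t (fun x => (phi x)%:C%C) x)).
  by have /L2P[[? _] [? _]] := U_L2 t lf.
have [e1 e2] := pairing_evolution Sq sq Hq t lf.
have ev := U_eigenfunction Sp sp Hp t.
have im0 : ip mu (fun=> 0) psi = 0.
  rewrite -[RHS](mul0r (ip mu psi psi)) -ipZl//.
  by apply: eq_Rintegral => x _; rewrite !mul0r.
have r1 : complex.Re (pairing mu (U t (fun x => (phi x)%:C%C)) psi) =
    cos (l * t) * ip mu phi psi.
  rewrite -ipZl//; apply: ae_eq_ip => //; try by case: sq.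
    by apply: measurable_funM => //; case: sp.
  by apply: filterS ev => x /[apply] -> /=; rewrite mulr0 subr0.
have r2 : complex.Im (pairing mu (U t (fun x => (phi x)%:C%C)) psi) =
    (- sin (l * t)) * ip mu phi psi.
  rewrite -ipZl//; apply: ae_eq_ip => //; try by case: sq.
    by apply: measurable_funM => //; case: sp.
  by apply: filterS ev => x /[apply] -> /=; rewrite mulr0 add0r.
move: e1 e2; rewrite {}r1 {}r2.
have -> : complex.Re (pairing mu (fun x => (phi x)%:C%C) psi) = ip mu phi psi by [].
have -> : complex.Im (pairing mu (fun x => (phi x)%:C%C) psi) = ip mu (fun=> 0) psi by [].
have -> : l * t = m * t + pi by rewrite /t; field; rewrite subr_eq0.
rewrite im0 cosDpi sinDpi.
have := cos2Dsin2 (m * t).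
move: (cos _) (sin _) (ip _ _ _) => c s N cs e1 e2.
have c0 : c * N = 0 by lra.
have s0 : s * N = 0 by lra.
by rewrite -[LHS]mul1r -cs mulrDl !expr2 -!mulrA c0 s0 !mulr0 addr0.
Qed.

End eigenfunction_evolution.

(** * Finite combinations of real functions with complex coefficients *)

Section spans.
Context d (T : measurableType d) (R : realType).
Variable mu : {measure set T -> \bar R}.
Implicit Types (a : nat -> R[i]) (phi : nat -> T -> R).

Definition span n a phi (x : T) : R[i] := \sum_(k < n) a k * (phi k x)%:C%C.

Lemma Re_span n a phi x :
  complex.Re (span n a phi x) = \sum_(k < n) complex.Re (a k) * phi k x.
Proof.
rewrite /span; elim: n => [|n ih]; first by rewrite !big_ord0.
rewrite !big_ord_recr/= -ih; case: (\sum_(_ < _) _) => u v.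
by case: (a n) => p q /=; ring.
Qed.

Lemma Im_span n a phi x :
  complex.Im (span n a phi x) = \sum_(k < n) complex.Im (a k) * phi k x.
Proof.
rewrite /span; elim: n => [|n ih]; first by rewrite !big_ord0.
rewrite !big_ord_recr/= -ih; case: (\sum_(_ < _) _) => u v.
by case: (a n) => p q /=; ring.
Qed.

Lemma L2_span n a phi : (forall k, sqint mu (phi k)) -> L2 mu (span n a phi).
Proof.
move=> sphi; apply/L2P; split.
- under eq_fun do rewrite Re_span.
  by apply: (@sqint_sum _ _ _ _ _ (fun k x => complex.Re (a k) * phi k x)) => k;
    exact: sqintZ.
- under eq_fun do rewrite Im_span.
  by apply: (@sqint_sum _ _ _ _ _ (fun k x => complex.Im (a k) * phi k x)) => k;
    exact: sqintZ.
Qed.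

Lemma ip_span n (a : nat -> R) phi : (forall k, sqint mu (phi k)) ->
  ip mu (fun x => \sum_(k < n) a k * phi k x) (fun x => \sum_(k < n) a k * phi k x)
  = \sum_(j < n) \sum_(k < n) a j * a k * ip mu (phi j) (phi k).
Proof.
move=> sphi.
have sa k : sqint mu (fun x => a k * phi k x) by exact: sqintZ.
have ssum : sqint mu (fun x => \sum_(k < n) a k * phi k x) by exact: (sqint_sum n sa).
rewrite (ip_suml n sa ssum); apply: eq_bigr => j _.
rewrite ipC (ip_suml n sa (sa j)); apply: eq_bigr => k _.
by rewrite ipZl// ipZr// (ipC _ (phi k)); ring.
Qed.

Lemma nm_span n a phi : (forall k, sqint mu (phi k)) ->
  nm mu (span n a phi) = \sum_(j < n) \sum_(k < n)
    (complex.Re (a j) * complex.Re (a k) + complex.Im (a j) * complex.Im (a k)) *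
    ip mu (phi j) (phi k).
Proof.
move=> sphi; rewrite /nm.
have -> : (fun x => complex.Re (span n a phi x)) =
    (fun x => \sum_(k < n) complex.Re (a k) * phi k x).
  by apply/funext => x; rewrite Re_span.
have -> : (fun x => complex.Im (span n a phi x)) =
    (fun x => \sum_(k < n) complex.Im (a k) * phi k x).
  by apply/funext => x; rewrite Im_span.
rewrite (ip_span n (fun k => complex.Re (a k)) sphi).
rewrite (ip_span n (fun k => complex.Im (a k)) sphi) -big_split/=; apply: eq_bigr => j _.
by rewrite -big_split/=; apply: eq_bigr => k _; rewrite mulrDl.
Qed.

End spans.

(** * Weighted energies at a fixed time *)

Section weighted_energy.
Context d (T : measurableType d) (R : realType).
Variable mu : {measure set T -> \bar R}.
Implicit Types (r : T -> R) (f g : T -> R[i]).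

Definition scale r f (x : T) : R[i] := (r x)%:C%C * f x.

(** The integral of [r^2 |f|^2]: the weight [1/s] will enter through its square root [r]. It is
    extended-valued because [r] may be unbounded. *)
Definition energy r f : \bar R := (\int[mu]_x
  ((complex.Re (scale r f x)) ^+ 2 + (complex.Im (scale r f x)) ^+ 2)%:E)%E.

Lemma Re_scale r f x : complex.Re (scale r f x) = r x * complex.Re (f x).
Proof. by rewrite /scale; case: (f x) => u v /=; ring. Qed.

Lemma Im_scale r f x : complex.Im (scale r f x) = r x * complex.Im (f x).
Proof. by rewrite /scale; case: (f x) => u v /=; ring. Qed.

Lemma scaleE r f x : (complex.Re (scale r f x)) ^+ 2 + (complex.Im (scale r f x)) ^+ 2
  = r x ^+ 2 * ((complex.Re (f x)) ^+ 2 + (complex.Im (f x)) ^+ 2).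
Proof. by rewrite Re_scale Im_scale; ring. Qed.

Lemma measurable_energy r f : measurable_fun setT r -> L2 mu f ->
  measurable_fun setT (fun x => ((complex.Re (scale r f x)) ^+ 2 +
    (complex.Im (scale r f x)) ^+ 2)%:E).
Proof.
move=> mr /L2P[[mu_ _] [mv _]]; apply: measurable_sqr_normc.
- by under eq_fun do rewrite Re_scale; exact: measurable_funM.
- by under eq_fun do rewrite Im_scale; exact: measurable_funM.
Qed.

Lemma energy_ge0 r f : (0 <= energy r f)%E.
Proof. by apply: integral_ge0 => x _; rewrite lee_fin addr_ge0// sqr_ge0. Qed.

Lemma ae_eq_energy r f g : measurable_fun setT r -> L2 mu f -> L2 mu g ->
  ae_eq mu setT f g -> energy r f = energy r g.
Proof.
move=> mr lf lg fg; apply: ae_eq_integral => //; try exact: measurable_energy.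
by apply: filterS fg => x /[apply]; rewrite !scaleE => ->.
Qed.

Lemma L2_scale_bounded r K f : measurable_fun setT r -> (forall x, `|r x| <= K) ->
  L2 mu f -> L2 mu (scale r f) /\ nm mu (scale r f) <= K ^+ 2 * nm mu f.
Proof.
move=> mr rK /L2P[sr si].
have h (g : T -> R) x : (r x * g x) ^+ 2 <= K ^+ 2 * g x ^+ 2.
  rewrite exprMn ler_wpM2r ?sqr_ge0// -[leLHS]real_normK ?num_real//.
  by rewrite ler_sqr ?nnegrE// (le_trans _ (rK x)).
have bd (g : T -> R) : sqint mu g -> sqint mu (fun x => r x * g x).
  move=> sg; apply: (integral_sqr_lty_le (sqr_ge0 K) _ sg) => [|x]; last exact: h.
  by apply: measurable_funM => //; case: sg.
have bd' (g : T -> R) : sqint mu g ->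
    ip mu (fun x => r x * g x) (fun x => r x * g x) <= K ^+ 2 * ip mu g g.
  move=> sg; rewrite -lee_fin EFinM -!ipE//; last exact: bd.
  rewrite -ge0_integralZl_EFin ?sqr_ge0//; first apply: ge0_le_integral => //.
  - by move=> x _; rewrite lee_fin sqr_ge0.
  - by apply: measurable_sqr; case: (bd _ sg).
  - by apply: measurable_funeM; apply: measurable_sqr; case: sg.
  - by move=> x _; rewrite -EFinM lee_fin h.
  - by move=> x _; rewrite lee_fin sqr_ge0.
  - by apply: measurable_sqr; case: sg.
have eR : (fun x => complex.Re (scale r f x)) = (fun x => r x * complex.Re (f x)).
  by apply/funext => x; rewrite Re_scale.
have eI : (fun x => complex.Im (scale r f x)) = (fun x => r x * complex.Im (f x)).
  by apply/funext => x; rewrite Im_scale.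
split; first by apply/L2P; rewrite eR eI; split; exact: bd.
by rewrite /nm eR eI mulrDr lerD// bd'.
Qed.

(** The counterpart of [nmD_le], proved pointwise so that infinite energies are covered. *)
Lemma energyD_le r f g (a : R) : 0 < a -> measurable_fun setT r ->
  L2 mu f -> L2 mu g ->
  (energy r (fun x => f x + g x)%R <=
   (1 + a)%:E * energy r f + (1 + a^-1)%:E * energy r g)%E.
Proof.
move=> a0 mr lf lg.
have ai0 : 0 < a^-1 by rewrite invr_gt0.
have ge0 (h : T -> R[i]) x : setT x -> (0 <= ((complex.Re (scale r h x)) ^+ 2 +
    (complex.Im (scale r h x)) ^+ 2)%:E)%E.
  by rewrite lee_fin addr_ge0// sqr_ge0.
have a1 : 0 <= 1 + a by rewrite addr_ge0// ltW.
have ai1 : 0 <= 1 + a^-1 by rewrite addr_ge0// ltW.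
rewrite -!ge0_integralZl_EFin//; try solve [exact: ge0 | exact: measurable_energy].
rewrite -ge0_integralD//; last 4 first.
- by move=> x _; rewrite mule_ge0 ?ge0// lee_fin.
- by apply: measurable_funeM; exact: measurable_energy.
- by move=> x _; rewrite mule_ge0 ?ge0// lee_fin.
- by apply: measurable_funeM; exact: measurable_energy.
apply: ge0_le_integral => //.
- exact: ge0.
- by apply: measurable_energy => //; exact: L2D.
- by apply: emeasurable_funD; apply: measurable_funeM; exact: measurable_energy.
- move=> x _; rewrite -!EFinM -EFinD lee_fin !scaleE.
  have key (u v : R) : (u + v) ^+ 2 <= (1 + a) * u ^+ 2 + (1 + a^-1) * v ^+ 2.
    rewrite -subr_ge0.
    have -> : (1 + a) * u ^+ 2 + (1 + a^-1) * v ^+ 2 - (u + v) ^+ 2 =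
        a^-1 * (a * u - v) ^+ 2 by field; rewrite gt_eqF.
    by rewrite mulr_ge0 ?sqr_ge0// ltW.
  case: (f x) (g x) => u v [u' v'] /=.
  have := lerD (key u u') (key v v').
  move=> /(ler_wpM2l (sqr_ge0 (r x))) /le_trans; apply.
  by rewrite le_eqVlt; apply/orP; left; apply/eqP; ring.
Qed.

Lemma energy_le r r' f : measurable_fun setT r -> measurable_fun setT r' ->
  (forall x, `|r x| <= `|r' x|) -> L2 mu f -> (energy r f <= energy r' f)%E.
Proof.
move=> mr mr' rr' lf; apply: ge0_le_integral => //.
- by move=> x _; rewrite lee_fin addr_ge0// sqr_ge0.
- exact: measurable_energy.
- exact: measurable_energy.
- move=> x _; rewrite lee_fin !scaleE ler_wpM2r//.
    by rewrite addr_ge0// sqr_ge0.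
  by rewrite -[leLHS]real_normK ?num_real// -[leRHS]real_normK ?num_real// ler_sqr ?nnegrE.
Qed.

End weighted_energy.

(** * The spacetime identity on the closed span of the eigenfunctions *)

Section spacetime_energy.
Context d (T : measurableType d) (R : realType).
Variable mu : {measure set T -> \bar R}.
Variables (S : set (T -> R)) (H : (T -> R) -> T -> R).
Variable U : R -> (T -> R[i]) -> T -> R[i].
Hypothesis hU : unitary_propagator mu S H U.
Variable phi : nat -> T -> R.
Hypothesis Sphi : forall k, S (phi k).
Hypothesis sphi : forall k, sqint mu (phi k).
Hypothesis Hphi : forall k, H (phi k) = (fun x => (4 * k%:R + 3) * phi k x).
Variable r : T -> R.
Hypothesis mr : measurable_fun setT r.
Hypothesis srphi : forall k, sqint mu (fun x => r x * phi k x).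
Hypothesis rphi : forall k,
  ip mu (fun x => r x * phi k x) (fun x => r x * phi k x) = 2 * ip mu (phi k) (phi k).

Local Notation rphi_ := (fun k x => r x * phi k x).
Local Notation leb := (@lebesgue_measure R).

Definition spacetime_energy (v : T -> R) (f : T -> R[i]) : \bar R :=
  (\int[leb]_(t in `[0%R, (2 * pi)%R]) energy mu v (U t f))%E.

Lemma U0 t : ae_eq mu setT (U t (fun=> 0)) (fun=> 0).
Proof.
have l0 := L2_0 mu.
(* With [a = -1] and both functions zero, linearity reads [U t 0 = - U t 0 + U t 0]. *)
have := ug_linear (proj1 hU) t (-1) l0 l0.
have -> : (fun x : T => -1 * (0 : R[i]) + 0) = (fun=> 0).
  by apply/funext => x; rewrite mulr0 addr0.
by apply: filterS => x /[apply] ->; rewrite mulN1r addNr.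
Qed.

Lemma U_span t n a : ae_eq mu setT (U t (span n a phi))
  (span n (fun k => a k * phase ((4 * k%:R + 3) * t)) phi).
Proof.
elim: n => [|n ih].
  have E0 b : span 0 b phi = (fun=> 0).
    by apply/funext => x; rewrite /span big_ord0.
  by rewrite !E0; exact: U0.
have -> : span n.+1 a phi =
    (fun x => a n * (phi n x)%:C%C + span n a phi x).
  by apply/funext => x; rewrite /span big_ord_recr addrC.
have lp := L2_real (sphi n).
have h1 := ug_linear (proj1 hU) t (a n) lp (L2_span n a sphi).
have h2 := U_eigenfunction hU (Sphi n) (sphi n) (Hphi n) t.
move: h1 ih h2; apply: filterS3 => x /(_ I) e1 /(_ I) e2 /(_ I) e3 _.
by rewrite e1 e2 e3 /span big_ord_recr/= mulrA addrC.
Qed.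

Lemma energy_span n a : energy mu r (span n a phi) = (nm mu (span n a rphi_))%:E.
Proof.
rewrite -nmE; last exact: L2_span.
apply: eq_integral => x _; rewrite !Re_scale !Im_scale !Re_span !Im_span.
by congr (_ ^+ 2 + _ ^+ 2)%:E; rewrite mulr_sumr; apply: eq_bigr => k _; ring.
Qed.

Lemma ip_phi_neq j k : j != k -> ip mu (phi j) (phi k) = 0.
Proof.
move=> jk; apply: (eigenfunctions_orthogonal hU (Sphi j) (sphi j) (Hphi j)
  (Sphi k) (sphi k) (Hphi k)).
by rewrite (inj_eq (addIr _)) (inj_eq (mulfI _)) ?pnatr_eq0// eqr_nat.
Qed.

Lemma nm_span_orthogonal n a : nm mu (span n a phi) = \sum_(k < n)
  (complex.Re (a k) ^+ 2 + complex.Im (a k) ^+ 2) * ip mu (phi k) (phi k).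
Proof.
rewrite nm_span//; apply: eq_bigr => j _.
rewrite (bigD1 j)//= big1 ?addr0; first by rewrite -!expr2.
by move=> k kj; rewrite ip_phi_neq ?mulr0// eq_sym.
Qed.

Lemma spacetime_energy_span n a :
  spacetime_energy r (span n a phi) = (4 * pi * nm mu (span n a phi))%:E.
Proof.
pose W j k := ip mu (rphi_ j) (rphi_ k).
(* [P + i Q] is [a j] times the conjugate of [a k]. The phases multiply it by
   [exp(- i 4 (j - k) t)], and the real part of the product is [P cos + Q sin]. *)
pose P j k := complex.Re (a j) * complex.Re (a k) + complex.Im (a j) * complex.Im (a k).
pose Q j k := complex.Im (a j) * complex.Re (a k) - complex.Re (a j) * complex.Im (a k).
transitivity (\int[leb]_(t in `[0%R, (2 * pi)%R])
  (\sum_(j < n) \sum_(k < n) (P j k * W j k * cos (4 * (j%:R - k%:R) * t) +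
     Q j k * W j k * sin (4 * (j%:R - k%:R) * t)))%:E)%E.
  apply: eq_integral => t _.
  rewrite (ae_eq_energy mr _ _ (U_span t n a)); last 2 first.
  - by apply: (U_L2 hU); exact: L2_span.
  - exact: L2_span.
  rewrite energy_span nm_span//; congr EFin.
  apply: eq_bigr => j _; apply: eq_bigr => k _.
  rewrite -/(W j k) /P /Q.
  have -> : 4 * (j%:R - k%:R) * t = (4 * j%:R + 3) * t - (4 * k%:R + 3) * t by ring.
  rewrite cosB sinB /phase; case: (a j) (a k) => p q [p' q'] /=; ring.
rewrite (integral_trigonometric (fun j k => P j k * W j k) (fun j k => Q j k * W j k)).
rewrite nm_span_orthogonal; congr EFin.
rewrite !mulr_sumr; apply: eq_bigr => j _.
by rewrite /W rphi /P; ring.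
Qed.

Lemma near_nm_UB f t0 (e : R) : L2 mu f -> 0 < e ->
  \forall t \near t0, nm mu (fun x => U t f x - U t0 f x) < e.
Proof.
move=> lf e0; have := ug_continuous (proj1 hU) t0 lf.
move=> /fine_cvg /= /cvgr0_norm_lt /(_ (Num.sqrt e)).
rewrite sqrtr_gt0 => /(_ e0); apply: filterS => t /=.
rewrite L2norm_sqrt; last by apply: L2B; exact: (U_L2 hU).
by rewrite /= ger0_norm ?sqrtr_ge0// ltr_sqrt.
Qed.

Lemma energy_nm (v : T -> R) (K : R) f : measurable_fun setT v -> (forall x, `|v x| <= K) ->
  L2 mu f -> energy mu v f = (nm mu (scale v f))%:E.
Proof. by move=> mv vK lf; rewrite -nmE//; exact: (L2_scale_bounded mv vK lf).1. Qed.

(** Any two energies differ by at most [a M + L |U s f - U t f|^2]. First [a] is fixed so that [a M]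
    is small; [L] grows with [1/a], but it is then constant while [t] approaches [t0] and strong
    continuity applies. The purpose is measurability in time. *)
Lemma continuous_energy (v : T -> R) (K : R) f : measurable_fun setT v ->
  (forall x, `|v x| <= K) -> L2 mu f ->
  continuous (fun t => nm mu (scale v (U t f))).
Proof.
move=> mv vK lf t0; pose M := K ^+ 2 * nm mu f.
have M0 : 0 <= M by rewrite mulr_ge0 ?sqr_ge0 ?nm_ge0.
have lU t : L2 mu (U t f) by exact: (U_L2 hU).
have bd t : nm mu (scale v (U t f)) <= M.
  by rewrite (le_trans (L2_scale_bounded mv vK (lU t)).2)// (nm_U hU).
have key s t (a : R) : 0 < a -> nm mu (scale v (U s f)) <= nm mu (scale v (U t f)) +
    (a * M + (1 + a^-1) * K ^+ 2 * nm mu (fun x => U s f x - U t f x)).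
  move=> a0; have a1 : 0 <= 1 + a^-1 by rewrite addr_ge0// invr_ge0 ltW.
  have lD : L2 mu (fun x => U s f x - U t f x) by exact: L2B.
  have := nmD_le a0 (L2_scale_bounded mv vK (lU t)).1 (L2_scale_bounded mv vK lD).1.
  have -> : (fun x => scale v (U t f) x + scale v (fun x => U s f x - U t f x) x)
      = scale v (U s f).
    by apply/funext => x; rewrite /scale -mulrDr addrC subrK.
  move=> /le_trans; apply; rewrite mulrDl mul1r -addrA lerD2l lerD//.
    by rewrite ler_wpM2l// ltW.
  by rewrite -mulrA ler_wpM2l// (L2_scale_bounded mv vK lD).2.
apply/cvgrPdist_le => /= e e0.
pose a := e / 2 / (M + 1).
have a0 : 0 < a by rewrite !divr_gt0// ltr_wpDl.
have aM : a * M <= e / 2.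
  rewrite /a -mulrA ler_piMr ?divr_ge0 ?(ltW e0)// mulrC ler_pdivrMr ?ltr_wpDl//.
  by rewrite mul1r lerDl.
pose L := (1 + a^-1) * K ^+ 2.
have L0 : 0 <= L by rewrite mulr_ge0 ?sqr_ge0// addr_ge0// invr_ge0 ltW.
have h0 : 0 < e / 2 / (L + 1) by rewrite !divr_gt0// ltr_wpDl.
have small x : x < e / 2 / (L + 1) -> 0 <= x -> L * x <= e / 2.
  rewrite ltr_pdivlMr ?ltr_wpDl// => xe x0; apply: le_trans (ltW xe).
  by rewrite mulrC ler_wpM2l// lerDl.
apply: filterS (near_nm_UB t0 lf h0) => t ht.
have sym : nm mu (fun x => U t0 f x - U t f x) = nm mu (fun x => U t f x - U t0 f x).
  rewrite /nm; congr (_ + _); apply: eq_Rintegral => x _;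
  by case: (U t f x) (U t0 f x) => ? ? [? ?] /=; ring.
have k1 := key t t0 a a0; have k2 := key t0 t a a0.
move: k1 k2; rewrite sym -/L.
have := small _ ht (nm_ge0 _ _).
rewrite ler_norml; move: (nm _ (fun x => _)) (nm _ _) (nm _ _) => p q w.
move: aM; move: (a * M) (L * w) => A B aM s1 k1 k2.
by apply/andP; split; lra.
Qed.

Lemma measurable_energy_time (v : T -> R) (K : R) f : measurable_fun setT v ->
  (forall x, `|v x| <= K) -> L2 mu f ->
  measurable_fun setT (fun t => energy mu v (U t f)).
Proof.
move=> mv vK lf.
have -> : (fun t => energy mu v (U t f)) = (fun t => (nm mu (scale v (U t f)))%:E).
  by apply/funext => t; apply: (energy_nm mv vK); exact: (U_L2 hU).
apply/measurable_EFinP.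
exact: (continuous_measurable_fun (continuous_energy mv vK lf)).
Qed.

Local Notation I2pi := `[0%R, (2 * pi)%R]%classic.

(** Measurability in time is a hypothesis because two kinds of weight are meant: bounded
    truncations, where it follows from continuity, and [r] itself, where it follows by a limit. *)
Lemma spacetimeD_le (v : T -> R) f g (a : R) : 0 < a -> measurable_fun setT v ->
  L2 mu f -> L2 mu g ->
  (forall h, L2 mu h -> measurable_fun setT (fun t => energy mu v (U t h))) ->
  (spacetime_energy v (fun x => f x + g x)%R <=
   (1 + a)%:E * spacetime_energy v f + (1 + a^-1)%:E * spacetime_energy v g)%E.
Proof.
move=> a0 mv lf lg mt.
have lD := L2D lf lg.
have a1 : 0 <= 1 + a by rewrite addr_ge0// ltW.
have ai1 : 0 <= 1 + a^-1 by rewrite addr_ge0// invr_ge0 ltW.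
have mt' h : L2 mu h -> measurable_fun I2pi (fun t => energy mu v (U t h)).
  by move=> lh; apply: measurable_funTS; exact: mt.
have ge0 h t : I2pi t -> (0 <= energy mu v (U t h))%E by move=> _; exact: energy_ge0.
rewrite /spacetime_energy -!ge0_integralZl_EFin//; try solve [exact: ge0 | exact: mt'].
rewrite -ge0_integralD//; last 4 first.
- by move=> t It; rewrite mule_ge0 ?ge0// lee_fin.
- by apply: measurable_funeM; exact: mt'.
- by move=> t It; rewrite mule_ge0 ?ge0// lee_fin.
- by apply: measurable_funeM; exact: mt'.
apply: ge0_le_integral => //.
- exact: ge0.
- exact: mt'.
- by apply: emeasurable_funD; apply: measurable_funeM; exact: mt'.
move=> t _; have lU h : L2 mu h -> L2 mu (U t h) by move=> lh; exact: (U_L2 hU).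
apply: le_trans (energyD_le a0 mv (lU _ lf) (lU _ lg)).
rewrite le_eqVlt; apply/orP; left; apply/eqP; apply: ae_eq_energy => //.
- exact: lU.
- by apply: L2D; exact: lU.
have := ug_linear (proj1 hU) t 1 lf lg.
under [fun x => 1 * f x + _]eq_fun do rewrite mul1r.
by apply: filterS => x /[apply] ->; rewrite mul1r.
Qed.

Lemma spacetime_bounded (v : T -> R) (K : R) f : measurable_fun setT v ->
  (forall x, `|v x| <= K) -> L2 mu f ->
  (spacetime_energy v f <= (2 * pi * K ^+ 2 * nm mu f)%:E)%E.
Proof.
move=> mv vK lf.
have lU t : L2 mu (U t f) by exact: (U_L2 hU).
apply: (@le_trans _ _ (\int[leb]_(t in I2pi) (K ^+ 2 * nm mu f)%:E)%E).
  apply: ge0_le_integral => //.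
  - by move=> t _; exact: energy_ge0.
  - by apply: measurable_funTS; exact: (measurable_energy_time mv vK lf).
  - move=> t _; rewrite (energy_nm mv vK (lU t)) lee_fin -(nm_U hU t lf).
    exact: (L2_scale_bounded mv vK (lU t)).2.
rewrite integral_cst//= lebesgue_measure_itv/= lte_fin mulr_gt0 ?pi_gt0//.
by rewrite sube0 -EFinM lee_fin mulrC mulrA.
Qed.

Hypothesis r0 : forall x, 0 <= r x.

(** Cut to 0 rather than to [K]: since [r >= 0] the truncations still increase with [K], and at each
    point they equal [r] from some [K] on. *)
Definition truncation K x := if r x <= K%:R then r x else 0.

Lemma measurable_truncation K : measurable_fun setT (truncation K).
Proof. by apply: measurable_fun_ifT => //; exact: measurable_fun_ler. Qed.

Lemma truncation_bound K x : `|truncation K x| <= K%:R.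
Proof. by rewrite /truncation; case: ifPn => h; rewrite ?normr0// ger0_norm. Qed.

Lemma truncation_le K x : `|truncation K x| <= `|r x|.
Proof. by rewrite /truncation; case: ifPn => h; rewrite ?normr0. Qed.

Lemma truncation_nd m n x : (m <= n)%N -> `|truncation m x| <= `|truncation n x|.
Proof.
move=> mn; rewrite /truncation; case: ifPn => h; rewrite ?normr0//.
by rewrite (le_trans h) ?ler_nat.
Qed.

Lemma truncation_near x : \forall K \near \oo, truncation K x = r x.
Proof.
have [N rN] : exists N, r x <= N%:R.
  by exists (Num.bound (r x)); rewrite ltW// archi_boundP.
exists N => // K /= NK; rewrite /truncation ifT//.
by rewrite (le_trans rN) ?ler_nat.
Qed.

Lemma cvg_energy_truncation f : L2 mu f ->
  energy mu (truncation K) f @[K --> \oo] --> energy mu r f.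
Proof.
move=> lf; rewrite /energy.
have -> : (fun x => ((complex.Re (scale r f x)) ^+ 2 +
    (complex.Im (scale r f x)) ^+ 2)%:E) =
    (fun x => limn (fun K => ((complex.Re (scale (truncation K) f x)) ^+ 2 +
    (complex.Im (scale (truncation K) f x)) ^+ 2)%:E)).
  apply/funext => x; apply/esym/cvg_lim => //; apply: cvg_near_cst.
  by apply: filterS (truncation_near x) => K e; rewrite !scaleE e.
apply: cvg_monotone_convergence => //.
- by move=> K; exact: (measurable_energy (measurable_truncation K) lf).
- by move=> K x _; rewrite lee_fin addr_ge0// sqr_ge0.
- move=> x _ m n mn; rewrite lee_fin !scaleE ler_wpM2r ?addr_ge0 ?sqr_ge0//.
  by rewrite -[leLHS]real_normK ?num_real// -[leRHS]real_normK ?num_real//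
    ler_sqr ?nnegrE// truncation_nd.
Qed.

Lemma measurable_truncated_energy_time K f : L2 mu f ->
  measurable_fun setT (fun t => energy mu (truncation K) (U t f)).
Proof.
by apply: measurable_energy_time;
  [exact: measurable_truncation|exact: truncation_bound].
Qed.

Lemma measurable_full_energy_time f : L2 mu f ->
  measurable_fun setT (fun t => energy mu r (U t f)).
Proof.
move=> lf; apply: (emeasurable_fun_cvg (fun K t => energy mu (truncation K) (U t f))).
  by move=> K; exact: measurable_truncated_energy_time.
by move=> t _; apply: cvg_energy_truncation; exact: (U_L2 hU).
Qed.

Lemma cvg_spacetime_truncation f : L2 mu f ->
  spacetime_energy (truncation K) f @[K --> \oo] --> spacetime_energy r f.
Proof.
move=> lf; rewrite /spacetime_energy.
have lU t : L2 mu (U t f) by exact: (U_L2 hU).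
have -> : (fun t => energy mu r (U t f)) =
    (fun t => limn (fun K => energy mu (truncation K) (U t f))).
  by apply/funext => t; apply/esym/cvg_lim => //; exact: cvg_energy_truncation.
apply: cvg_monotone_convergence => //.
- by move=> K; apply: measurable_funTS; exact: measurable_truncated_energy_time.
- by move=> K t _; exact: energy_ge0.
- move=> t _ m n mn; apply: energy_le => //; try exact: measurable_truncation.
  by move=> x; exact: truncation_nd.
Qed.

Definition in_closed_span f := L2 mu f /\
  forall e, 0 < e -> exists n a, nm mu (fun x => f x - span n a phi x) <= e.

Lemma nmBC f g : nm mu (fun x => f x - g x) = nm mu (fun x => g x - f x).
Proof.
by rewrite /nm; congr (_ + _); apply: eq_Rintegral => x _;
  case: (f x) (g x) => ? ? [? ?] /=; ring.
Qed.

(** The error is measured as [a^2], with the same [a] as in [nmD_le], because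
    [(1 + a^-1) a^2 = a^2 + a] vanishes with [a]. *)
Lemma nm_le_approx f g (a : R) : 0 < a -> L2 mu f -> L2 mu g ->
  nm mu (fun x => f x - g x) <= a ^+ 2 -> nm mu g <= (1 + a) * nm mu f + (a ^+ 2 + a).
Proof.
move=> a0 lf lg fg; have := nmD_le a0 lf (L2B lg lf).
have -> : (fun x => f x + (g x - f x)) = g by apply/funext => x; rewrite addrC subrK.
move=> /le_trans; apply; rewrite lerD2l -nmBC.
apply: (@le_trans _ _ ((1 + a^-1) * a ^+ 2)).
  by rewrite ler_wpM2l// addr_ge0// invr_ge0 ltW.
by rewrite le_eqVlt; apply/orP; left; apply/eqP; field; rewrite gt_eqF.
Qed.

(** On the span the truncated energy is at most the full one, which is known there. Since the
    truncated energy is also bounded by a multiple of [nm], this inequality passes to [L^2] limits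
    of the span. *)
Lemma spacetime_truncation_le K f : in_closed_span f ->
  (spacetime_energy (truncation K) f <= (4 * pi * nm mu f)%:E)%E.
Proof.
move=> [lf af]; have mK := measurable_truncation K.
have Qb g := spacetime_bounded mK (truncation_bound K) (f := g).
have Q0 g : (0 <= spacetime_energy (truncation K) g)%E.
  by apply: integral_ge0 => t _; exact: energy_ge0.
have Qfin g : L2 mu g -> (fine (spacetime_energy (truncation K) g))%:E =
    spacetime_energy (truncation K) g.
  by move=> lg; rewrite fineK// ge0_fin_numE// (le_lt_trans (Qb _ lg)) ?ltry.
pose C := 2 * pi * K%:R ^+ 2 : R.
have C0 : 0 <= C by rewrite !mulr_ge0 ?pi_ge0.
have p0 : 0 <= 4 * pi :> R by rewrite mulr_ge0 ?pi_ge0.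
rewrite -Qfin// lee_fin.
apply: (@le_of_quadratic_slack _ _ _ (4 * pi) C) => // [|a a0 a1].
  by rewrite mulr_ge0 ?nm_ge0.
have [n [b fb]] := af (a ^+ 2) (exprn_gt0 2 a0).
have lb := L2_span n b sphi.
have := spacetimeD_le a0 mK lb (L2B lf lb) (measurable_truncated_energy_time K).
have -> : (fun x => span n b phi x + (f x - span n b phi x)) = f.
  by apply/funext => x; rewrite addrC subrK.
rewrite -(Qfin _ lf) -(Qfin _ lb) -(Qfin _ (L2B lf lb)) -!EFinM -EFinD lee_fin => /le_trans; apply; apply: lerD.
  rewrite ler_wpM2l ?addr_ge0 ?(ltW a0)//.
  have : fine (spacetime_energy (truncation K) (span n b phi)) <=
      4 * pi * nm mu (span n b phi).
    rewrite -lee_fin Qfin// -spacetime_energy_span.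
    apply: ge0_le_integral => //.
    - by move=> t _; exact: energy_ge0.
    - by apply: measurable_funTS; exact: measurable_truncated_energy_time.
    - by apply: measurable_funTS; exact: measurable_full_energy_time.
    - move=> t _; apply: energy_le => //; first exact: truncation_le.
      exact: (U_L2 hU).
  move=> /le_trans; apply.
  have := ler_wpM2l p0 (nm_le_approx a0 lf lb fb).
  move=> /le_trans; apply.
  by rewrite le_eqVlt; apply/orP; left; apply/eqP; ring.
have : fine (spacetime_energy (truncation K) (fun x => f x - span n b phi x)) <=
    C * a ^+ 2.
  rewrite -lee_fin Qfin; last exact: L2B.
  apply: (le_trans (Qb _ (L2B lf lb))); rewrite lee_fin.
  by rewrite ler_wpM2l.
have ai : 0 <= 1 + a^-1 by rewrite addr_ge0// invr_ge0 ltW.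
move=> /(ler_wpM2l ai) /le_trans; apply.
by rewrite le_eqVlt; apply/orP; left; apply/eqP; field; rewrite gt_eqF.
Qed.

Lemma spacetime_energy_le f : in_closed_span f ->
  (spacetime_energy r f <= (4 * pi * nm mu f)%:E)%E.
Proof.
move=> af; have [lf _] := af.
rewrite -(cvg_lim _ (cvg_spacetime_truncation lf))//; apply: lime_le.
  by apply/cvg_ex; eexists; exact: cvg_spacetime_truncation lf.
by apply: nearW => K; exact: spacetime_truncation_le.
Qed.

Lemma spanB n m a b : exists c, forall x,
  span n a phi x - span m b phi x = span (n + m) c phi x.
Proof.
exists (fun k => (if (k < n)%N then a k else 0) - (if (k < m)%N then b k else 0)) => x.
rewrite /span.
have ext p q (e : nat -> R[i]) : (p <= q)%N -> \sum_(k < p) e k * (phi k x)%:C%C =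
    \sum_(k < q) (if (k < p)%N then e k else 0) * (phi k x)%:C%C.
  move=> pq; rewrite (big_ord_widen q (fun k => e k * (phi k x)%:C%C) pq).
  rewrite big_mkcond/=; apply: eq_bigr => k _.
  by case: ifP => // _; rewrite mul0r.
rewrite (ext n (n + m)%N) ?leq_addr// (ext m (n + m)%N) ?leq_addl//.
by rewrite -sumrB; apply: eq_bigr => k _; rewrite mulrBl.
Qed.

Lemma in_closed_spanB n a f : in_closed_span f ->
  in_closed_span (fun x => span n a phi x - f x).
Proof.
move=> [lf af]; split; first by apply: L2B => //; exact: L2_span.
move=> e /af[m [b fb]]; have [c cE] := spanB n m a b.
exists (n + m)%N, c; apply: le_trans fb; rewrite nmBC.
rewrite le_eqVlt; apply/orP; left; apply/eqP; congr nm; apply/funext => x.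
by rewrite -cE; ring.
Qed.

(** What remains is the reverse inequality. The difference between an approximant and [f] lies in
    the closed span too, so [spacetime_energy_le] makes its full energy small; the identity for the
    approximant then bounds [4 pi |f|^2] by the energy of [f], up to a vanishing error. *)
Theorem spacetime_energy_identity f : in_closed_span f ->
  spacetime_energy r f = (4 * pi * nm mu f)%:E.
Proof.
move=> af; have [lf af'] := af.
have p0 : 0 <= 4 * pi :> R by rewrite mulr_ge0 ?pi_ge0.
have Q0 g : (0 <= spacetime_energy r g)%E.
  by apply: integral_ge0 => t _; exact: energy_ge0.
have Qfin g : in_closed_span g -> (fine (spacetime_energy r g))%:E = spacetime_energy r g.
  move=> /spacetime_energy_le h.
  by rewrite fineK// ge0_fin_numE// (le_lt_trans h) ?ltry.
apply/eqP; rewrite eq_le spacetime_energy_le//= -Qfin// lee_fin.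
apply: (@le_of_quadratic_slack _ _ _ (4 * pi) (4 * pi)) => // [|a a0 a1].
  by rewrite fine_ge0.
have [n [b fb]] := af' (a ^+ 2) (exprn_gt0 2 a0).
have lb := L2_span n b sphi.
have ab := in_closed_spanB n b af.
have := spacetimeD_le a0 mr lf (proj1 ab) measurable_full_energy_time.
have -> : (fun x => f x + (span n b phi x - f x)) = span n b phi.
  by apply/funext => x; rewrite addrC subrK.
rewrite -(Qfin _ af) -(Qfin _ ab) spacetime_energy_span -!EFinM -EFinD lee_fin.
have : fine (spacetime_energy r (fun x => span n b phi x - f x)) <= 4 * pi * a ^+ 2.
  rewrite -lee_fin Qfin//; apply: (le_trans (spacetime_energy_le ab)).
  by rewrite lee_fin ler_wpM2l// -nmBC.
have ai : 0 <= 1 + a^-1 by rewrite addr_ge0// invr_ge0 ltW.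
move=> /(ler_wpM2l ai) h1 h2.
have {h1 h2} h3 : 4 * pi * nm mu (span n b phi) <=
    (1 + a) * fine (spacetime_energy r f) + 4 * pi * (a ^+ 2 + a).
  apply: (le_trans h2); rewrite lerD2l; apply: (le_trans h1).
  by rewrite le_eqVlt; apply/orP; left; apply/eqP; field; rewrite gt_eqF.
have fb' : nm mu (fun x => span n b phi x - f x) <= a ^+ 2 by rewrite -nmBC.
have := ler_wpM2l p0 (nm_le_approx a0 lb lf fb').
move=> /le_trans; apply; rewrite mulrDr lerD2r.
by rewrite mulrCA ler_wpM2l// addr_ge0// ltW.
Qed.

End spacetime_energy.

(** A pointwise limit of the continuous functions [x / (x^2 + 1/(n+1))]; at 0 they all vanish, in
    agreement with [0^-1 = 0]. *)
Lemma measurable_inv (R : realType) : measurable_fun setT (@GRing.inv R).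
Proof.
pose h n (x : R) := x / (x ^+ 2 + n.+1%:R^-1).
have d0 n (x : R) : 0 < x ^+ 2 + n.+1%:R^-1 by rewrite ltr_wpDl ?sqr_ge0 ?invr_gt0.
apply: (@measurable_fun_cvg _ _ _ _ h) => [n|x _].
  apply: continuous_measurable_fun => x; apply: cvgM; first exact: cvg_id.
  apply: cvgV; first by rewrite gt_eqF.
  by apply: cvgD; [exact: exprn_continuous|exact: cvg_cst].
have [->|x0] := eqVneq x 0.
  by rewrite invr0 /h; under eq_fun do rewrite mul0r; exact: cvg_cst.
have -> : x^-1 = x / (x ^+ 2 + 0) by field.
apply: cvgM; first exact: cvg_cst.
apply: cvgV; first by rewrite addr0 expf_neq0.
by apply: cvgD; [exact: cvg_cst|exact: cvg_harmonic].
Qed.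

(** By continuity from the left. It serves to evaluate at [q = 1] estimates that were obtained for
    [q < 1] by cancelling a factor [1 - q]. *)
Lemma horner_le_at1 (R : realType) (p q : {poly R}) :
  (forall x, 0 < x -> x < 1 -> p.[x] <= q.[x]) -> p.[1] <= q.[1].
Proof.
move=> pq; apply: (@ler_cvg_to _ (1 : R)^'- _ _ (horner p) (horner q)).
- by apply: cvg_at_left_filter; exact: continuous_horner.
- by apply: cvg_at_left_filter; exact: continuous_horner.
- by near=> x; apply: pq; near: x; [exact: nbhs_left_gt|exact: nbhs_left_lt].
Unshelve. all: by end_near. Qed.

(** * Moments of a homogeneous measure on the half-line *)

Section scaling_moments.
Context d (T : measurableType d) (R : realType).
Variable mu : {measure set T -> \bar R}.
Variables s b : T -> R.
Hypothesis ms : measurable_fun setT s.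
Hypothesis mb : measurable_fun setT b.
Hypothesis s_ge0 : forall x, 0 <= s x.
Implicit Types F : R -> R.

(** Integral of [F] against the image under [s] of the measure [b^2 mu]. The hypothesis [scaling]
    gives this image the homogeneity of [y^(1/2) dy] on the half-line. *)
Definition wint F : \bar R := (\int[mu]_x ((b x) ^+ 2 * F (s x))%:E)%E.

Hypothesis scaling : forall F, measurable_fun setT F ->
  (forall y : R, 0 <= y -> 0 <= F y) ->
  forall c : R, 0 < c -> wint (fun y => F (c ^+ 2 * y)) = ((c^-1 ^+ 3)%:E * wint F)%E.
Hypothesis gauss_lty : (wint (fun y => expR (- y)) < +oo)%E.

Lemma measurable_wint F : measurable_fun setT F ->
  measurable_fun setT (fun x => ((b x) ^+ 2 * F (s x))%:E).
Proof.
move=> mF; apply/measurable_EFinP; apply: measurable_funM.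
  exact: measurable_funX.
exact: measurableT_comp.
Qed.

Lemma wint_ge0 F : (forall y : R, 0 <= y -> 0 <= F y) -> (0 <= wint F)%E.
Proof.
by move=> F0; apply: integral_ge0 => x _; rewrite lee_fin mulr_ge0 ?sqr_ge0 ?F0.
Qed.

Lemma eq_wint F F' : (forall y : R, 0 <= y -> F y = F' y) -> wint F = wint F'.
Proof. by move=> FF'; apply: eq_integral => x _; rewrite FF'. Qed.

Lemma wint_le F F' : measurable_fun setT F -> measurable_fun setT F' ->
  (forall y : R, 0 <= y -> 0 <= F y) -> (forall y : R, 0 <= y -> F y <= F' y) ->
  (wint F <= wint F')%E.
Proof.
move=> mF mF' F0 FF'; apply: ge0_le_integral => //; try exact: measurable_wint.
- by move=> x _; rewrite lee_fin mulr_ge0 ?sqr_ge0 ?F0.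
- by move=> x _; rewrite lee_fin ler_wpM2l ?sqr_ge0 ?FF'.
Qed.

Lemma wintZ k F : measurable_fun setT F -> (forall y : R, 0 <= y -> 0 <= F y) ->
  0 <= k -> wint (fun y => k * F y) = (k%:E * wint F)%E.
Proof.
move=> mF F0 k0; rewrite -ge0_integralZl_EFin//; last exact: measurable_wint.
  by apply: eq_integral => x _; rewrite -EFinM; congr EFin; ring.
by move=> x _; rewrite lee_fin mulr_ge0 ?sqr_ge0 ?F0.
Qed.

Lemma wintD F F' : measurable_fun setT F -> measurable_fun setT F' ->
  (forall y : R, 0 <= y -> 0 <= F y) -> (forall y : R, 0 <= y -> 0 <= F' y) ->
  wint (fun y => F y + F' y) = (wint F + wint F')%E.
Proof.
move=> mF mF' F0 F0'; rewrite -ge0_integralD//; try exact: measurable_wint.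
- by apply: eq_integral => x _; rewrite -EFinD; congr EFin; ring.
- by move=> x _; rewrite lee_fin mulr_ge0 ?sqr_ge0 ?F0.
- by move=> x _; rewrite lee_fin mulr_ge0 ?sqr_ge0 ?F0'.
Qed.

Lemma measurable_expRM (a : R) : measurable_fun setT (fun y : R => expR (a * y)).
Proof. by apply: measurableT_comp => //; exact: mulrl_measurable. Qed.

Lemma wint_exp_lty a : 0 < a -> (wint (fun y => expR (- a * y)) < +oo)%E.
Proof.
move=> a0; have mN : measurable_fun setT (fun y : R => expR (- y)).
  by under eq_fun do rewrite -mulN1r; exact: measurable_expRM.
have := scaling mN (fun y _ => expR_ge0 (- y)) (_ : 0 < Num.sqrt a).
rewrite sqrtr_gt0 => /(_ a0).
rewrite (sqr_sqrtr (ltW a0)) => e; under eq_wint do rewrite mulNr.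
rewrite e; apply: lte_mul_pinfty; [|by []|exact: gauss_lty].
by rewrite lee_fin exprn_ge0// invr_ge0 sqrtr_ge0.
Qed.

Lemma exprn_expR_le k (a y : R) : 0 < a -> 0 <= y ->
  y ^+ k * expR (- a * y) <=
  (2 * k.+1%:R / a) ^+ k * expR (- (a / 2) * y).
Proof.
(* The choice ensures [k e <= a/2], which leaves half of the decay; [k.+1] keeps [e] positive when
   [k = 0]. *)
move=> a0 y0; pose e := a / (2 * k.+1%:R).
have k0 : 0 < k.+1%:R :> R by rewrite ltr0n.
have e0 : 0 < e by rewrite divr_gt0// mulr_gt0.
have ye : e * y <= expR (e * y) by apply: ltW; apply: lt_le_trans (expR_ge1Dx _); lra.
have h : (e * y) ^+ k <= expR (k%:R * (e * y)).
  by rewrite expRM_natl lerXn2r ?nnegrE ?expR_ge0// mulr_ge0// ltW.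
have -> : (2 * k.+1%:R / a) = e^-1 by rewrite /e invf_div.
have -> : y ^+ k = e^-1 ^+ k * (e * y) ^+ k.
  by rewrite -exprMn mulrA mulVf ?gt_eqF// mul1r.
rewrite -mulrA ler_wpM2l ?exprn_ge0 ?invr_ge0 ?(ltW e0)//.
apply: (@le_trans _ _ (expR (k%:R * (e * y)) * expR (- a * y))).
  by rewrite ler_wpM2r ?expR_ge0.
rewrite -expRD ler_expR mulrA -mulrDl ler_wpM2r//.
have : k%:R * e <= a / 2.
  have -> : k%:R * e = a / 2 * (k%:R / k.+1%:R).
    by rewrite /e; field; rewrite gt_eqF.
  by rewrite ler_piMr ?divr_ge0 ?(ltW a0)// ler_pdivrMr// mul1r ler_nat.
lra.
Qed.

Lemma measurable_exprn_expR k (a : R) :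
  measurable_fun setT (fun y : R => y ^+ k * expR (a * y)).
Proof.
by apply: measurable_funM; [exact: exprn_measurable|exact: measurable_expRM].
Qed.

Lemma wint_exprn_expR_lty k a : 0 < a ->
  (wint (fun y => (y ^+ k * expR (- a * y))%R) < +oo)%E.
Proof.
move=> a0; have a2 : 0 < a / 2 by rewrite divr_gt0.
pose C := (2 * k.+1%:R / a) ^+ k : R.
have C0 : 0 <= C by rewrite exprn_ge0// divr_ge0 ?mulr_ge0// ltW.
apply: (@le_lt_trans _ _ (wint (fun y => C * expR (- (a / 2) * y)))).
  apply: wint_le.
  - exact: measurable_exprn_expR.
  - by apply: measurable_funM => //; exact: measurable_expRM.
  - by move=> y y0; rewrite mulr_ge0 ?exprn_ge0 ?expR_ge0.
  - by move=> y y0; exact: exprn_expR_le.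
rewrite wintZ//; last exact: measurable_expRM.
by apply: lte_mul_pinfty; [rewrite lee_fin| |exact: wint_exp_lty].
Qed.

Lemma measurable_inv_expR j (a : R) :
  measurable_fun setT (fun y : R => y ^+ j / y * expR (a * y)).
Proof.
apply: measurable_funM; last exact: measurable_expRM.
by apply: measurable_funM; [exact: exprn_measurable|exact: measurable_inv].
Qed.

(** [expR (- y) / y] is singular at 0, out of reach of exponential bounds. It is the increasing
    limit of [dyadic N], and [dyadic N.+1 - dyadic N] is [4^N] times a dilate of [dyadic 1]; by
    scaling its integral is [4^N 8^-N = 2^-N] times that of [dyadic 1], so the integrals grow along
    a convergent geometric series. *)
Let dyadic N (y : R) := y^-1 * (expR (- y) - expR (- (4 ^+ N * y))).

Let measurable_dyadic N : measurable_fun setT (dyadic N).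
Proof.
apply: measurable_funM; first exact: measurable_inv.
apply: measurable_funB.
  by under eq_fun do rewrite -mulN1r; exact: measurable_expRM.
by under eq_fun do rewrite -mulNr; exact: measurable_expRM.
Qed.

Let dyadic_nd m n y : 0 <= y -> (m <= n)%N -> dyadic m y <= dyadic n y.
Proof.
move=> y0 mn; rewrite /dyadic ler_wpM2l ?invr_ge0// lerD2l lerN2 ler_expR lerN2.
by rewrite ler_wpM2r// ler_weXn2l// ler1n.
Qed.

Let dyadic_ge0 N y : 0 <= y -> 0 <= dyadic N y.
Proof.
move=> y0; apply: le_trans (dyadic_nd y0 (leq0n N)).
by rewrite /dyadic expr0 mul1r subrr mulr0.
Qed.

Let wint_dyadic1 : (wint (dyadic 1) < +oo)%E.
Proof.
apply: (@le_lt_trans _ _ (wint (fun y => 3 * expR (-1 * y)))).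
  apply: wint_le => //.
  - by apply: measurable_funM => //; exact: measurable_expRM.
  - by move=> y; exact: dyadic_ge0.
  move=> y y0; rewrite /dyadic mulN1r expr1.
  have [->|yn0] := eqVneq y 0; first by rewrite invr0 mul0r mulr_ge0 ?expR_ge0.
  have yp : 0 < y by rewrite lt_neqAle eq_sym yn0.
  rewrite mulrC ler_pdivrMr//.
  (* Here [dyadic 1 y = expR (- y) (1 - expR (- 3 y)) / y], and [1 - expR (- 3 y) <= 3 y]. *)
  have -> : - (4 * y) = - y + - (3 * y) by ring.
  rewrite expRD; have := expR_ge1Dx (- (3 * y)); have := expR_ge0 (- y).
  nra.
rewrite wintZ//; last exact: measurable_expRM.
by apply: lte_mul_pinfty; [rewrite lee_fin| |exact: wint_exp_lty].
Qed.

Let wint_dyadic N : (wint (dyadic N) <= 2%:E * wint (dyadic 1))%E.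
Proof.
suff -> : wint (dyadic N) = ((2 - 2 * 2^-1 ^+ N)%:E * wint (dyadic 1))%E.
  rewrite lee_wpmul2r ?lee_fin//; first by apply: wint_ge0 => y; exact: dyadic_ge0.
  by rewrite gerBl mulr_ge0// exprn_ge0// invr_ge0.
elim: N => [|N ih].
  rewrite expr0 mulr1 subrr mul0e -(integral0 mu setT); apply: eq_integral => x _.
  by rewrite /dyadic expr0 mul1r subrr !mulr0.
have -> : wint (dyadic N.+1) =
    wint (fun y => dyadic N y + 4 ^+ N * dyadic 1 ((2 ^+ N) ^+ 2 * y)).
  apply: eq_wint => y _; rewrite /dyadic.
  have e4 : (2 ^+ N) ^+ 2 = 4 ^+ N :> R.
    by rewrite -exprM mulnC exprM; congr (_ ^+ _); ring.
  rewrite e4 expr1 exprS -mulrA [in RHS]mulrA.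
  have -> : 4 ^+ N * (4 ^+ N * y)^-1 = y^-1.
    by rewrite invfM mulrA mulfV ?expf_neq0// mul1r.
  ring.
have mS : measurable_fun setT (fun y : R => dyadic 1 ((2 ^+ N) ^+ 2 * y)).
  by apply: (measurableT_comp (measurable_dyadic 1)); exact: mulrl_measurable.
have S0 (y : R) : 0 <= y -> 0 <= dyadic 1 ((2 ^+ N) ^+ 2 * y).
  by move=> y0; apply: dyadic_ge0; rewrite mulr_ge0 ?sqr_ge0.
rewrite wintD//; last 3 first.
- by apply: measurable_funM.
- by move=> y; exact: dyadic_ge0.
- by move=> y y0; rewrite mulr_ge0 ?exprn_ge0 ?S0.
rewrite wintZ ?exprn_ge0// (scaling (measurable_dyadic 1)); last 2 first.
- by move=> y; exact: dyadic_ge0.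
- by rewrite exprn_gt0.
rewrite ih muleA -EFinM -ge0_muleDl ?lee_fin; last 2 first.
- by rewrite subr_ge0 ler_piMr// exprn_ile1// ?invr_ge0// invf_le1// ler1n.
- by rewrite mulr_ge0 ?exprn_ge0 ?invr_ge0 ?exprn_ge0.
rewrite -EFinD; congr (_%:E * _)%E.
have -> : 4 ^+ N = (2 ^+ N) ^+ 2 :> R.
  by rewrite -exprM mulnC exprM; congr (_ ^+ _); ring.
have -> : 2^-1 ^+ N = (2 ^+ N)^-1 :> R by rewrite exprVn.
have : 2 ^+ N != 0 :> R by rewrite expf_neq0.
rewrite (_ : 2^-1 ^+ N.+1 = 2^-1 * (2 ^+ N)^-1); last by rewrite exprS exprVn.
by move: (2 ^+ N) => z z0; field.
Qed.

Lemma wint_inv_expR_lty j : (wint (fun y => (y ^+ j / y * expR (- y))%R) < +oo)%E.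
Proof.
have mwj k : measurable_fun setT (fun y : R => y ^+ k / y * expR (- y)).
  by under eq_fun do rewrite -mulN1r; exact: measurable_inv_expR.
(* For a positive exponent the singularity cancels and an exponential bound suffices; exponent 0 is
   reached from [dyadic] by monotone convergence. *)
case: j => [|j]; last first.
  apply: le_lt_trans (wint_exprn_expR_lty j ltr01); apply: wint_le => //.
  - exact: measurable_exprn_expR.
  - by move=> y y0; rewrite mulr_ge0 ?expR_ge0// divr_ge0 ?exprn_ge0.
  move=> y y0; rewrite mulN1r ler_wpM2r ?expR_ge0//.
  have [->|yn0] := eqVneq y 0; first by rewrite invr0 mulr0 exprn_ge0.
  by rewrite exprSr mulfK.
have lim y : 0 <= y -> dyadic N y @[N --> \oo] --> y ^+ 0 / y * expR (- y).
  move=> y0; rewrite expr0 mul1r.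
  have [->|yn0] := eqVneq y 0.
    by rewrite /dyadic invr0 mul0r; under eq_fun do rewrite mul0r; exact: cvg_cst.
  have yp : 0 < y by rewrite lt_neqAle eq_sym yn0.
  rewrite -[X in _ * X](subr0 (expR (- y))).
  apply: cvgM; first exact: cvg_cst.
  apply: cvgB; first exact: cvg_cst.
  have e1 : `|expR (- y)| < 1 by rewrite ger0_norm ?expR_ge0// expR_lt1 oppr_lt0.
  apply: (squeeze_cvgr _ (cvg_cst 0) (cvg_expr e1)).
  apply: nearW => N; rewrite expR_ge0/= -expRM_natl ler_expR mulrN lerN2.
  by rewrite ler_wpM2r// -natrX ler_nat ltnW// ltn_expl.
rewrite /wint.
have -> : (fun x => ((b x) ^+ 2 * ((s x) ^+ 0 / s x * expR (- s x)))%:E) =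
   (fun x => limn (fun N => ((b x) ^+ 2 * dyadic N (s x))%:E)).
  apply/funext => x; apply/esym/cvg_lim => //.
  apply: cvg_EFin; first exact: nearW.
  by apply: cvgM; [exact: cvg_cst|exact: lim].
rewrite monotone_convergence//.
- apply: (@le_lt_trans _ _ (2%:E * wint (dyadic 1))%E); last by rewrite lte_mul_pinfty ?wint_dyadic1.
  apply: lime_le; last by apply: nearW => N; exact: wint_dyadic.
  apply: ereal_nondecreasing_is_cvgn => m n mn; apply: wint_le => //.
    by move=> y; exact: dyadic_ge0.
  by move=> y y0; exact: dyadic_nd.
- by move=> N; exact: measurable_wint.
- by move=> N x _; rewrite lee_fin mulr_ge0 ?sqr_ge0// dyadic_ge0.
- by move=> x _ m n mn; rewrite lee_fin ler_wpM2l ?sqr_ge0// dyadic_nd.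
Qed.

(** By the recursion below, a constant multiple of [Gamma(j + 1/2)]. The index is shifted, with
    [y ^+ j / y] in place of [y^(j-1)], so that [j = 0] carries the weight [1/s]. *)
Definition inv_moment j : R := fine (wint (fun y => y ^+ j / y * expR (- y))).

Let w_ge0 j (a y : R) : 0 <= y -> 0 <= y ^+ j / y * expR (a * y).
Proof. by move=> y0; rewrite mulr_ge0 ?expR_ge0// divr_ge0 ?exprn_ge0. Qed.

Lemma inv_momentE j :
  wint (fun y => y ^+ j / y * expR (- y)) = (inv_moment j)%:E.
Proof.
rewrite fineK// ge0_fin_numE ?wint_inv_expR_lty//.
by apply: wint_ge0 => y y0; rewrite -mulN1r w_ge0.
Qed.

(** Parametrized by [q = c^-1], which makes the dilation factor a positive power of [q] and the
    estimates of the recursion comparisons of polynomials in [q]. *)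
Lemma inv_moment_scaled j q : 0 < q ->
  wint (fun y => y ^+ j / y * expR (- (q^-1 ^+ 2) * y)) =
  (q ^+ (2 * j + 1) * inv_moment j)%:E.
Proof.
move=> q0; have qi0 : 0 < q^-1 by rewrite invr_gt0.
have mw : measurable_fun setT (fun y : R => y ^+ j / y * expR (- y)).
  by under eq_fun do rewrite -mulN1r; exact: measurable_inv_expR.
have qn : q != 0 by rewrite gt_eqF.
have w0 (y : R) : 0 <= y -> 0 <= y ^+ j / y * expR (- y).
    by move=> y0; rewrite -mulN1r w_ge0.
have k0 : 0 <= (q ^+ 2) ^+ j / q ^+ 2 by rewrite divr_ge0 ?exprn_ge0 ?(ltW q0).
rewrite (@eq_wint _ (fun y => (q ^+ 2) ^+ j / q ^+ 2 * ((q^-1 ^+ 2 * y) ^+ j /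
    (q^-1 ^+ 2 * y) * expR (- (q^-1 ^+ 2 * y))))); last first.
  move=> y y0; rewrite mulNr mulrA; congr (_ * _).
  have [->|yn0] := eqVneq y 0; first by rewrite mulr0 invr0 !mulr0.
  rewrite [(q^-1 ^+ 2 * y) ^+ j]exprMn mulrACA.
  have -> : (q ^+ 2) ^+ j * ((q^-1 ^+ 2) ^+ j * y ^+ j) = y ^+ j.
    by rewrite mulrA -!exprMn mulfV// !expr1n mul1r.
  by field; rewrite yn0 qn.
have mw' : measurable_fun setT (fun y : R => (q^-1 ^+ 2 * y) ^+ j /
    (q^-1 ^+ 2 * y) * expR (- (q^-1 ^+ 2 * y))).
  by apply: (measurableT_comp mw); exact: mulrl_measurable.
have w0' (y : R) : 0 <= y -> 0 <= (q^-1 ^+ 2 * y) ^+ j / (q^-1 ^+ 2 * y) * expR (- (q^-1 ^+ 2 * y)).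
  by move=> y0; rewrite w0// mulr_ge0// sqr_ge0.
rewrite wintZ// (scaling mw w0 qi0) inv_momentE invrK -!EFinM mulrA; congr (_ * _)%:E.
by rewrite -exprM exprD; field.
Qed.

(** The derivative at 1 of the dilation identity is taken by inequalities. With [e = q^-2 - 1], the
    bound [1 + x <= expR x] at [x = e y] and [x = - e y] places [expR (- y) - expR (- q^-2 y)]
    between [e y expR (- q^-2 y)] and [e y expR (- y)]. Integrating against [y^(j-1)] and cancelling
    [1 - q] leaves polynomials in [q], which at [q = 1] read [2 M' <= (2 j + 1) M <= 2 M']. *)
Lemma inv_moment_rec j : inv_moment j.+1 = (j%:R + 2^-1) * inv_moment j.
Proof.
pose M := inv_moment j; pose M' := inv_moment j.+1.
have mw k (a : R) : measurable_fun setT (fun y : R => y ^+ k / y * expR (a * y)).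
  exact: measurable_inv_expR.
have bounds q : 0 < q -> q < 1 ->
    (1 + q) * q ^+ (2 * j + 3) * M' <= q ^+ 2 * (\sum_(i < 2 * j + 1) q ^+ i) * M /\
    q ^+ 2 * (\sum_(i < 2 * j + 1) q ^+ i) * M <= (1 + q) * M'.
  move=> q0 q1; pose e := q^-1 ^+ 2 - 1.
  have qi1 : 1 < q^-1 by rewrite invf_gt1.
  have e0 : 0 <= e by rewrite subr_ge0 exprn_ege1// ltW.
  have yS (y : R) k : y ^+ k.+1 / y = y * (y ^+ k / y) by rewrite exprS mulrA.
  have lo : (e * (q ^+ (2 * j.+1 + 1) * M') + q ^+ (2 * j + 1) * M <= M).
    rewrite -lee_fin EFinD EFinM -!inv_moment_scaled// -inv_momentE.
    rewrite -wintZ//; last by move=> y; exact: w_ge0.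
    rewrite -wintD//; [|by apply: measurable_funM| |by move=> y; exact: w_ge0]; last first.
      by move=> y y0; rewrite mulr_ge0// w_ge0.
    apply: wint_le => //.
    - by apply: measurable_funD => //; apply: measurable_funM.
    - by under eq_fun do rewrite -mulN1r; exact: mw.
    - by move=> y y0; apply: addr_ge0; [apply: mulr_ge0 => //|]; exact: w_ge0.
    move=> y y0; rewrite yS.
    have -> : - y = - q^-1 ^+ 2 * y + e * y by rewrite /e; ring.
    rewrite expRD; have := expR_ge1Dx (e * y).
    move=> /(ler_wpM2l (w_ge0 j (- q^-1 ^+ 2) y0)).
    move=> h; rewrite [leRHS]mulrA; apply: le_trans h.
    by rewrite le_eqVlt; apply/orP; left; apply/eqP; ring.
  have hi : M <= e * M' + q ^+ (2 * j + 1) * M.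
    rewrite -lee_fin EFinD EFinM -!inv_moment_scaled// -!inv_momentE.
    rewrite -wintZ//; last 2 first.
    - by under eq_fun do rewrite -mulN1r; exact: mw.
    - by move=> y; rewrite -mulN1r; exact: w_ge0.
    have mS : measurable_fun setT (fun y : R => e * (y ^+ j.+1 / y * expR (- y))).
      by apply: measurable_funM => //; under eq_fun do rewrite -mulN1r; exact: mw.
    have S0 (y : R) : 0 <= y -> 0 <= e * (y ^+ j.+1 / y * expR (- y)).
      by move=> y0; apply: mulr_ge0 => //; rewrite -mulN1r; exact: w_ge0.
    rewrite -wintD//; last by move=> y; exact: w_ge0.
    apply: wint_le => //.
    - by under eq_fun do rewrite -mulN1r; exact: mw.
    - by apply: measurable_funD.
    - by move=> y y0; rewrite -mulN1r w_ge0.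
    move=> y y0; rewrite yS.
    have -> : - q^-1 ^+ 2 * y = - y + - (e * y) by rewrite /e; ring.
    rewrite expRD; have := expR_ge1Dx (- (e * y)).
    move=> /(ler_wpM2l (w_ge0 j (-1) y0)); rewrite mulN1r.
    move=> h; rewrite -lerBlDl [leRHS]mulrA; apply: le_trans h.
    by rewrite le_eqVlt; apply/orP; left; apply/eqP; ring.
  have qn : q != 0 by rewrite gt_eqF.
  have q1' : 0 < 1 - q by rewrite subr_gt0.
  have eq2 : q ^+ 2 * e = (1 - q) * (1 + q) by rewrite /e; field.
  have geom : 1 - q ^+ (2 * j + 1) = (1 - q) * \sum_(i < 2 * j + 1) q ^+ i.
    by rewrite -[1 in LHS](expr1n _ (2 * j + 1)) subrXX; congr (_ * _);
      apply: eq_bigr => i _; rewrite expr1n mul1r.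
  have E1 x : (1 - q) * ((1 + q) * x) = q ^+ 2 * (e * x) by rewrite mulrA -eq2 mulrA.
  have E2 : (1 - q) * (q ^+ 2 * (\sum_(i < 2 * j + 1) q ^+ i) * M) =
      q ^+ 2 * (M - q ^+ (2 * j + 1) * M).
    by rewrite -[X in _ * (X - _)]mul1r -mulrBl geom; ring.
  split; rewrite -(ler_pM2l q1') E2 -?(mulrA (1 + q)) E1 ler_wpM2l ?sqr_ge0//.
  - by rewrite lerBrDr; move: lo; have -> : (2 * j.+1 + 1 = 2 * j + 3)%N by rewrite mulnS addnAC addnC.
  - by rewrite lerBlDr.
pose S : {poly R} := \sum_(i < 2 * j + 1) 'X^i.
have hS x : S.[x] = \sum_(i < 2 * j + 1) x ^+ i.
  by rewrite horner_sum; apply: eq_bigr => i _; rewrite hornerXn.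
have S1 : S.[1] = (2 * j + 1)%:R.
  by rewrite hS; under eq_bigr do rewrite expr1n; rewrite sumr_const card_ord.
have := @horner_le_at1 _ ((1 + 'X) * 'X^(2 * j + 3) * M'%:P) ('X^2 * S * M%:P).
have := @horner_le_at1 _ ('X^2 * S * M%:P) ((1 + 'X) * M'%:P).
rewrite !hornerE S1 !expr1n => h1 h2.
have {}h1 : 1 * (2 * j + 1)%:R * M <= (1 + 1) * M'.
  by apply: h1 => x x0 x1; rewrite !hornerE hS; case: (bounds x x0 x1).
have {}h2 : (1 + 1) * 1 * M' <= 1 * (2 * j + 1)%:R * M.
  by apply: h2 => x x0 x1; rewrite !hornerE hS; case: (bounds x x0 x1).
move: h1 h2; rewrite -/M -/M' natrD natrM; lra.
Qed.

End scaling_moments.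

(** * Laguerre polynomials of index 1/2 *)

Section laguerre.
Variable R : realType.

(** Coefficients of the Kummer series [1F1(-k; 3/2; y)], read off the equation
    [4 y p'' + (6 - 4 y) p' + 4 k p = 0]; the factor [i - k] ends the series at degree [k]. *)
Fixpoint lag_coef (k j : nat) : R := if j is i.+1
  then lag_coef k i * (4 * (i%:R - k%:R)) / (i.+1%:R * (4 * i%:R + 6)) else 1.

(* Up to a factor, the Laguerre polynomial of index 1/2 and degree k. *)
Definition lag (k : nat) : {poly R} := \poly_(j < k.+1) lag_coef k j.

Lemma lag_coef_eq0 k j : (k < j)%N -> lag_coef k j = 0.
Proof.
elim: j => // j ih; rewrite ltnS leq_eqVlt => /predU1P[->|/ih /= ->].
  by rewrite /= subrr !mulr0 mul0r.
by rewrite !mul0r.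
Qed.

Lemma coef_lag k j : (lag k)`_j = lag_coef k j.
Proof. by rewrite coef_poly; case: ltnP => // /lag_coef_eq0. Qed.

Lemma lag_coef_neq0 k j : (j <= k)%N -> lag_coef k j != 0.
Proof.
elim: j => [_|j ih jk]; first exact: oner_neq0.
have d0 : 4 * j%:R + 6 != 0 :> R by rewrite gt_eqF// ltr_wpDl ?mulr_ge0.
rewrite /= !mulf_neq0 ?ih ?(ltnW jk) ?invr_neq0 ?mulf_neq0 ?pnatr_eq0//.
by rewrite subr_eq0 eqr_nat ltn_eqF.
Qed.

Lemma size_lag k : size (lag k) = k.+1.
Proof. by rewrite size_poly_eq// lag_coef_neq0. Qed.

Lemma lag_ode k (y : R) :
  4 * y * (lag k)^`()^`().[y] + (6 - 4 * y) * (lag k)^`().[y]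
  + 4 * k%:R * (lag k).[y] = 0.
Proof.
suff : 4 *: ('X * (lag k)^`()^`()) + 6 *: (lag k)^`() - 4 *: ('X * (lag k)^`())
    + (4 * k%:R) *: lag k = 0 :> {poly R}.
  move=> /(congr1 (fun p => p.[y])).
  by rewrite !(hornerD, hornerN, hornerZ, hornerM, hornerX, horner0) => <-; ring.
have derE (p : {poly R}) i : p^`()`_i = i.+1%:R * p`_i.+1.
  by rewrite coef_deriv mulr_natl.
apply/polyP => j; rewrite !(coefD, coefZ, coefN, coefXM, derE, coef0, coef_lag).
have d0 i : 4 * i%:R + 6 != 0 :> R by rewrite gt_eqF// ltr_wpDl ?mulr_ge0.
have lS i : lag_coef k i.+1 =
  lag_coef k i * (4 * (i%:R - k%:R)) / (i.+1%:R * (4 * i%:R + 6)) by [].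
case: j => [|j].
  by rewrite eqxx lS; field.
rewrite -[j.+1 == 0%N]/false -[j.+1.-1]/j (lS j.+1).
move: (lag_coef k j.+1) => A.
have -> : (j.+2%:R = j%:R + 2 :> R) by rewrite -addn2 natrD.
have -> : (j.+1%:R = j%:R + 1 :> R) by rewrite -addn1 natrD.
have j0 : 0 <= j%:R :> R by [].
by field; rewrite !gt_eqF//; lra.
Qed.

Lemma lag_basis n (q : {poly R}) : (size q <= n)%N ->
  exists c : nat -> R, q = \sum_(k < n) c k *: lag k.
Proof.
elim: n q => [|n ih] q.
  by rewrite leqn0 size_poly_eq0 => /eqP ->; exists (fun=> 0); rewrite big_ord0.
move=> sq; have ln : lag_coef n n != 0 by exact: lag_coef_neq0.
pose a := q`_n / lag_coef n n.
have [|c qc] := ih (q - a *: lag n).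
  apply/leq_sizeP => j; rewrite leq_eqVlt => /predU1P[<-|nj].
    by rewrite coefB coefZ coef_lag /a mulfVK// subrr.
  rewrite coefB coefZ coef_lag lag_coef_eq0// mulr0 subr0.
  by apply/(leq_sizeP _ _ sq).
exists (fun k => if k == n then a else c k).
rewrite big_ord_recr/= eqxx -[LHS](subrK (a *: lag n)) qc; congr (_ + _).
by apply: eq_bigr => k _; rewrite ltn_eqF.
Qed.

End laguerre.

(** * Laguerre functions and their weighted norms *)

Section laguerre_functions.
Context d (T : measurableType d) (R : realType).
Variable mu : {measure set T -> \bar R}.
Variables s b : T -> R.
Hypothesis ms : measurable_fun setT s.
Hypothesis mb : measurable_fun setT b.
Hypothesis s_ge0 : forall x, 0 <= s x.
Hypothesis scaling : forall F : R -> R, measurable_fun setT F ->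
  (forall y : R, 0 <= y -> 0 <= F y) -> forall c : R, 0 < c ->
  wint mu s b (fun y => F (c ^+ 2 * y)) = ((c^-1 ^+ 3)%:E * wint mu s b F)%E.
Hypothesis gauss_lty : (wint mu s b (fun y => expR (- y)) < +oo)%E.

Local Notation M := (inv_moment mu s b).

(** The eigenfunctions have [a = 2^-1]; the other rates occur in the density argument. *)
Definition gmon (a : R) (j : nat) (x : T) : R := b x * (s x ^+ j * expR (- a * s x)).

Lemma measurable_gmon a j : measurable_fun setT (gmon a j).
Proof.
apply: measurable_funM => //; exact: measurableT_comp (measurable_exprn_expR _ _) ms.
Qed.

Lemma sqint_gmon a j : 0 < a -> sqint mu (gmon a j).
Proof.
move=> a0; split; first exact: measurable_gmon.
have a2 : 0 < 2 * a by rewrite mulr_gt0.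
have := wint_exprn_expR_lty ms mb s_ge0 scaling gauss_lty (2 * j) a2.
rewrite /wint; congr (_ < _)%E; apply: eq_integral => x _.
rewrite /gmon !exprMn; congr (_ * _)%:E.
by rewrite -exprM mulnC; congr (_ * _); rewrite -expRM_natl; congr expR; ring.
Qed.

(** On the half-line [F] is the indicator of 0, hence invariant under dilation: the scaling identity
    at [c = 2] makes [wint F] an eighth of itself, and it is finite by comparison with [expR (- y)].
    In other words, [b] vanishes almost everywhere on the zero set of [s]. *)
Lemma wint_eq0E (F : R -> R) : measurable_fun setT F ->
  (forall y : R, 0 <= y -> F y = (y == 0)%:R) -> wint mu s b F = 0%E.
Proof.
move=> mF FE.
have F0 y : 0 <= y -> 0 <= F y by move=> y0; rewrite FE.
have := scaling mF F0 (ltr0n R 2).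
rewrite (@eq_wint _ _ _ _ _ _ s_ge0 _ F); last first.
  move=> y y0; rewrite !FE ?mulr_ge0//.
  by rewrite mulf_eq0 expf_eq0/= pnatr_eq0.
have : (wint mu s b F < +oo)%E.
  apply: le_lt_trans gauss_lty; apply: wint_le => //.
    by under eq_fun do rewrite -mulN1r; exact: measurable_expRM.
  move=> y y0; rewrite FE//; have [->|_] := eqVneq y 0; last exact: expR_ge0.
  by rewrite oppr0 expR0.
have : (0 <= wint mu s b F)%E by exact: wint_ge0.
case: (wint mu s b F) => [w|//|//] w0 _ [] h; congr EFin.
have : w * (1 - 2^-1 ^+ 3) = 0 by rewrite mulrBr mulr1 {1}h; ring.
move=> /eqP; rewrite mulf_eq0 => /orP[/eqP//|].
by rewrite subr_eq0 => /eqP h2; exfalso; move: h2; rewrite exprVn; lra.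
Qed.

(** Only [j = 0] is delicate: at [y = 0] the convention [0^-1 = 0] turns [y ^+ 1 / y] into 0 instead
    of 1. The discrepancy is the indicator of 0, whose integral is zero by [wint_eq0E]. *)
Lemma wint_moment j : wint mu s b (fun y => y ^+ j * expR (- y)) = (M j.+1)%:E.
Proof.
rewrite -(inv_momentE ms mb s_ge0 scaling gauss_lty).
have mw k : measurable_fun setT (fun y : R => y ^+ k / y * expR (- y)).
  by under eq_fun do rewrite -mulN1r; exact: measurable_inv_expR.
pose F (y : R) : R := (y == 0)%:R.
have mF : measurable_fun setT F.
  have -> : F = \1_[set 0].
    apply/funext => y; rewrite indicE /F.
    have [->|y0] := eqVneq y 0; first by rewrite mem_set.
    by rewrite memNset//; exact/eqP.
  exact: measurable_indic.
case: j => [|j]; last first.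
  apply: eq_wint => // y y0; congr (_ * _).
  have [->|yn0] := eqVneq y 0; last by rewrite [in RHS]exprSr mulfK.
  by rewrite invr0 mulr0 expr0n.
rewrite -[RHS]adde0 -(wint_eq0E mF)// -wintD//; last first.
  by move=> y y0; rewrite mulr_ge0 ?expR_ge0// divr_ge0.
apply: eq_wint => // y y0; rewrite /F expr0 mul1r expr1.
have [->|yn0] := eqVneq y 0; last by rewrite mulfV// mul1r addr0.
by rewrite invr0 mulr0 mul0r add0r oppr0 expR0.
Qed.

Lemma ip_gmon i j : ip mu (gmon 2^-1 i) (gmon 2^-1 j) = M (i + j).+1.
Proof.
apply: EFin_inj; rewrite -wint_moment /ip /Rintegral fineK.
  apply: eq_integral => x _; congr EFin; rewrite /gmon.
  have -> : expR (- s x) = expR (- 2^-1 * s x) * expR (- 2^-1 * s x).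
    by rewrite -expRD; congr expR; field.
  by rewrite exprD; ring.
have i2 : 0 < 2^-1 :> R by rewrite invr_gt0.
have := integrable_ip (sqint_gmon i i2) (sqint_gmon j i2).
exact: integrable_fin_num.
Qed.

Definition inv_root (x : T) : R := (Num.sqrt (s x))^-1.

Lemma measurable_inv_root : measurable_fun setT inv_root.
Proof.
apply: measurableT_comp; first exact: measurable_inv.
apply: measurableT_comp => //; apply: continuous_measurable_fun.
exact: sqrt_continuous.
Qed.

Lemma sqr_inv_root x : inv_root x ^+ 2 = (s x)^-1.
Proof. by rewrite /inv_root exprVn sqr_sqrtr. Qed.

Lemma sqint_inv_root_gmon j : sqint mu (fun x => inv_root x * gmon 2^-1 j x).
Proof.
split; first by apply: measurable_funM; [exact: measurable_inv_root|exact: measurable_gmon].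
have := wint_inv_expR_lty ms mb s_ge0 scaling gauss_lty (2 * j).
rewrite /wint; congr (_ < _)%E; apply: eq_integral => x _; congr EFin.
rewrite exprMn sqr_inv_root /gmon.
have -> : expR (- s x) = expR (- 2^-1 * s x) * expR (- 2^-1 * s x).
  by rewrite -expRD; congr expR; field.
by rewrite mul2n -addnn exprD; ring.
Qed.

Lemma ip_inv_root_gmon i j :
  ip mu (fun x => inv_root x * gmon 2^-1 i x) (fun x => inv_root x * gmon 2^-1 j x)
  = M (i + j).
Proof.
apply: EFin_inj; rewrite -(inv_momentE ms mb s_ge0 scaling gauss_lty) /ip /Rintegral fineK.
  apply: eq_integral => x _; congr EFin.
  rewrite mulrACA -expr2 sqr_inv_root /gmon.
  have -> : expR (- s x) = expR (- 2^-1 * s x) * expR (- 2^-1 * s x).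
    by rewrite -expRD; congr expR; field.
  by rewrite exprD; ring.
have := integrable_ip (sqint_inv_root_gmon i) (sqint_inv_root_gmon j).
exact: integrable_fin_num.
Qed.

Definition pgauss (q : {poly R}) (x : T) : R := b x * (q.[s x] * expR (- 2^-1 * s x)).

Definition lagfun (k : nat) : T -> R := pgauss (lag R k).

Lemma pgaussE n (q : {poly R}) : (size q <= n)%N ->
  pgauss q = (fun x => \sum_(i < n) q`_i * gmon 2^-1 i x).
Proof.
move=> qn; apply/funext => x; rewrite /pgauss (horner_coef_wide _ qn).
by rewrite mulr_suml mulr_sumr; apply: eq_bigr => i _; rewrite /gmon; ring.
Qed.

Let i2 : 0 < 2^-1 :> R. Proof. by rewrite invr_gt0. Qed.

Lemma sqint_pgauss (q : {poly R}) : sqint mu (pgauss q).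
Proof.
rewrite (pgaussE (leqnn _)).
by apply: (@sqint_sum _ _ _ mu _ (fun i x => q`_i * gmon 2^-1 i x)) => i;
  apply: sqintZ; exact: sqint_gmon.
Qed.

Lemma sqint_inv_root_pgauss (q : {poly R}) : sqint mu (fun x => inv_root x * pgauss q x).
Proof.
rewrite (pgaussE (leqnn _)); under eq_fun do rewrite mulr_sumr.
apply: (@sqint_sum _ _ _ mu _ (fun i x => inv_root x * (q`_i * gmon 2^-1 i x))) => i.
under eq_fun do rewrite mulrCA.
by apply: sqintZ; exact: sqint_inv_root_gmon.
Qed.

Hypothesis lagfun_orth : forall j k, j != k -> ip mu (lagfun j) (lagfun k) = 0.

Lemma lagfun_orth_lower k (q : {poly R}) : (size q <= k)%N -> ip mu (lagfun k) (pgauss q) = 0.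
Proof.
move=> /lag_basis[c ->].
have -> : pgauss (\sum_(i < k) c i *: lag R i) =
    (fun x => \sum_(i < k) c i * lagfun i x).
  apply/funext => x; rewrite /pgauss horner_sum mulr_suml mulr_sumr.
  by apply: eq_bigr => i _; rewrite hornerZ /lagfun /pgauss; ring.
rewrite ipC (@ip_suml _ _ _ mu k (fun i x => c i * lagfun i x)) => [|i|]; last 2 first.
- by apply: sqintZ; exact: sqint_pgauss.
- exact: sqint_pgauss.
rewrite big1// => i _; rewrite ipZl; try exact: sqint_pgauss.
by rewrite lagfun_orth ?mulr0// ltn_eqF.
Qed.

(** By the recursion, [M (i + j) - 2 M (i + j + 1) = - 2 (i + j) M (i + j)]. The sum of
    [p_i p_j j M (i + j)] is the inner product of [lagfun k] with the function built on the
    derivative of [p], of lower degree, so it is 0; the sum with [i] in place of [j] is 0 by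
    symmetry. *)
Lemma ip_inv_root_lagfun k :
  ip mu (fun x => inv_root x * lagfun k x) (fun x => inv_root x * lagfun k x) =
  2 * ip mu (lagfun k) (lagfun k).
Proof.
pose p := lag R k; have sp : (size p <= k.+1)%N by rewrite size_lag.
have sg i := sqint_gmon i i2; have sr := sqint_inv_root_gmon.
have e1 : (fun x => inv_root x * lagfun k x) =
    (fun x => \sum_(i < k.+1) p`_i * (inv_root x * gmon 2^-1 i x)).
  apply/funext => x; rewrite /lagfun (pgaussE sp) mulr_sumr.
  by apply: eq_bigr => i _; rewrite mulrCA.
have dp : (size p^`() <= k)%N.
  by rewrite -ltnS -(size_lag R k); apply: lt_size_deriv; rewrite -size_poly_eq0 size_lag.
have orth : \sum_(i < k.+1) \sum_(j < k.+1) p`_i * p`_j * (j%:R * M (i + j)) = 0.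
  rewrite -[RHS](lagfun_orth_lower dp) {1}/lagfun (pgaussE sp).
  rewrite (@ip_suml _ _ _ mu k.+1 (fun i x => p`_i * gmon 2^-1 i x)) => [|i|]; last 2 first.
  - exact: sqintZ.
  - exact: sqint_pgauss.
  apply: eq_bigr => i _; rewrite ipZl//; last exact: sqint_pgauss.
  rewrite (pgaussE dp) ipC (@ip_suml _ _ _ mu k (fun j x => p^`()`_j * gmon 2^-1 j x)) => [|j|//].
    rewrite big_ord_recl mul0r mulr0 add0r mulr_sumr; apply: eq_bigr => j _.
    rewrite ipZl// ip_gmon coef_deriv -mulr_natl.
    by rewrite -[lift ord0 j : nat]/j.+1 addnS (addnC j i); ring.
  exact: sqintZ.
have orth' : \sum_(i < k.+1) \sum_(j < k.+1) p`_i * p`_j * (i%:R * M (i + j)) = 0.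
  rewrite -[RHS]orth exchange_big; apply: eq_bigr => i _; apply: eq_bigr => j _.
  by rewrite (addnC j i); ring.
rewrite e1 (ip_span k.+1 (fun i => p`_i) sr).
rewrite /lagfun (pgaussE sp) (ip_span k.+1 (fun i => p`_i) sg).
apply/eqP; rewrite -subr_eq0 mulr_sumr -sumrB; apply/eqP.
transitivity (-2 * (\sum_(i < k.+1) \sum_(j < k.+1) p`_i * p`_j * (i%:R * M (i + j)) +
   \sum_(i < k.+1) \sum_(j < k.+1) p`_i * p`_j * (j%:R * M (i + j)))); last first.
  by rewrite orth orth' addr0 mulr0.
rewrite -big_split mulr_sumr; apply: eq_bigr => i _.
rewrite -big_split !mulr_sumr -sumrB; apply: eq_bigr => j _.
rewrite ip_inv_root_gmon ip_gmon (inv_moment_rec ms mb s_ge0 scaling gauss_lty) natrD /=.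
by field.
Qed.

End laguerre_functions.

(** * Polynomials approximating a step on [0, 1] *)

Section threshold_polynomials.
Variable R : realType.
Implicit Types x : R.

(* Exponent n 2^n rather than 2^n, so that the limit also holds at x = 1/2. *)
Definition threshold n : {poly R} := (1%:P - 'X^n) ^+ (n * 2 ^ n).

Lemma threshold_itv n x : 0 <= x -> x <= 1 -> 0 <= (threshold n).[x] <= 1.
Proof.
move=> x0 x1; rewrite /threshold !(horner_exp, hornerD, hornerN, hornerX, hornerC).
have xn0 : 0 <= x ^+ n by rewrite exprn_ge0.
have xn1 : x ^+ n <= 1 by rewrite exprn_ile1.
have h0 : 0 <= 1 - x ^+ n by lra.
have h1 : 1 - x ^+ n <= 1 by lra.
by rewrite exprn_ge0//= exprn_ile1.
Qed.

Lemma bernoulli_ineq n x : 0 <= x -> x <= 1 -> 1 - n%:R * x <= (1 - x) ^+ n.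
Proof.
move=> x0 x1; elim: n => [|n ih]; first by rewrite mul0r subr0 expr0.
rewrite exprSr; apply: le_trans (ler_wpM2r _ ih); last by rewrite subr_ge0.
by have := sqr_ge0 x; have : 0 <= n%:R :> R by []; rewrite -natr1; nra.
Qed.

Lemma natr_geometric_le n x : 0 <= x -> x <= 1 -> n%:R * (1 - x) * x ^+ n <= 1.
Proof.
move=> x0 x1; suff : x ^+ n * (n%:R * (1 - x) + 1) <= 1.
  by apply: le_trans; rewrite mulrC ler_wpM2l ?exprn_ge0// lerDl.
elim: n => [|n ih]; first by rewrite expr0 mul0r add0r mulr1.
have xn1 : x ^+ n <= 1 by rewrite exprn_ile1.
have -> : x ^+ n.+1 * (n.+1%:R * (1 - x) + 1) =
    x * (x ^+ n * (n%:R * (1 - x) + 1)) + x * (1 - x) * x ^+ n.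
  by rewrite exprS -natr1; ring.
have h1 := ler_wpM2l x0 ih.
have h0 : 0 <= x * (1 - x) by rewrite mulr_ge0// subr_ge0.
have h2 := ler_wpM2l h0 xn1; apply: le_trans (lerD h1 h2) _.
by have := sqr_ge0 (1 - x); nra.
Qed.

(** With [w = sqrt x], the term is [(n w^n) w^n], and [n w^n] is bounded by [1 / (1 - w)]. *)
Lemma cvg_natr_geometric x : 0 <= x -> x < 1 -> n%:R * x ^+ n @[n --> \oo] --> 0.
Proof.
move=> x0 x1; pose w := Num.sqrt x.
have w0 : 0 <= w by exact: sqrtr_ge0.
have w1 : w < 1 by rewrite -sqrtr1 ltr_sqrt.
have wx : x = w ^+ 2 by rewrite sqr_sqrtr.
have ww : 0 < 1 - w by rewrite subr_gt0.
have lim : (1 - w)^-1 * w ^+ n @[n --> \oo] --> 0.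
  rewrite -[X in _ --> X](mulr0 (1 - w)^-1); apply: cvgM; first exact: cvg_cst.
  by apply: cvg_expr; rewrite ger0_norm.
apply: (squeeze_cvgr _ (cvg_cst 0) lim); apply: nearW => n.
rewrite mulr_ge0 ?exprn_ge0//= wx -exprM mulnC exprM expr2 mulrA ler_wpM2r ?exprn_ge0//.
rewrite -(ler_pM2r ww) mulVf ?gt_eqF// mulrAC.
exact: natr_geometric_le (ltW w1).
Qed.

(** Below 1/2, Bernoulli's inequality gives the lower bound [1 - n (2 x)^n]. From 1/2 on,
    [1 - x^n <= exp(- 2^-n)], whose power of exponent [n 2^n] is [exp(- n)]. *)
Lemma cvg_threshold x : 0 <= x -> x <= 1 ->
  (threshold n).[x] @[n --> \oo] --> ((x < 2^-1)%R%:R : R).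
Proof.
move=> x0 x1.
have hE n : (threshold n).[x] = (1 - x ^+ n) ^+ (n * 2 ^ n).
  by rewrite /threshold !(horner_exp, hornerD, hornerN, hornerX, hornerC).
have xn0 n : 0 <= x ^+ n by rewrite exprn_ge0.
have xn1 n : x ^+ n <= 1 by rewrite exprn_ile1.
have [xlt|xge] := ltP x 2^-1.
  have lim : 1 - n%:R * (2 * x) ^+ n @[n --> \oo] --> (1 : R).
    rewrite -[X in _ --> X](subr0 1); apply: cvgB; first exact: cvg_cst.
    by apply: cvg_natr_geometric; [rewrite mulr_ge0|lra].
  rewrite [X in _ --> X](_ : _ = 1)//.
  apply: (squeeze_cvgr _ lim); last exact: cvg_cst.
  apply: nearW => n.
  have /andP[_ ->] := threshold_itv n x0 x1; rewrite andbT hE.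
  apply: le_trans (bernoulli_ineq _ (xn0 n) (xn1 n)).
  by rewrite natrM natrX exprMn mulrA.
have e1 : `|expR (-1)| < 1 :> R by rewrite ger0_norm ?expR_ge0// expR_lt1 oppr_lt0.
rewrite [X in _ --> X](_ : _ = 0)//.
apply: (squeeze_cvgr _ (cvg_cst 0) (cvg_expr e1)); apply: nearW => n.
have /andP[-> _] := threshold_itv n x0 x1; rewrite /= hE.
have step : 1 - x ^+ n <= expR (- 2^-1 ^+ n).
  apply: le_trans (expR_ge1Dx _); rewrite lerD2l lerN2.
  by rewrite lerXn2r ?nnegrE ?invr_ge0.
apply: (@le_trans _ _ (expR (- 2^-1 ^+ n) ^+ (n * 2 ^ n))).
  by rewrite lerXn2r ?nnegrE ?expR_ge0// subr_ge0.
by rewrite -!expRM_natl ler_expR natrM natrX exprVn mulrN mulrN1 -mulrA mulfV ?mulr1.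
Qed.

End threshold_polynomials.

(** * Density of the Laguerre functions among the functions [b F(s)] *)

Section density.
Context d (T : measurableType d) (R : realType).
Variable mu : {measure set T -> \bar R}.
Variables s b : T -> R.
Hypothesis ms : measurable_fun setT s.
Hypothesis mb : measurable_fun setT b.
Hypothesis s_ge0 : forall x, 0 <= s x.
Hypothesis scaling : forall F : R -> R, measurable_fun setT F ->
  (forall y : R, 0 <= y -> 0 <= F y) -> forall c : R, 0 < c ->
  wint mu s b (fun y => F (c ^+ 2 * y)) = ((c^-1 ^+ 3)%:E * wint mu s b F)%E.
Hypothesis gauss_lty : (wint mu s b (fun y => expR (- y)) < +oo)%E.

Local Notation gmon := (gmon s b).
Local Notation pgauss := (pgauss s b).

Let sqint_gm a j : 0 < a -> sqint mu (gmon a j).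
Proof. exact: (sqint_gmon ms mb s_ge0 scaling gauss_lty). Qed.

Let sqint_pg q : sqint mu (pgauss q).
Proof. exact: (sqint_pgauss ms mb s_ge0 scaling gauss_lty). Qed.

Definition dist2 (f g : T -> R) : R := ip mu (fun x => f x - g x) (fun x => f x - g x).

Definition approximable (f : T -> R) : Prop := sqint mu f /\
  forall e, 0 < e -> exists q, dist2 f (pgauss q) <= e.

Lemma dist2_le f g h : sqint mu f -> sqint mu g -> sqint mu h ->
  dist2 f h <= 2 * dist2 f g + 2 * dist2 g h.
Proof.
move=> sf sg sh; have := ip_sqrD_le (@ltr01 R) (sqintB sf sg) (sqintB sg sh).
rewrite invr1 -[1 + 1]/2; congr (ip _ _ _ <= _); apply/funext => x;
  by rewrite addrA subrK.
Qed.

Lemma approximable_limit f : sqint mu f ->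
  (forall e, 0 < e -> exists2 g, approximable g & dist2 f g <= e) -> approximable f.
Proof.
move=> sf h; split => // e e0; have e4 : 0 < e / 4 by rewrite divr_gt0.
have [g [sg ag] fg] := h _ e4; have [q gq] := ag _ e4.
by exists q; apply: le_trans (dist2_le sf sg (sqint_pg q)) _; lra.
Qed.

Lemma pgaussD p q x : pgauss (p + q) x = pgauss p x + pgauss q x.
Proof. by rewrite /pgauss hornerD; ring. Qed.

Lemma pgaussZ a q x : pgauss (a *: q) x = a * pgauss q x.
Proof. by rewrite /pgauss hornerZ; ring. Qed.

Lemma approximable_pgauss q : approximable (pgauss q).
Proof.
split=> // e e0; exists q; rewrite /dist2.
have -> : (fun x => pgauss q x - pgauss q x) = (fun=> 0) by apply/funext => x; rewrite subrr.
rewrite (_ : ip _ _ _ = 0) ?ltW//.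
by apply: EFin_inj; rewrite -ipE;
  [under eq_integral do rewrite expr0n; exact: integral0|exact: sqint0].
Qed.

Lemma approximableD f g : approximable f -> approximable g ->
  approximable (fun x => f x + g x).
Proof.
move=> [sf af] [sg ag]; split=> [|e e0]; first exact: sqintD.
have e4 : 0 < e / 4 by rewrite divr_gt0.
have [p fp] := af _ e4; have [q gq] := ag _ e4.
exists (p + q).
have := ip_sqrD_le (@ltr01 R) (sqintB sf (sqint_pg p)) (sqintB sg (sqint_pg q)).
rewrite invr1 -[1 + 1]/2 -/(dist2 f _) -/(dist2 g _) /dist2.
have -> : (fun x => f x + g x - pgauss (p + q) x) =
    (fun x => f x - pgauss p x + (g x - pgauss q x)).
  by apply/funext => x; rewrite pgaussD; ring.
by move/le_trans; apply; rewrite -/(dist2 f _) -/(dist2 g _); lra.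
Qed.

Lemma approximableZ a f : approximable f -> approximable (fun x => a * f x).
Proof.
move=> [sf af]; split=> [|e e0]; first exact: sqintZ.
have a20 : 0 < a ^+ 2 + 1 by rewrite ltr_wpDl ?sqr_ge0.
have [q fq] := af (e / (a ^+ 2 + 1)) (divr_gt0 e0 a20).
exists (a *: q); rewrite /dist2.
have -> : (fun x => a * f x - pgauss (a *: q) x) = (fun x => a * (f x - pgauss q x)).
  by apply/funext => x; rewrite pgaussZ; ring.
have sB := sqintB sf (sqint_pg q).
rewrite ipZl ?ipZr//; last exact: sqintZ.
rewrite mulrA -expr2; move: fq; rewrite ler_pdivlMr// /dist2.
by have := ip_ge0 mu (fun x => f x - pgauss q x); nra.
Qed.

Lemma approximable_sum n (f : nat -> T -> R) : (forall k, approximable (f k)) ->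
  approximable (fun x => \sum_(k < n) f k x).
Proof.
move=> af; elim: n => [|n ih].
  have := approximable_pgauss 0; congr approximable; apply/funext => x.
  by rewrite big_ord0 /pgauss horner0 mul0r mulr0.
by under eq_fun do rewrite big_ord_recr; exact: approximableD.
Qed.

(** The limit tool of the density argument: pointwise convergence under a square-integrable bound
    [g] is convergence in [L^2], the squared error being dominated by [(2 g)^2]. *)
Lemma approximable_dominated (f_ : nat -> T -> R) (f g : T -> R) : (forall n, approximable (f_ n)) ->
  measurable_fun setT f -> sqint mu g -> (forall n x, `|f_ n x| <= `|g x|) ->
  (forall x, f_ n x @[n --> \oo] --> f x) -> approximable f.
Proof.
move=> af mf sg fg lim.
have flim x : `|f x| <= `|g x|.
  have c : `|f_ n x| @[n --> \oo] --> `|f x| by apply: cvg_norm; exact: lim.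
  rewrite -(cvg_lim _ c)//; apply: limr_le; last by apply: nearW => n; exact: fg.
  by apply/cvg_ex; exists `|f x|.
have sf : sqint mu f by apply: sqint_le sg flim.
apply: approximable_limit => // e e0.
have mf_ n : measurable_fun setT (f_ n) by have [[]] := af n.
pose D x := ((2 * g x) ^+ 2)%:E.
have iD : mu.-integrable setT D.
  have s2g := sqintZ 2 sg.
  exact: eq_integrable (integrable_ip s2g s2g).
have mh n : measurable_fun setT (fun x => ((f x - f_ n x) ^+ 2)%:E).
  by apply/measurable_EFinP/measurable_funX; exact: measurable_funB.
have hlim x : ((f x - f_ n x) ^+ 2)%:E @[n --> \oo] --> 0%:E.
  apply: cvg_EFin; first exact: nearW.
  have -> : (0 : R) = (f x - f x) * (f x - f x) by rewrite subrr mul0r.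
  have c : f x - f_ n x @[n --> \oo] --> f x - f x.
    by apply: cvgB; [exact: cvg_cst|exact: lim].
  exact: (cvgM c c).
have dom n x : (`|((f x - f_ n x) ^+ 2)%:E| <= D x)%E.
  rewrite gee0_abs ?lee_fin ?sqr_ge0// -[leLHS]real_normK ?num_real//.
  rewrite -[leRHS]real_normK ?num_real// ler_sqr ?nnegrE// normrM (ger0_norm (ler0n _ 2)).
  rewrite (le_trans (ler_normB _ _))//.
  by have := fg n x; have := flim x; lra.
have [_ _ cv] := dominated_convergence measurableT mh (measurable_cst 0%:E)
  (aeW mu (fun x _ => hlim x)) iD (aeW mu (fun x n _ => dom n x)).
move: cv; rewrite integral0 => /fine_cvg /= /cvgr0_norm_le /(_ e e0) [N _ /(_ N)] /=.
move=> /(_ (leqnn N)) h; exists (f_ N); first exact: af.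
by apply: le_trans h; rewrite ger0_norm ?fine_ge0//; apply: integral_ge0 => x _;
  rewrite lee_fin sqr_ge0.
Qed.

Lemma approximable_gmon_half j : approximable (gmon 2^-1 j).
Proof.
have -> : gmon 2^-1 j = pgauss 'X^j; last exact: approximable_pgauss.
by apply/funext => x; rewrite /pgauss hornerXn.
Qed.

(** The power series of [exp(- t s)] turns [gmon a j] into combinations of the [gmon a (j + k)]. Its
    partial sums are bounded only by [exp(t s)], so the dominating function is [gmon (a - t) j],
    which forces short steps [t < a]. *)
Lemma approximable_gmon_step a t : 0 <= t -> t <= 4^-1 -> 2^-1 <= a ->
  (forall j, approximable (gmon a j)) -> forall j, approximable (gmon (a + t) j).
Proof.
move=> t0 t4 a2 ha j.
have at0 : 0 < a - t by lra.
pose f_ n x := \sum_(k < n) ((- t) ^+ k / k`!%:R) * gmon a (j + k) x.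
have f_E n x : f_ n x = gmon a j x * series (exp_coeff (- (t * s x))) n.
  rewrite /f_ /series /= big_mkord mulr_sumr; apply: eq_bigr => k _.
  rewrite /gmon /exp_coeff/= exprD -[- (t * s x)]mulNr [(- t * s x) ^+ k]exprMn; ring.
apply: (@approximable_dominated f_ _ (gmon (a - t) j)).
- by move=> n; apply: (@approximable_sum n (fun k x => ((- t) ^+ k / k`!%:R) * gmon a (j + k) x)) => k;
    exact: approximableZ.
- exact: measurable_gmon.
- exact: sqint_gm.
- move=> n x; rewrite f_E normrM.
  have ts0 : 0 <= t * s x by rewrite mulr_ge0.
  have h : `|series (exp_coeff (- (t * s x))) n| <= expR (t * s x).
    apply: (@le_trans _ _ (series (exp_coeff (t * s x)) n)).
      rewrite /series /= (le_trans (ler_norm_sum _ _ _))// ler_sum// => k _.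
      by rewrite /exp_coeff/= normrM normrX normrN ger0_norm// ger0_norm ?invr_ge0.
    rewrite /expR; apply: nondecreasing_cvgn_le; last exact: is_cvg_series_exp_coeff.
    by apply/nondecreasing_seqP => m; rewrite seriesSr lerDl exp_coeff_ge0.
  apply: le_trans (ler_wpM2l (normr_ge0 _) h) _.
  rewrite (_ : gmon (a - t) j x = gmon a j x * expR (t * s x)).
    by rewrite [leRHS]normrM [X in _ <= _ * X]ger0_norm ?expR_ge0.
  by rewrite /gmon -!mulrA -expRD; congr (_ * (_ * expR _)); ring.
- move=> x; under eq_fun do rewrite f_E.
  have -> : gmon (a + t) j x = gmon a j x * expR (- (t * s x)).
    rewrite /gmon -!mulrA -expRD; congr (_ * (_ * expR _)); ring.
  by apply: cvgM; [exact: cvg_cst|exact: is_cvg_series_exp_coeff].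
Qed.

Lemma approximable_gmon a j : 2^-1 <= a -> approximable (gmon a j).
Proof.
(* [N.+1] equal steps of length [t <= 1/4] lead from 1/2 to [a]. *)
move=> a2; pose N := Num.bound (4 * (a - 2^-1)).
have aN : 4 * (a - 2^-1) < N.+1%:R.
  apply: lt_le_trans (archi_boundP _) _; last by rewrite ler_nat.
  by rewrite mulr_ge0// subr_ge0.
pose t := (a - 2^-1) / N.+1%:R.
have N0 : 0 < N.+1%:R :> R by rewrite ltr0n.
have t0 : 0 <= t by rewrite divr_ge0// subr_ge0.
have t4 : t <= 4^-1 by rewrite /t ler_pdivrMr//; lra.
have h m : forall i, approximable (gmon (2^-1 + m%:R * t) i).
  elim: m => [|m ih] i; first by rewrite mul0r addr0; exact: approximable_gmon_half.
  have -> : 2^-1 + m.+1%:R * t = 2^-1 + m%:R * t + t by rewrite -natr1; ring.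
  by apply: approximable_gmon_step => //; rewrite lerDl mulr_ge0.
have := h N.+1 j; congr (approximable (gmon _ _)).
by rewrite /t mulrC divfK ?gt_eqF//; ring.
Qed.

(** A polynomial in [expR (- t * s x)] is a combination of exponentials, and [approximable_gmon]
    covers the resulting rates [1/2 + i t]. *)
Lemma approximable_exp_poly (t : R) (p : {poly R}) : 0 <= t ->
  approximable (fun x => gmon 2^-1 0 x * p.[expR (- t * s x)]).
Proof.
move=> t0.
have -> : (fun x => gmon 2^-1 0 x * p.[expR (- t * s x)]) =
    (fun x => \sum_(i < size p) p`_i * gmon (2^-1 + i%:R * t) 0 x).
  apply/funext => x; rewrite horner_coef mulr_sumr; apply: eq_bigr => i _.
  rewrite /gmon expr0 !mul1r -expRM_natl mulrCA -mulrA -expRD.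
  by congr (_ * (_ * expR _)); ring.
apply: (@approximable_sum _ (fun i x => p`_i * gmon (2^-1 + i%:R * t) 0 x)) => i.
by apply: approximableZ; apply: approximable_gmon; rewrite lerDl mulr_ge0.
Qed.

Local Notation cut A := (fun x => gmon 2^-1 0 x * \1_A (s x)).

Let measurable_cut (A : set R) : measurable A -> measurable_fun setT (cut A).
Proof.
move=> mA; apply: measurable_funM; first exact: measurable_gmon.
by apply: measurableT_comp => //; exact: measurable_indic.
Qed.

Let sqint_half : sqint mu (gmon 2^-1 0).
Proof. by apply: sqint_gm; rewrite invr_gt0. Qed.

Lemma approximable_ray_gt0 (c : R) : 0 < c -> approximable (cut `]c, +oo[).
Proof.
(* With this rate, [expR (- t * s x) < 1/2] is equivalent to [c < s x], so the threshold polynomials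
   of the exponential tend to the indicator of the ray. *)
move=> c0; pose t := ln 2 / c.
have l2 : 0 < ln 2 :> R by rewrite ln_gt0// ltr1n.
have t0 : 0 < t by rewrite divr_gt0.
have e01 x : 0 <= expR (- t * s x) <= 1.
  by rewrite expR_ge0 expR_le1 mulNr oppr_le0 mulr_ge0// ltW.
apply: (@approximable_dominated
  (fun n x => gmon 2^-1 0 x * (threshold R n).[expR (- t * s x)]) _ (gmon 2^-1 0)).
- by move=> n; apply: approximable_exp_poly; exact: ltW.
- by apply: measurable_cut.
- exact: sqint_half.
- move=> n x; have /andP[e0 e1] := e01 x.
  have /andP[p0 p1] := threshold_itv n e0 e1.
  by rewrite normrM ler_piMr// ger0_norm.
- move=> x; have /andP[e0 e1] := e01 x.
  have -> : \1_(`]c, +oo[%classic) (s x) = ((expR (- t * s x) < 2^-1)%R%:R : R).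
    rewrite indicE; congr (_%:R); congr nat_of_bool.
    have -> : 2^-1 = expR (- ln 2) :> R by rewrite expRN lnK// posrE.
    rewrite ltr_expR mulNr ltrN2 /t mulrAC ltr_pdivlMr// ltr_pM2l//.
    by apply/idP/idP; rewrite inE/= in_itv/= andbT.
  by apply: cvgM; [exact: cvg_cst|exact: cvg_threshold].
Qed.

(** The rate [ln 2 / c] asks for [c > 0]. The ray from 0 is the limit of those from [1/(n+1)], and
    for [c < 0] nothing is cut away, since [s >= 0]. *)
Lemma approximable_ray (c : R) : approximable (cut `]c, +oo[).
Proof.
have [c0|c0|->] := ltgtP c 0; last 1 first.
- apply: (@approximable_dominated (fun n => cut `](n.+1%:R^-1), +oo[) _ (gmon 2^-1 0)).
  + by move=> n; apply: approximable_ray_gt0; rewrite invr_gt0.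
  + by apply: measurable_cut.
  + exact: sqint_half.
  + by move=> n x; rewrite normrM ler_piMr// ger0_norm// indicE; case: (_ \in _).
  + move=> x; apply: cvgM; first exact: cvg_cst.
    have [s0|s0] := ltP 0 (s x); last first.
      rewrite !indicE memNset/=; last by rewrite in_itv/= andbT; apply/negP; rewrite -leNgt.
      under eq_fun => n.
        rewrite indicE memNset/=; last first.
          rewrite in_itv/= andbT; apply/negP; rewrite -leNgt (le_trans s0)//.
        over.
      exact: cvg_cst.
    apply: cvg_near_cst.
    have : \forall n \near \oo, n.+1%:R^-1 < s x.
      have := @cvg_harmonic R; move=> /cvgr0_norm_lt /(_ _ s0).
      by apply: filterS => n /=; rewrite ger0_norm// invr_ge0.
    apply: filterS => n ns; rewrite !indicE !mem_set//= in_itv/= andbT//.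
- have := approximable_gmon_half 0; congr approximable; apply/funext => x.
  by rewrite indicE mem_set ?mulr1//= in_itv/= andbT (lt_le_trans c0).
- exact: approximable_ray_gt0.
Qed.

(** Dynkin's lemma: open right rays are stable under intersection and generate the Borel sets,
    linearity gives stability under proper differences, and domination by [gmon 2^-1 0] under
    increasing unions. *)
Lemma approximable_cut (A : set R) : measurable A -> approximable (cut A).
Proof.
pose D := [set A : set R | measurable A /\ approximable (cut A)].
suff : @measurable _ (measurableTypeR R) `<=` D by move=> h mA; case: (h _ mA).
rewrite -[X in X `<=` _]/((@ocitv R).-sigma.-measurable) RGenOInfty.measurableE.
apply: lambda_system_subset => //.
- move=> _ _ [x ->] [y ->]; exists (Num.max x y).
  by apply/seteqP; split => z /=; rewrite !in_itv/= !andbT gt_max => /andP.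
- split => //.
  + split; first exact: measurableT.
    have := approximable_gmon_half 0; congr approximable; apply/funext => x.
    by rewrite indicE mem_set ?mulr1.
  + move=> B' B BA [mA aA] [mB aB]; split; first exact: measurableD.
    have := approximableD aA (approximableZ (-1) aB); congr approximable.
    apply/funext => x; rewrite !indicE in_setD.
    have [sB|sB] := boolP (s x \in B); last by rewrite andbT mulr0 mulr0 addr0.
    by rewrite (_ : s x \in B') ?mulr0 ?mulr1 ?mulN1r ?subrr//; move: sB; rewrite !inE; exact: BA.
  + move=> F nF DF; have mF n : measurable (F n) by case: (DF n).
    split; first exact: bigcupT_measurable.
    apply: (@approximable_dominated (fun n => cut (F n)) _ (gmon 2^-1 0)).
    * by move=> n; case: (DF n).
    * by apply: measurable_cut; exact: bigcupT_measurable.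
    * exact: sqint_half.
    * by move=> n x; rewrite normrM ler_piMr// ger0_norm// indicE; case: (_ \in _).
    * move=> x; apply: cvgM; first exact: cvg_cst.
      rewrite [X in _ --> X]indicE; have [/set_mem[N _ FN]|/negP nF'] := boolP (s x \in \bigcup_n F n).
        apply: cvg_near_cst; exists N => // n /= Nn.
        by rewrite indicE mem_set//; move/subsetPset: (nF _ _ Nn); apply.
      apply: cvg_near_cst; apply: nearW => n; rewrite indicE memNset//.
      by move=> Fn; apply: nF'; apply/mem_set; exists n.
- move=> _ [x ->]; split; first exact: measurable_itv.
  exact: approximable_ray.
Qed.

Import HBNNSimple.

Lemma approximable_nnsfun (h : {nnsfun measurableTypeR R >-> R}) :
  approximable (fun x => gmon 2^-1 0 x * h (s x)).
Proof.
have -> : (fun x => gmon 2^-1 0 x * h (s x)) = (fun x =>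
   \sum_(r <- finmap.enum_fset (fset_set (range h))) r * (gmon 2^-1 0 x * \1_(h @^-1` [set r]) (s x))).
  apply/funext => x; rewrite fimfunE fsbig_finite//= mulr_sumr.
  by apply: eq_bigr => r _; rewrite mulrCA.
elim: (finmap.enum_fset _) => [|r l ih].
  have := approximable_pgauss 0; congr approximable; apply/funext => x.
  by rewrite big_nil /pgauss horner0 mul0r mulr0.
under eq_fun do rewrite big_cons; apply: approximableD => //.
apply: approximableZ; apply: approximable_cut.
rewrite -[X in measurable X]setTI.
have mh : measurable_fun setT (h : measurableTypeR R -> R) by exact: measurable_funP.
have mr : measurable [set r : R] by exact: measurable_set1.
exact: (mh measurableT _ mr).
Qed.

Lemma approximable_ge0 (F : R -> R) : measurable_fun setT F ->
  (forall y, 0 <= F y) -> sqint mu (fun x => gmon 2^-1 0 x * F (s x)) ->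
  approximable (fun x => gmon 2^-1 0 x * F (s x)).
Proof.
move=> mF F0 sF.
have mEF : measurable_fun [set: measurableTypeR R] (EFin \o F) by apply/measurable_EFinP.
pose h := nnsfun_approx measurableT mEF.
have F0' y : (0 <= (EFin \o F) y)%E by rewrite /= lee_fin.
have cvgh y : h n y @[n --> \oo] --> F y.
  have := cvg_nnsfun_approx measurableT mEF (fun y _ => F0' y) (I : setT y).
  by move=> /fine_cvg.
have hle n y : h n y <= F y.
  rewrite -(cvg_lim _ (cvgh y))//; apply: nondecreasing_cvgn_le.
    by move=> m p mp; exact/lefP/nd_nnsfun_approx.
  by apply/cvg_ex; exists (F y).
apply: (@approximable_dominated (fun n x => gmon 2^-1 0 x * h n (s x)) _
   (fun x => gmon 2^-1 0 x * F (s x))) => //.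
- by move=> n; exact: approximable_nnsfun.
- by case: sF.
- move=> n x; rewrite !normrM ler_wpM2l// !ger0_norm//.
- by move=> x; apply: cvgM; [exact: cvg_cst|exact: cvgh].
Qed.

Lemma approximable_profile (F : R -> R) : measurable_fun setT F ->
  sqint mu (fun x => b x * F (s x)) -> approximable (fun x => b x * F (s x)).
Proof.
(* [G] is [F] divided by the exponential factor of [gmon 2^-1 0]. It may grow fast, but only its
   product with [gmon 2^-1 0] has to be square integrable. *)
move=> mF sF; pose G y := F y * expR (2^-1 * y).
have FG x : b x * F (s x) = gmon 2^-1 0 x * G (s x).
  rewrite /gmon /G mul1r mulrACA -mulrA [expR _ * expR _]mulrC -expRD.
  by rewrite mulNr addrN expR0 mulr1.
have mG : measurable_fun setT G by apply: measurable_funM => //; exact: measurable_expRM.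
pose Gp y := Num.max (G y) 0; pose Gm y := Num.max (- G y) 0.
have mGp : measurable_fun setT Gp by apply: measurable_maxr.
have mGm : measurable_fun setT Gm by apply: measurable_maxr => //; exact: measurable_funN.
have sub (H : R -> R) : measurable_fun setT H -> (forall y, `|H y| <= `|G y|) ->
    sqint mu (fun x => gmon 2^-1 0 x * H (s x)).
  move=> mH HG; apply: sqint_le sF _.
    by apply: measurable_funM; [exact: measurable_gmon|exact: measurableT_comp].
  by move=> x; rewrite FG normrM [leRHS]normrM ler_wpM2l.
have -> : (fun x => b x * F (s x)) =
    (fun x => gmon 2^-1 0 x * Gp (s x) + -1 * (gmon 2^-1 0 x * Gm (s x))).
  apply/funext => x; rewrite FG mulN1r -mulrBr; congr (_ * _).
  rewrite /Gp /Gm; case/orP: (le_total 0 (G (s x))) => g0.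
    by rewrite max_l// max_r ?oppr_le0// subr0.
  by rewrite max_r// max_l ?oppr_ge0// sub0r opprK.
apply: approximableD; last apply: approximableZ.
- apply: approximable_ge0 => //; first by move=> y; rewrite le_max lexx orbT.
  apply: sub => // y; rewrite /Gp; case/orP: (le_total 0 (G y)) => g0.
    by rewrite max_l.
  by rewrite max_r// normr0.
- apply: approximable_ge0 => //; first by move=> y; rewrite le_max lexx orbT.
  apply: sub => // y; rewrite /Gm; case/orP: (le_total 0 (- G y)) => g0.
    by rewrite max_l// normrN.
  by rewrite max_r// normr0.
Qed.

Lemma in_closed_span_profile (f : T -> R[i]) (F1 F2 : R -> R) : L2 mu f ->
  measurable_fun setT F1 -> measurable_fun setT F2 ->
  {ae mu, forall x, complex.Re (f x) = b x * F1 (s x)} ->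
  {ae mu, forall x, complex.Im (f x) = b x * F2 (s x)} ->
  in_closed_span mu (lagfun s b) f.
Proof.
move=> lf mF1 mF2 f1 f2; split=> // e e0; have e2 : 0 < e / 2 by rewrite divr_gt0.
have /L2P[[mr ir] [mi ii]] := lf.
have prof (F : R -> R) (g : T -> R) : measurable_fun setT F -> measurable_fun setT g ->
    (\int[mu]_x (g x ^+ 2)%:E < +oo)%E -> {ae mu, forall x, g x = b x * F (s x)} ->
    exists q, dist2 g (pgauss q) <= e / 2.
  move=> mF mg ig gF.
  have mbF : measurable_fun setT (fun x => b x * F (s x)).
    by apply: measurable_funM => //; exact: measurableT_comp.
  have gF' : ae_eq mu setT g (fun x => b x * F (s x)) by apply: filterS gF => x ->.
  have sbF : sqint mu (fun x => b x * F (s x)).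
    by split => //; rewrite -(ae_eq_integral_sqr mg mbF gF').
  have [_ /(_ _ e2)[q hq]] := approximable_profile mF sbF.
  exists q; apply: le_trans hq; rewrite -lee_fin.
  have sq := sqint_pg q.
  rewrite /dist2 -!ipE; [|exact: sqintB|exact: sqintB].
  rewrite (@ae_eq_integral_sqr _ _ _ _ (fun x => g x - pgauss q x)
    (fun x => b x * F (s x) - pgauss q x))//.
  - by apply: measurable_funB => //; case: sq.
  - by apply: measurable_funB => //; case: sq.
  - by apply: filterS gF' => x /[apply] ->.
have [q1 h1] := prof _ _ mF1 mr ir f1; have [q2 h2] := prof _ _ mF2 mi ii f2.
pose n := maxn (size q1) (size q2).
have [c1 q1E] := lag_basis (leq_maxl _ _ : (size q1 <= n)%N).
have [c2 q2E] := lag_basis (leq_maxr _ _ : (size q2 <= n)%N).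
exists n, (fun k => (c1 k +i* c2 k)%C).
have lagE (c : nat -> R) x : pgauss (\sum_(k < n) c k *: lag R k) x =
    \sum_(k < n) c k * lagfun s b k x.
  rewrite /pgauss horner_sum mulr_suml mulr_sumr.
  by apply: eq_bigr => i _; rewrite hornerZ /lagfun /pgauss; ring.
have reE x : complex.Re (f x - span n (fun k => (c1 k +i* c2 k)%C) (lagfun s b) x) =
    complex.Re (f x) - pgauss q1 x.
  rewrite q1E lagE -(Re_span n (fun k => (c1 k +i* c2 k)%C)).
  by case: (f x) (span _ _ _ _) => ? ? [].
have imE x : complex.Im (f x - span n (fun k => (c1 k +i* c2 k)%C) (lagfun s b) x) =
    complex.Im (f x) - pgauss q2 x.
  rewrite q2E lagE -(Im_span n (fun k => (c1 k +i* c2 k)%C)).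
  by case: (f x) (span _ _ _ _) => ? ? [].
rewrite /nm; under [fun x => complex.Re _]eq_fun do rewrite reE.
under [fun x => complex.Im _]eq_fun do rewrite imE.
by move: h1 h2; rewrite /dist2; lra.
Qed.

End density.

(** * Polynomials times Gaussians are Schwartz functions *)

Section gaussian_schwartz.
Variables (R : realType) (E : normedModType R).
Implicit Types (f g p : E -> R) (v : E).

(** What is retained of a linear functional of norm at most 1, so that the identity of R and the
    projections of R * R * R are handled alike. *)
Definition coordinate (l : E -> R) : Prop :=
  [/\ (forall x, differentiable l x), (forall v, exists c, 'D_v l = cst c) &
      (forall x, `|l x| <= `|x|)].

Inductive polynomial_fun : (E -> R) -> Prop :=
| pf_cst c : polynomial_fun (cst c)
| pf_coordinate l : coordinate l -> polynomial_fun l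
| pf_add f g : polynomial_fun f -> polynomial_fun g ->
    polynomial_fun (fun x => f x + g x)
| pf_mul f g : polynomial_fun f -> polynomial_fun g ->
    polynomial_fun (fun x => f x * g x).

Lemma pf_differentiable f x : polynomial_fun f -> differentiable f x.
Proof.
elim=> [c|l []//|{}f g _ df _ dg|{}f g _ df _ dg].
- exact: differentiable_cst.
- exact: differentiableD.
- exact: differentiableM.
Qed.

Lemma pf_derivable f x v : polynomial_fun f -> derivable f x v.
Proof. by move=> pf; apply: diff_derivable; exact: pf_differentiable. Qed.

Lemma pf_derive v f : polynomial_fun f -> polynomial_fun ('D_v f).
Proof.
elim=> [c|l [_ /(_ v)[c ->] _]|{}f g pf pf' pg pg'|{}f g pf pf' pg pg'].
- rewrite (_ : 'D_v (cst c) = cst 0); first exact: pf_cst.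
  by apply/funext => x; rewrite derive_cst.
- exact: pf_cst.
- rewrite (_ : 'D_v _ = fun x => 'D_v f x + 'D_v g x); first exact: pf_add.
  apply/funext => x.
  exact: (deriveD (@pf_derivable f x v pf) (@pf_derivable g x v pg)).
- rewrite (_ : 'D_v _ = fun x => 'D_v f x * g x + f x * 'D_v g x).
    by apply: pf_add; apply: pf_mul.
  apply/funext => x.
  rewrite [LHS](deriveM (@pf_derivable f x v pf) (@pf_derivable g x v pg)).
  by rewrite /GRing.scale/= addrC mulrC [f x * _]mulrC [X in _ + X]mulrC.
Qed.

Lemma pf_growth f : polynomial_fun f ->
  exists C, exists N, forall x, `|f x| <= C * (1 + `|x|) ^+ N.
Proof.
have ge1 x N : 1 <= (1 + `|x : E|) ^+ N by rewrite exprn_ege1// lerDl.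
have pos f' C N : (forall x, `|f' x| <= C * (1 + `|x : E|) ^+ N) -> (0 <= C :> R).
  move=> h; have := h 0; rewrite normr0 addr0 expr1n mulr1.
  by move=> /(le_trans (normr_ge0 (f' 0 : R))).
elim=> [c|l [_ _ ll]|{}f g _ [C [N fC]] _ [D [M gD]]|{}f g _ [C [N fC]] _ [D [M gD]]].
- by exists `|c|, 0%N => x; rewrite expr0 mulr1.
- by exists 1, 1%N => x; rewrite expr1 mul1r (le_trans (ll x))// lerDr.
- have C0 := pos _ _ _ fC; have D0 := pos _ _ _ gD.
  exists (C + D), (N + M)%N => x; rewrite (le_trans (ler_normD _ _))// mulrDl.
  rewrite lerD//.
    by rewrite (le_trans (fC x))// exprD ler_wpM2l// ler_peMr// (le_trans ler01).
  by rewrite (le_trans (gD x))// exprD ler_wpM2l// ler_peMl// (le_trans ler01).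
- exists (C * D), (N + M)%N => x; rewrite normrM exprD mulrACA.
  by rewrite ler_pM.
Qed.

Lemma differentiable_compR (g : R -> R) f x : differentiable f x ->
  derivable g (f x) 1 -> differentiable (fun x => g (f x)) x.
Proof. by move=> df /derivable1_diffP dg; exact: differentiable_comp. Qed.

Lemma derive_compR (g : R -> R) f x v dg : differentiable f x ->
  is_derive (f x) 1 g dg -> 'D_v (fun x => g (f x)) x = dg * 'D_v f x.
Proof.
move=> df gP; have dgP : differentiable g (f x).
  by apply/derivable1_diffP; exact: (@ex_derive _ _ _ _ _ _ _ gP).
rewrite [LHS](deriveE _ (differentiable_comp df dgP)) diff_comp//=.
rewrite -(deriveE _ df) -[X in 'd g _ X]mulr1 -[X in 'd g _ X]/(_ *: 1) linearZ/=.
rewrite -(deriveE _ dgP) (@derive_val _ _ _ _ _ _ _ gP).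
by rewrite /GRing.scale/= mulrC.
Qed.

Variable s : E -> R.
Hypothesis ps : polynomial_fun s.
Hypothesis s_coercive : forall x, `|x| ^+ 2 <= s x.

(** A class stable under every ['D_v], so the decay of its members yields that of all iterated
    derivatives. *)
Definition gaussian_fun f : Prop :=
  exists2 p, polynomial_fun p & f = (fun x => p x * expR (- 2^-1 * s x)).

Let expfun_diff x : differentiable (fun x => expR (- 2^-1 * s x)) x.
Proof.
apply: (differentiable_compR (g := fun y => expR (- 2^-1 * y))).
  exact: pf_differentiable.
have h := is_derive1_comp (is_derive_expR (- 2^-1 * s x)) (is_derive_mull (- 2^-1) (s x)).
exact: (@ex_derive _ _ _ _ _ _ _ h).
Qed.

Let expfun_derivable x v : derivable (fun x => expR (- 2^-1 * s x)) x v.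
Proof. by apply: diff_derivable; exact: expfun_diff. Qed.

Let expfun_derive v x : 'D_v (fun x => expR (- 2^-1 * s x)) x =
  - 2^-1 * 'D_v s x * expR (- 2^-1 * s x).
Proof.
have h := is_derive1_comp (is_derive_expR (- 2^-1 * s x)) (is_derive_mull (- 2^-1) (s x)).
rewrite (derive_compR v (pf_differentiable x ps) h); ring.
Qed.

Lemma gaussian_differentiable f x : gaussian_fun f -> differentiable f x.
Proof.
move=> [p pp ->]; apply: differentiableM; last exact: expfun_diff.
exact: pf_differentiable.
Qed.

Lemma gaussian_derive v f : gaussian_fun f -> gaussian_fun ('D_v f).
Proof.
move=> [p pp ->].
exists (fun x => 'D_v p x + - 2^-1 * (p x * 'D_v s x)).
  apply: pf_add; first exact: pf_derive.
  by apply: (pf_mul (pf_cst _)); apply: pf_mul => //; exact: pf_derive.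
apply/funext => x.
rewrite [LHS](deriveM (@pf_derivable p x v pp) (@expfun_derivable x v)) expfun_derive.
by rewrite /GRing.scale/=; ring.
Qed.

(** With [r] the norm of [x], [(1 + r)^m <= m! exp(1 + r)] by the exponential series; coercivity
    bounds the Gaussian by [exp(- r^2 / 2)], and [1 + r - r^2 / 2 <= 2]. *)
Lemma gaussian_decay f k : gaussian_fun f -> exists M, forall x, `|x| ^+ k * `|f x| <= M.
Proof.
move=> [p /pf_growth[C [N pC]] ->].
pose m := (k + N)%N.
have C0 : 0 <= C.
  by have := le_trans (normr_ge0 _) (pC 0); rewrite normr0 addr0 expr1n mulr1.
exists (C * (m`!%:R * expR 2)) => x; set r := `|x|.
have r0 : 0 <= r by exact: normr_ge0.
have h1 : (1 + r) ^+ m <= m`!%:R * expR (1 + r).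
  rewrite -ler_pdivrMl ?ltr0n ?fact_gt0//.
  case: m => [|m]; first by rewrite fact0 expr0 invr1 mulr1 -expR0 ler_expR addr_ge0.
  rewrite mulrC; apply: le_trans (expR_ge1Dxn m _); first by rewrite lerDr.
  by rewrite addr_ge0.
have h2 : expR (1 + r) * expR (- 2^-1 * s x) <= expR 2.
  rewrite -expRD ler_expR; have := s_coercive x; rewrite -/r.
  by have := sqr_ge0 (r - 1); nra.
rewrite normrM (ger0_norm (expR_ge0 _)).
apply: (@le_trans _ _ ((1 + r) ^+ k * (C * (1 + r) ^+ N * expR (- 2^-1 * s x)))).
  rewrite ler_pM ?exprn_ge0 ?mulr_ge0 ?expR_ge0//.
    by rewrite lerXn2r ?nnegrE ?lerDr// addr_ge0.
  by rewrite ler_wpM2r ?expR_ge0// pC.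
have -> : (1 + r) ^+ k * (C * (1 + r) ^+ N * expR (- 2^-1 * s x)) =
    C * ((1 + r) ^+ m * expR (- 2^-1 * s x)).
  by rewrite /m exprD; ring.
rewrite ler_wpM2l//; apply: le_trans (ler_wpM2r (expR_ge0 _) h1) _.
by rewrite -mulrA ler_wpM2l.
Qed.

Lemma gaussian_schwartz f : gaussian_fun f -> schwartz f.
Proof.
move=> gf l; have : gaussian_fun (iter_derive l f).
  by elim: l => // v l ih /=; exact: gaussian_derive.
move=> gl; split=> [x|k]; first exact: gaussian_differentiable.
exact: gaussian_decay.
Qed.

End gaussian_schwartz.

(** * Derivatives of profiles and eigenfunctions of the harmonic oscillator *)

Section profile_derivatives.
Variables (R : realType) (E : normedModType R).

Lemma pf_horner (q : {poly R}) (s : E -> R) : polynomial_fun s ->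
  polynomial_fun (fun x => q.[s x]).
Proof.
move=> ps; elim/poly_ind: q => [|q c ih].
  by under eq_fun do rewrite horner0; exact: pf_cst.
under eq_fun do rewrite hornerMXaddC.
by apply: pf_add; [exact: pf_mul|exact: pf_cst].
Qed.

Definition radial_gauss (q : {poly R}) (y : R) : R := q.[y] * expR (- 2^-1 * y).

Lemma is_derive_radial_gauss q (y : R) :
  is_derive y 1 (radial_gauss q) (radial_gauss (q^`() - 2^-1 *: q) y).
Proof.
have he := is_derive1_comp (is_derive_expR (- 2^-1 * y)) (is_derive_mull (- 2^-1) y).
apply: (@is_derive_eq _ _ _ _ _ _ _ _ (is_deriveM (is_derive_poly q y) he)).
by rewrite /GRing.scale/= /radial_gauss !(hornerD, hornerN, hornerZ); ring.
Qed.

(** In dimension one [b = l = x] and [be = ga = 1]; in dimension three [b = 1], [be = 0], and [l] is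
    the coordinate along [v]. Summed over the basis, both give [b (4 s F2 + 6 F1)]: on the line, the
    cross term [4 be l F1] makes up for the two missing directions. *)
Lemma derive2_profile (b s l : E -> R) (be ga : R) (F F1 F2 : R -> R) v x :
  polynomial_fun b -> polynomial_fun s -> polynomial_fun l ->
  (forall x, 'D_v b x = be) -> (forall x, 'D_v s x = 2 * l x) ->
  (forall x, 'D_v l x = ga) ->
  (forall y : R, is_derive y 1 F (F1 y)) -> (forall y : R, is_derive y 1 F1 (F2 y)) ->
  'D_v ('D_v (fun x => b x * F (s x))) x =
  4 * be * l x * F1 (s x) + b x * (4 * l x ^+ 2 * F2 (s x) + 2 * ga * F1 (s x)).
Proof.
move=> pb ps pl Db Ds Dl dF dF1.
have dcomp (G G1 : R -> R) : (forall y : R, is_derive y 1 G (G1 y)) ->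
    forall x, derivable (fun x => G (s x)) x v.
  move=> dG z; apply: diff_derivable; apply: differentiable_compR.
    exact: pf_differentiable.
  exact: (@ex_derive _ _ _ _ _ _ _ (dG (s z))).
have Dcomp (G G1 : R -> R) : (forall y : R, is_derive y 1 G (G1 y)) ->
    forall x, 'D_v (fun x => G (s x)) x = G1 (s x) * (2 * l x).
  move=> dG z; rewrite (derive_compR v (pf_differentiable z ps) (dG (s z))).
  by rewrite Ds.
have -> : 'D_v (fun x => b x * F (s x)) =
    (fun x => be * F (s x) + (2 * (b x * l x)) * F1 (s x)).
  apply/funext => z.
  rewrite [LHS](deriveM (@pf_derivable _ _ b z v pb) (dcomp _ _ dF z)).
  by rewrite (Dcomp _ _ dF) Db /GRing.scale/=; ring.
have pbl : polynomial_fun (fun x => 2 * (b x * l x)).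
  by apply: (pf_mul (pf_cst _ _)); exact: pf_mul.
have d1 : derivable (fun x => be * F (s x)) x v.
  exact: (derivableM (@pf_derivable _ _ _ x v (@pf_cst R E be)) (dcomp _ _ dF x)).
have d2 : derivable (fun x => 2 * (b x * l x) * F1 (s x)) x v.
  exact: (derivableM (@pf_derivable _ _ _ x v pbl) (dcomp _ _ dF1 x)).
rewrite [LHS](deriveD d1 d2).
have -> : 'D_v (fun x => be * F (s x)) x = be * (F1 (s x) * (2 * l x)).
  rewrite [LHS](deriveM (@pf_derivable _ _ _ x v (@pf_cst R E be)) (dcomp _ _ dF x)).
  by rewrite (Dcomp _ _ dF) derive_cst /GRing.scale/=; ring.
rewrite [X in _ + X](deriveM (@pf_derivable _ _ _ x v pbl) (dcomp _ _ dF1 x)).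
rewrite (Dcomp _ _ dF1).
have -> : 'D_v (fun x => 2 * (b x * l x)) x = 2 * (be * l x + b x * ga).
  rewrite [LHS](deriveM (@pf_derivable _ _ _ x v (@pf_cst R E 2))
    (@pf_derivable _ _ _ x v (pf_mul pb pl))).
  rewrite derive_cst.
  rewrite [X in _ *: X](deriveM (@pf_derivable _ _ _ x v pb) (@pf_derivable _ _ _ x v pl)).
  by rewrite Db Dl /GRing.scale/=; ring.
by rewrite /GRing.scale/=; ring.
Qed.

End profile_derivatives.

Section coordinates.
Variable R : realType.

Lemma coordinate_id : @coordinate R R id.
Proof.
split=> // v; exists v; apply/funext => x; exact: derive_id.
Qed.

Lemma coordinate_comp (E E' : normedModType R) (l : E' -> R) (L : {linear E -> E'}) :
  continuous L -> (forall x, `|L x| <= `|x|) -> coordinate l -> coordinate (fun x => l (L x)).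
Proof.
move=> cL Lle [dl Dl ll].
have dL x : differentiable L x by exact: linear_differentiable.
split.
- by move=> x; exact: differentiable_comp.
- move=> v; have [c lc] := Dl (L v); exists c; apply/funext => x.
  rewrite [LHS](deriveE _ (differentiable_comp (dL x) (dl (L x)))) diff_comp//=.
  rewrite (diff_lin _ cL) -(deriveE _ (dl (L x))).
  exact: (congr1 (fun h : E' -> R => h (L x)) lc).
- by move=> x; rewrite (le_trans (ll _)).
Qed.

Lemma coordinate_fst (E E' : normedModType R) (l : E -> R) : coordinate l ->
  coordinate (fun x : E * E' => l x.1).
Proof.
move=> cl; refine (@coordinate_comp (E * E')%type E l fst _ _ cl).
  by move=> x; exact: cvg_fst.
by move=> x; rewrite prod_normE le_max lexx.
Qed.

Lemma coordinate_snd (E E' : normedModType R) (l : E' -> R) : coordinate l ->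
  coordinate (fun x : E * E' => l x.2).
Proof.
move=> cl; refine (@coordinate_comp (E * E')%type E' l snd _ _ cl).
  by move=> x; exact: cvg_snd.
by move=> x; rewrite prod_normE le_max lexx orbT.
Qed.

End coordinates.

Section harmonic_eigenfunctions.
Variable R : realType.

Lemma gaussian_profile (E : normedModType R) (b s : E -> R) (q : {poly R}) :
  polynomial_fun b -> polynomial_fun s ->
  gaussian_fun s (fun x => b x * radial_gauss q (s x)).
Proof.
move=> pb ps; exists (fun x => b x * q.[s x]); first by apply: pf_mul => //; exact: pf_horner.
by apply/funext => x; rewrite /radial_gauss mulrA.
Qed.

(* Writing F for the radial profile, both sides below are -4yF''-6F'+yF. *)
Lemma radial_gauss_eigen k (y : R) :
  let F1 := (lag R k)^`() - 2^-1 *: lag R k in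
  - (4 * y * radial_gauss (F1^`() - 2^-1 *: F1) y + 6 * radial_gauss F1 y)
  + y * radial_gauss (lag R k) y = (4 * k%:R + 3) * radial_gauss (lag R k) y.
Proof.
rewrite /= /radial_gauss !(derivB, derivZ) !(hornerD, hornerN, hornerZ).
have := lag_ode k y; move: (_ .[y]) (_ .[y]) (_ .[y]) (expR _) => p0 p1 p2 e ode.
apply/eqP; rewrite -subr_eq0; apply/eqP.
transitivity (- (4 * y * p2 + (6 - 4 * y) * p1 + 4 * k%:R * p0) * e); first by field.
by rewrite ode oppr0 mul0r.
Qed.

Definition s1 (x : R) : R := x ^+ 2.
Definition s3 (x : R * R * R) : R := x.1.1 ^+ 2 + x.1.2 ^+ 2 + x.2 ^+ 2.

Lemma polynomial_s1 : polynomial_fun (s1 : R -> R).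
Proof.
have p := pf_coordinate (coordinate_id R); exact: (pf_mul p p).
Qed.

Lemma coordinate_1 : coordinate (fun x : R * R * R => x.1.1).
Proof.
exact: (@coordinate_fst R (R * R)%type R _ (@coordinate_fst R R R _ (coordinate_id R))).
Qed.

Lemma coordinate_2 : coordinate (fun x : R * R * R => x.1.2).
Proof.
exact: (@coordinate_fst R (R * R)%type R _ (@coordinate_snd R R R _ (coordinate_id R))).
Qed.

Lemma coordinate_3 : coordinate (fun x : R * R * R => x.2).
Proof. exact: (@coordinate_snd R (R * R)%type R _ (coordinate_id R)). Qed.

Lemma polynomial_s3 : polynomial_fun s3.
Proof.
have p1 := pf_coordinate coordinate_1; have p2 := pf_coordinate coordinate_2.
have p3 := pf_coordinate coordinate_3.
exact: (pf_add (pf_add (pf_mul p1 p1) (pf_mul p2 p2)) (pf_mul p3 p3)).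
Qed.

Lemma s1_coercive (x : R) : `|x| ^+ 2 <= s1 x.
Proof. by rewrite real_normK ?num_real. Qed.

Lemma s3_coercive (x : R * R * R) : `|x| ^+ 2 <= s3 x.
Proof.
have sq (a b : R) : (Num.max `|a| `|b|) ^+ 2 <= a ^+ 2 + b ^+ 2.
  have [ab|ab] := leP `|a| `|b|; rewrite real_normK ?num_real//.
    by rewrite lerDr sqr_ge0.
  by rewrite lerDl sqr_ge0.
rewrite !prod_normE /s3; set m := Num.max `|x.1.1| `|x.1.2|.
have m0 : 0 <= m by rewrite /m le_max normr_ge0.
rewrite -(ger0_norm m0); apply: (le_trans (sq _ _)).
by rewrite lerD2r /m sq.
Qed.

Local Notation prof1 k := (fun x : R => x * radial_gauss (lag R k) (s1 x)).
Local Notation prof3 k := (fun x : R * R * R => 1 * radial_gauss (lag R k) (s3 x)).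

Lemma schwartz_prof1 k : schwartz (prof1 k).
Proof.
apply: (gaussian_schwartz polynomial_s1 s1_coercive).
exact: (gaussian_profile _ (pf_coordinate (coordinate_id R)) polynomial_s1).
Qed.

Lemma schwartz_prof3 k : schwartz (prof3 k).
Proof.
apply: (gaussian_schwartz polynomial_s3 s3_coercive).
exact: (gaussian_profile _ (pf_cst _ _) polynomial_s3).
Qed.

Lemma derive_sqr (E : normedModType R) (l : E -> R) (c : R) v x : polynomial_fun l ->
  'D_v l x = c -> 'D_v (fun x => l x ^+ 2) x = 2 * (c * l x).
Proof.
move=> pl Dl; have dl := @pf_derivable _ _ l x v pl.
by rewrite [LHS](deriveM dl dl) Dl /GRing.scale/=; ring.
Qed.

Lemma harmonic_prof1 k : harmonic_oscillator (basis1 R) (@enorm1 R) (prof1 k) =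
  (fun x => (4 * k%:R + 3) * prof1 k x).
Proof.
have pid := pf_coordinate (coordinate_id R).
apply/funext => x; rewrite /harmonic_oscillator /laplacian /basis1 big_seq1.
rewrite (@derive2_profile R R id s1 id 1 1 _ _ _ 1 x pid polynomial_s1 pid _ _ _
  (is_derive_radial_gauss (lag R k)) (is_derive_radial_gauss _)); last 3 first.
- by move=> z; rewrite derive_id.
- by move=> z; rewrite (@derive_sqr R id 1)// ?derive_id// mul1r.
- by move=> z; rewrite derive_id.
rewrite /enorm1 real_normK ?num_real// [RHS]mulrCA -radial_gauss_eigen /s1.
ring.
Qed.

Lemma derive_linear (E : normedModType R) (l : {linear E -> R}) v x : continuous l ->
  'D_v l x = l v.
Proof. by move=> cl; rewrite deriveE ?diff_lin//; exact: linear_differentiable. Qed.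

Lemma derive_coordinate_1 (v x : R * R * R) : 'D_v (fun x : R * R * R => x.1.1) x = v.1.1.
Proof.
refine (@derive_linear (R * R * R)%type (fst \o fst) v x _) => z.
by apply: continuous_comp; exact: cvg_fst.
Qed.

Lemma derive_coordinate_2 (v x : R * R * R) : 'D_v (fun x : R * R * R => x.1.2) x = v.1.2.
Proof.
refine (@derive_linear (R * R * R)%type (snd \o fst) v x _) => z.
by apply: continuous_comp; [exact: cvg_fst|exact: cvg_snd].
Qed.

Lemma derive_coordinate_3 (v x : R * R * R) : 'D_v (fun x : R * R * R => x.2) x = v.2.
Proof.
refine (@derive_linear (R * R * R)%type snd v x _) => z.
exact: cvg_snd.
Qed.

Lemma harmonic_prof3 k : harmonic_oscillator (basis3 R) (@enorm3 R) (prof3 k) =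
  (fun x => (4 * k%:R + 3) * prof3 k x).
Proof.
have pc : polynomial_fun (fun _ : R * R * R => 1 : R) := pf_cst _ 1.
have p1 := pf_coordinate coordinate_1; have p2 := pf_coordinate coordinate_2.
have p3 := pf_coordinate coordinate_3.
apply/funext => x; rewrite /harmonic_oscillator /laplacian /basis3 !big_cons big_nil.
have Ds v z : 'D_v s3 z = 2 * (v.1.1 * z.1.1 + v.1.2 * z.1.2 + v.2 * z.2).
  have q1 := pf_mul p1 p1; have q2 := pf_mul p2 p2; have q3 := pf_mul p3 p3.
  rewrite [LHS](deriveD (@pf_derivable _ _ _ z v (pf_add q1 q2)) (@pf_derivable _ _ _ z v q3)).
  rewrite [X in X + _](deriveD (@pf_derivable _ _ _ z v q1) (@pf_derivable _ _ _ z v q2)).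
  have e1 := derive_sqr p1 (derive_coordinate_1 v z).
  have e2 := derive_sqr p2 (derive_coordinate_2 v z).
  have e3 := derive_sqr p3 (derive_coordinate_3 v z).
  rewrite -[X in X + _ + _]/('D_v (fun x : R * R * R => x.1.1 ^+ 2) z) e1.
  rewrite -[X in _ + X + _]/('D_v (fun x : R * R * R => x.1.2 ^+ 2) z) e2.
  rewrite -[X in _ + X]/('D_v (fun x : R * R * R => x.2 ^+ 2) z) e3.
  ring.
have D1 (v z : R * R * R) : 'D_v (fun _ : R * R * R => 1 : R) z = 0 by exact: derive_cst.
have dF := is_derive_radial_gauss (lag R k).
have dF1 := is_derive_radial_gauss ((lag R k)^`() - 2^-1 *: lag R k).
pose f := radial_gauss (lag R k) (s3 x).
pose f1 := radial_gauss ((lag R k)^`() - 2^-1 *: lag R k) (s3 x).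
pose f2 := radial_gauss (((lag R k)^`() - 2^-1 *: lag R k)^`() -
  2^-1 *: ((lag R k)^`() - 2^-1 *: lag R k)) (s3 x).
have D2 (v : R * R * R) (l : R * R * R -> R) : polynomial_fun l ->
    (forall z, 'D_v s3 z = 2 * l z) -> (forall z, 'D_v l z = 1) ->
    'D_v ('D_v (prof3 k)) x = 4 * 0 * l x * f1 + 1 * (4 * l x ^+ 2 * f2 + 2 * 1 * f1).
  move=> pl Dsl Dl.
  exact: (derive2_profile x pc polynomial_s3 pl (D1 v) Dsl Dl dF dF1).
have e1 := D2 (1, 0, 0) _ p1 _ (derive_coordinate_1 (1, 0, 0)).
have e2 := D2 (0, 1, 0) _ p2 _ (derive_coordinate_2 (0, 1, 0)).
have e3 := D2 (0, 0, 1) _ p3 _ (derive_coordinate_3 (0, 0, 1)).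
have S1 z : 'D_((1, 0, 0) : R * R * R) s3 z = 2 * z.1.1.
  by rewrite (Ds (1, 0, 0))/=; ring.
have S2 z : 'D_((0, 1, 0) : R * R * R) s3 z = 2 * z.1.2.
  by rewrite (Ds (0, 1, 0))/=; ring.
have S3 z : 'D_((0, 0, 1) : R * R * R) s3 z = 2 * z.2.
  by rewrite (Ds (0, 0, 1))/=; ring.
have eL := congr2 +%R (e1 S1) (congr2 +%R (e2 S2) (congr2 +%R (e3 S3) (erefl (0 : R)))).
transitivity (- (4 * 0 * x.1.1 * f1 + 1 * (4 * x.1.1 ^+ 2 * f2 + 2 * 1 * f1) +
  (4 * 0 * x.1.2 * f1 + 1 * (4 * x.1.2 ^+ 2 * f2 + 2 * 1 * f1) +
  (4 * 0 * x.2 * f1 + 1 * (4 * x.2 ^+ 2 * f2 + 2 * 1 * f1) + 0))) +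
  enorm3 x ^+ 2 * (1 * f)).
  exact: (congr1 (fun z => - z + enorm3 x ^+ 2 * (1 * f)) eL).
rewrite /enorm3 sqr_sqrtr ?addr_ge0 ?sqr_ge0// !mul1r -radial_gauss_eigen -/f -/f1 -/f2 /s3.
ring.
Qed.

End harmonic_eigenfunctions.

(** * The identity common to both dimensions *)

Section radial_frame_identity.
Context d (T : measurableType d) (R : realType).
Variable mu : {measure set T -> \bar R}.
Variables (S : set (T -> R)) (H : (T -> R) -> T -> R).
Variable U : R -> (T -> R[i]) -> T -> R[i].
Hypothesis hU : unitary_propagator mu S H U.
Variables s b : T -> R.
Hypothesis ms : measurable_fun setT s.
Hypothesis mb : measurable_fun setT b.
Hypothesis s_ge0 : forall x, 0 <= s x.
Hypothesis scaling : forall F : R -> R, measurable_fun setT F ->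
  (forall y : R, 0 <= y -> 0 <= F y) -> forall c : R, 0 < c ->
  wint mu s b (fun y => F (c ^+ 2 * y)) = ((c^-1 ^+ 3)%:E * wint mu s b F)%E.
Hypothesis gauss_lty : (wint mu s b (fun y => expR (- y)) < +oo)%E.
Hypothesis Slag : forall k, S (lagfun s b k).
Hypothesis Hlag : forall k, H (lagfun s b k) = (fun x => (4 * k%:R + 3) * lagfun s b k x).
Variable enorm : T -> R.
Hypothesis enorm_sqr : forall x, enorm x ^+ 2 = s x.

Theorem radial_frame_identity (f : T -> R[i]) (F1 F2 : R -> R) : L2 mu f ->
  measurable_fun setT F1 -> measurable_fun setT F2 ->
  {ae mu, forall x, complex.Re (f x) = b x * F1 (s x)} ->
  {ae mu, forall x, complex.Im (f x) = b x * F2 (s x)} ->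
  weighted_spacetime_integral mu enorm (fun t => U t f) =
  ((4 * pi)%:E * L2norm mu f ^+ 2)%E.
Proof.
move=> lf mF1 mF2 f1 f2.
have slag k : sqint mu (lagfun s b k) by exact: sqint_pgauss.
have orth j k : j != k -> ip mu (lagfun s b j) (lagfun s b k) = 0.
  exact: (ip_phi_neq hU Slag slag Hlag).
have cl := in_closed_span_profile ms mb s_ge0 scaling gauss_lty lf mF1 mF2 f1 f2.
have r0 x : 0 <= inv_root s x by rewrite invr_ge0 sqrtr_ge0.
have sr k : sqint mu (fun x => inv_root s x * lagfun s b k x).
  exact: sqint_inv_root_pgauss.
have ipr := ip_inv_root_lagfun ms mb s_ge0 scaling gauss_lty orth.
have := spacetime_energy_identity hU Slag slag Hlag (measurable_inv_root ms) sr ipr r0 cl.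
rewrite (L2norm_sqr lf) -EFinM => <-.
rewrite /weighted_spacetime_integral /spacetime_energy; apply: eq_integral => t _.
rewrite /energy; apply: eq_integral => x _.
by rewrite scaleE sqr_inv_root// sqr_normc enorm_sqr mulrC.
Qed.

End radial_frame_identity.

(** * Dilations and the scaling identity *)

Section dilations.
Context {R : realType}.
Local Notation leb := (@lebesgue_measure R).

(** [k] is the reciprocal of the Jacobian of [D]. Stating the change of variables for nonnegative
    functions lets it pass to product measures by Tonelli's theorem. *)
Definition dilation d (T : measurableType d) (m : {measure set T -> \bar R})
    (D : T -> T) (k : R) : Prop :=
  [/\ measurable_fun setT D, 0 <= k & forall f : T -> \bar R, measurable_fun setT f ->
    (forall x, 0 <= f x)%E -> (\int[m]_x f (D x) = k%:E * \int[m]_x f x)%E].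

(** Uniqueness of Lebesgue measure: [c] times its image under multiplication by [c] gives half-open
    intervals their length. *)
Lemma dilation_lebesgue (c : R) : 0 < c ->
  dilation leb (fun x : measurableTypeR R => c * x : measurableTypeR R) c^-1.
Proof.
move=> c0; have mc : measurable_fun setT (fun x : measurableTypeR R => c * x : measurableTypeR R).
  exact: mulrl_measurable.
split => //; first by rewrite invr_ge0 ltW.
move=> f mf f0.
pose nu := mscale (NngNum (ltW c0)) (pushforward leb (fun x : measurableTypeR R => c * x : measurableTypeR R)).
have h A : measurable A -> leb A = nu mc A.
  apply: lebesgue_measure_unique => _ [[a b]] _ <-.
  have preE : (fun x : measurableTypeR R => c * x) @^-1` `]a, b]%classic =
      `](a / c), (b / c)]%classic.
    apply/seteqP; split => x /=; rewrite !in_itv/= ltr_pdivrMr// ler_pdivlMr//;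
    by rewrite (mulrC x).
  transitivity (c%:E * leb `](a / c)%R, (b / c)%R]%classic)%E; last first.
    exact: (congr1 (fun A : set (measurableTypeR R) => c%:E * leb A)%E (esym preE)).
  rewrite !lebesgue_measure_itv/= !lte_fin ltr_pM2r ?invr_gt0//.
  case: ifPn => _; last by rewrite mule0.
  by rewrite -!EFinB -EFinM; congr EFin; field; rewrite gt_eqF.
have -> : (\int[leb]_x f x = \int[nu mc]_x f x)%E.
  by apply: eq_measure_integral => A mA _; exact: h.
rewrite /nu ge0_integral_mscale//= ge0_integral_pushforward//= muleA -EFinM.
by rewrite mulVf ?gt_eqF// mul1e.
Qed.

Lemma dilation_prod d1 d2 (T1 : measurableType d1) (T2 : measurableType d2)
    (m1 : {sigma_finite_measure set T1 -> \bar R})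
    (m2 : {sigma_finite_measure set T2 -> \bar R}) D1 D2 k1 k2 :
  dilation m1 D1 k1 -> dilation m2 D2 k2 ->
  dilation (m1 \x m2)%E (fun x => (D1 x.1, D2 x.2)) (k1 * k2).
Proof.
move=> [mD1 k10 h1] [mD2 k20 h2].
have mD : measurable_fun setT (fun x : T1 * T2 => (D1 x.1, D2 x.2)).
  apply: measurable_fun_pair; first exact: (measurableT_comp mD1 measurable_fst).
  exact: (measurableT_comp mD2 measurable_snd).
split; [exact: mD|exact: mulr_ge0|move=> f mf f0].
rewrite (fubini_tonelli1 (fun x => f (D1 x.1, D2 x.2)))//; last exact: measurableT_comp.
rewrite (fubini_tonelli1 f)//.
pose G x := (\int[m2]_y f (x, y))%E.
have mG : measurable_fun setT G by exact: (measurable_fun_fubini_tonelli_F f).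
have G0 x : (0 <= G x)%E by exact: integral_ge0.
transitivity (\int[m1]_x (k2%:E * G (D1 x)))%E.
  apply: eq_integral => x _; rewrite /G -h2//.
  by apply: measurableT_comp => //; exact: pair1_measurable.
rewrite ge0_integralZl_EFin//; last exact: measurableT_comp.
by rewrite h1// muleA -EFinM mulrC.
Qed.

End dilations.

Section gaussian_moments.
Context {R : realType}.
Local Notation leb := (@lebesgue_measure R).

Lemma measurable_sqrt : measurable_fun setT (@Num.sqrt R).
Proof. by apply: continuous_measurable_fun; exact: sqrt_continuous. Qed.

(** [p] is the degree of homogeneity of [b]. The common exponent 3 comes from
    [k c = c^-1 = c^-3 c^2] with [p = 1] on the line, and from [k c = c^-3] with [p = 0] in
    space. *)
Lemma scaling_of_dilation d (T : measurableType d) (m : {measure set T -> \bar R})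
    (s b : T -> R) (D : R -> T -> T) (k : R -> R) (p : nat) :
  measurable_fun setT s -> measurable_fun setT b -> (forall x, 0 <= s x) ->
  (forall c, 0 < c -> dilation m (D c) (k c)) ->
  (forall c x, s (D c x) = c ^+ 2 * s x) -> (forall c x, b (D c x) = c ^+ p * b x) ->
  (forall c, 0 < c -> k c = c^-1 ^+ 3 * (c ^+ p) ^+ 2) ->
  forall F : R -> R, measurable_fun setT F -> (forall y : R, 0 <= y -> 0 <= F y) ->
  forall c : R, 0 < c ->
  wint m s b (fun y => F (c ^+ 2 * y)) = ((c^-1 ^+ 3)%:E * wint m s b F)%E.
Proof.
move=> ms mb s0 hD sD bD kE F mF F0 c c0.
have [mD kc0 hDc] := hD c c0.
have cp0 : 0 < (c ^+ p) ^+ 2 by rewrite !exprn_gt0.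
have mw := measurable_wint ms mb mF.
have w0 x : (0 <= ((b x) ^+ 2 * F (s x))%:E)%E.
  by rewrite lee_fin mulr_ge0 ?sqr_ge0// F0.
have -> : wint m s b (fun y => F (c ^+ 2 * y)) =
    ((((c ^+ p) ^+ 2)^-1)%:E * \int[m]_x ((b (D c x)) ^+ 2 * F (s (D c x)))%:E)%E.
  rewrite -ge0_integralZl_EFin ?invr_ge0 ?(ltW cp0)//; last first.
    exact: (measurableT_comp mw mD).
  apply: eq_integral => x _; rewrite -EFinM; congr EFin.
  by rewrite bD sD exprMn mulrA mulKf ?gt_eqF.
rewrite (hDc _ mw w0) muleA -EFinM kE//.
by congr (_%:E * _)%E; rewrite mulrCA mulVf ?gt_eqF// mulr1.
Qed.

Lemma gauss_scaled_lty (a : R) : 0 < a ->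
  (\int[leb]_x (expR (- (a * x ^+ 2)))%:E < +oo)%E.
Proof.
move=> a0; have ra : 0 < Num.sqrt a by rewrite sqrtr_gt0.
have [_ _ h] := dilation_lebesgue ra.
have mg : measurable_fun [set: measurableTypeR R] (EFin \o @gauss_fun R).
  by apply/measurable_EFinP; exact: measurable_gauss_fun.
have := h _ mg (fun x => gauss_fun_ge0 x).
have -> : (\int[leb]_x (EFin \o @gauss_fun R) (Num.sqrt a * x)%R)%E =
    (\int[leb]_x (expR (- (a * x ^+ 2)))%:E)%E.
  apply: eq_integral => x _ /=; rewrite /gauss_fun exprMn sqr_sqrtr ?ltW//.
by move=> ->; rewrite integralT_gauss -EFinM ltry.
Qed.

End gaussian_moments.

(** * Dimension one *)

Section one_dimension.
Context {R : realType}.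
Local Notation mu := (@mu1 R).
Local Notation T1 := (measurableTypeR R).

Let ms : measurable_fun [set: T1] (@s1 R).
Proof. exact: exprn_measurable. Qed.

Let mb : measurable_fun [set: T1] (@id R).
Proof. exact: measurable_id. Qed.

Let s0 (x : T1) : 0 <= s1 x. Proof. exact: sqr_ge0. Qed.

Let scaling1 (F : R -> R) : measurable_fun setT F ->
  (forall y : R, 0 <= y -> 0 <= F y) -> forall c : R, 0 < c ->
  wint mu (@s1 R) id (fun y => F (c ^+ 2 * y)) =
  ((c^-1 ^+ 3)%:E * wint mu (@s1 R) id F)%E.
Proof.
apply: (@scaling_of_dilation _ _ _ _ _ _ (fun c (x : T1) => c * x) (fun c => c^-1) 1) => //.
- by move=> c c0; exact: dilation_lebesgue.
- by move=> c x; rewrite /s1 exprMn.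
- by move=> c c0; rewrite expr1; field; rewrite gt_eqF.
Qed.

Let gauss1 : (wint mu (@s1 R) id (fun y => expR (- y)) < +oo)%E.
Proof.
have mE : measurable_fun setT (fun y : R => expR (- y)).
  by under eq_fun do rewrite -mulN1r; exact: measurable_expRM.
(* The factor [x^2] is absorbed by [exprn_expR_le] with [k = 1] and [a = 1], whose constant is 4. *)
apply: (@le_lt_trans _ _ (\int[mu]_x ((4 : R)%:E * (expR (- (2^-1 * x ^+ 2)))%:E))%E).
  have mg a : measurable_fun [set: T1] (fun x : T1 => expR (a * x ^+ 2)).
    exact: (measurableT_comp (measurable_expRM a) ms).
  apply: ge0_le_integral => //.
  - by move=> x _; rewrite lee_fin mulr_ge0 ?sqr_ge0 ?expR_ge0.
  - exact: (measurable_wint ms mb mE).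
  - apply: measurable_funeM; apply/measurable_EFinP.
    by under eq_fun do rewrite -mulNr; exact: mg.
  - move=> x _; rewrite -EFinM lee_fin.
    have := exprn_expR_le 1 (@ltr01 R) (sqr_ge0 x).
    rewrite !expr1 mulN1r divr1 /s1 => /le_trans; apply.
    rewrite mul1r mulNr ler_wpM2r ?expR_ge0//; lra.
rewrite ge0_integralZl_EFin//.
- by rewrite lte_mul_pinfty// gauss_scaled_lty.
- apply/measurable_EFinP; under eq_fun do rewrite -mulNr.
  exact: (measurableT_comp (measurable_expRM _) ms).
Qed.

Variable U1 : R -> (R -> R[i]) -> R -> R[i].
Hypothesis hU1 : harmonic_propagator1 U1.

(** Off 0 an odd [h] equals [x F(x^2)] with [F y = h (sqrt y) / sqrt y], a profile that is
    measurable along with [h]. This is applied to the real and imaginary parts of [g], almost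
    everywhere. *)
Lemma odd_spacetime_identity (g : R -> R[i]) : L2 mu g -> odd_fun g ->
  weighted_spacetime_integral mu (@enorm1 R) (fun t => U1 t g)
  = ((4 * pi)%:E * L2norm mu g ^+ 2)%E.
Proof.
move=> lg og; have /L2P[[mr _] [mi _]] := lg.
have mF (h : R -> R) : measurable_fun [set: T1] h ->
    measurable_fun setT (fun y : R => h (Num.sqrt y) / Num.sqrt y).
  move=> mh; apply: measurable_funM.
    exact: (measurableT_comp mh measurable_sqrt).
  by apply: measurableT_comp; [exact: measurable_inv|exact: measurable_sqrt].
have x0 : {ae mu, forall x, x != 0}.
  exists [set 0]; split; first exact: measurable_set1.
    exact: lebesgue_measure_set1.
  by move=> x /= /negP; rewrite negbK => /eqP.
have prof (h : R -> R) (x : R) : x != 0 -> h (- x) = - h x ->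
    h x = x * (h (Num.sqrt (s1 x)) / Num.sqrt (s1 x)).
  move=> xn0 hN; rewrite /s1 sqrtr_sqr.
  have [xp|xp] := leP 0 x; first by rewrite ger0_norm// mulrCA mulfV// mulr1.
  by rewrite ltr0_norm// hN; field.
apply: (radial_frame_identity hU1 ms mb s0 scaling1 gauss1 (@schwartz_prof1 R)
  (@harmonic_prof1 R) _ lg (mF _ mr) (mF _ mi)).
- by move=> x; rewrite /enorm1 real_normK ?num_real.
- move: og x0; apply: (@filterS2 _ _ (ae_filter_ringOfSetsType mu)) => x gN xn0.
  apply: (prof (fun x => complex.Re (g x))) => //.
  by rewrite gN; case: (g x).
- move: og x0; apply: (@filterS2 _ _ (ae_filter_ringOfSetsType mu)) => x gN xn0.
  apply: (prof (fun x => complex.Im (g x))) => //.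
  by rewrite gN; case: (g x).
Qed.

End one_dimension.

(** * Null sets along rays and measurable radial profiles *)

Section null_slices.
Context {R : realType}.

Lemma ae_eq0P d (T : measurableType d) (m : {measure set T -> \bar R}) (h : T -> \bar R) :
  measurable_fun setT h -> (forall x, 0 <= h x)%E ->
  {ae m, forall x, h x = 0%E} <-> (\int[m]_x h x = 0)%E.
Proof.
move=> mh h0; have -> : (\int[m]_x h x = \int[m]_x `|h x|)%E.
  by apply: eq_integral => x _; rewrite gee0_abs.
have P := ae_eq_integral_abs m measurableT mh.
split=> [[N [mN N0 NP]]|/P[N [mN N0 NP]]]; last first.
  by exists N; split => //; apply: subset_trans NP => x /= nh hx; apply: nh; exact: hx.
apply/P; exists N; split => //.
by apply: subset_trans NP => x /= nh hx; apply: nh => _.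
Qed.

(** By Tonelli's theorem each side says that [B] is null for the product measure. *)
Lemma ae_slices d1 d2 (T1 : measurableType d1) (T2 : measurableType d2)
    (m1 : {sigma_finite_measure set T1 -> \bar R})
    (m2 : {sigma_finite_measure set T2 -> \bar R}) (B : set (T1 * T2)) :
  measurable B ->
  {ae m1, forall x, m2 (xsection B x) = 0%E} <-> {ae m2, forall y, m1 (ysection B y) = 0%E}.
Proof.
move=> mB; have := indic_fubini_tonelli m1 m2 mB.
rewrite indic_fubini_tonelli_FE// indic_fubini_tonelli_GE//= => E.
rewrite !ae_eq0P// ?E//; first exact: measurable_fun_ysection.
exact: measurable_fun_xsection.
Qed.

Lemma ae_exists d (T : measurableType d) (m : {measure set T -> \bar R})
    (A : set T) (P : T -> Prop) :
  measurable A -> m A != 0%E -> {ae m, forall x, P x} -> exists2 x, A x & P x.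
Proof.
move=> mA A0 [N [mN N0 NP]]; apply: contrapT => h.
move/eqP: A0; apply; apply: (subset_measure0 mA mN _ N0) => x Ax.
by apply: NP => /= Px; apply: h; exists x.
Qed.

Lemma dilation_preimage d (T : measurableType d) (m : {measure set T -> \bar R})
    (D : T -> T) (k : R) (A : set T) :
  dilation m D k -> measurable A -> m (D @^-1` A) = (k%:E * m A)%E.
Proof.
move=> [mD _ h] mA.
have mDA : measurable (D @^-1` A) by rewrite -[X in measurable X]setTI; exact: mD.
have := h (fun x => (\1_A x)%:E).
rewrite !integral_indic// !setIT => <- //.
by apply/measurable_EFinP; exact: measurable_indic.
Qed.

Variables (d : measure_display) (T : measurableType d).
Variable m : {sigma_finite_measure set T -> \bar R}.
Local Notation leb := (@lebesgue_measure R).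
Local Notation T1 := (measurableTypeR R).
Variables (D : T1 -> T -> T) (k : R -> R).
Hypothesis mD : measurable_fun setT (fun z : T * T1 => D z.2 z.1).
Hypothesis hD : forall c, 0 < c -> dilation m (D c) (k c).
Hypothesis k_gt0 : forall c, 0 < c -> 0 < k c.

Let posE : [set c : T1 | 0 < c] = `]0, +oo[%classic.
Proof. by apply/seteqP; split => c /=; rewrite in_itv/= andbT. Qed.

Let measurable_pos : measurable [set c : T1 | 0 < c].
Proof. by rewrite posE; exact: measurable_itv. Qed.

Let pos_neq0 : leb [set c : T1 | 0 < c] != 0%E.
Proof. by rewrite posE lebesgue_measure_itv/= ltry. Qed.

Let measurable_cone (A : set T) : measurable A ->
  measurable [set z : T * T1 | 0 < z.2 /\ A (D z.2 z.1)].
Proof.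
move=> mA; apply: measurableI.
  by have := @measurable_snd _ _ T T1 measurableT _ measurable_pos; rewrite setTI; exact.
by rewrite -[X in measurable X]setTI; apply: mD.
Qed.

(** For fixed [c > 0] the points [x] with [D c x] in [A] form the preimage of a null set under a
    dilation, again null; exchanging the slices turns this into a statement about almost every
    ray. *)
Lemma ae_ray_null (A : set T) : measurable A -> m A = 0%E ->
  {ae m, forall x, leb [set c : T1 | 0 < c /\ A (D c x)] = 0%E}.
Proof.
move=> mA A0.
have : {ae leb, forall c, m (ysection [set z : T * T1 | 0 < z.2 /\ A (D z.2 z.1)] c) = 0%E}.
  apply: aeW => c; rewrite ysectionE.
  have [c0|c0] := ltP 0 c; last first.
    rewrite (_ : _ @^-1` _ = set0) ?measure0// -subset0 => x /= [].
    by rewrite ltNge c0.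
  rewrite (_ : _ @^-1` _ = D c @^-1` A).
    by rewrite (dilation_preimage (hD c0))// [X in (_ * X)%E]A0 mule0.
  by apply/seteqP; split => x //= [].
move/(ae_slices _ _ (measurable_cone mA)); apply: (@filterS _ _ (ae_filter_ringOfSetsType m)) => x.
by rewrite xsectionE.
Qed.

(** The reverse passage: almost every ray meets the set in a dilate of [L], which is null, so for
    some [c > 0] the preimage of the set under [D c] is null; as [k c > 0], the set itself is
    null. *)
Lemma null_of_homogeneous (n : T -> R) (L : set T1) : measurable_fun setT n ->
  (forall c x, 0 < c -> n (D c x) = c * n x) -> {ae m, forall x, 0 < n x} ->
  measurable L -> leb L = 0%E -> m (n @^-1` L) = 0%E.
Proof.
move=> mn nD n0 mL L0.
have mA : measurable (n @^-1` L) by rewrite -[X in measurable X]setTI; exact: mn.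
have : {ae m, forall x, leb (xsection [set z : T * T1 | 0 < z.2 /\ L (n (D z.2 z.1))] x) = 0%E}.
  move: n0; apply: (@filterS _ _ (ae_filter_ringOfSetsType m)) => x x0.
  rewrite xsectionE; apply: (subset_measure0 (B := (fun c : T1 => n x * c : T1) @^-1` L)).
  - by have := measurable_xsection x (measurable_cone mA); rewrite xsectionE.
  - by rewrite -[X in measurable X]setTI; exact: mulrl_measurable.
  - by move=> c /= [c0]; rewrite nD// mulrC.
  - apply: (etrans (dilation_preimage (dilation_lebesgue x0) mL)).
    by rewrite [X in (_ * X)%E]L0 mule0.
move/(ae_slices _ _ (measurable_cone mA)) => /(ae_exists measurable_pos pos_neq0)[c c0].
rewrite ysectionE (_ : _ @^-1` _ = D c @^-1` (n @^-1` L)).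
  by rewrite (dilation_preimage (hD c0))// => /eqP; rewrite mule_eq0 eqe gt_eqF ?k_gt0//= => /eqP.
by apply/seteqP; split => x //= [].
Qed.

Hypothesis mT : m setT != 0%E.

(* The profile rho need not be measurable.  It is recovered from the values of
   f on the ray through x0, a ray which by Fubini's theorem may be chosen to
   meet the exceptional null set in a null set. *)
Lemma radial_measurable_profile (n : T -> R) (f : T -> R[i]) (rho : R -> R[i]) :
  measurable_fun setT n -> (forall c x, 0 < c -> n (D c x) = c * n x) ->
  {ae m, forall x, 0 < n x} -> {ae m, forall x, f x = rho (n x)} ->
  exists x0, {ae m, forall x, f x = f (D (n x / n x0) x0)}.
Proof.
move=> mn nD n0 [A [mA A0 fA]].
have [x0 _ [nx0 L0]] : exists2 x0, setT x0 &
    0 < n x0 /\ leb [set c : T1 | 0 < c /\ A (D c x0)] = 0%E.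
  apply: (ae_exists measurableT mT); move: n0 (ae_ray_null mA A0).
  exact: (@filterS2 _ _ (ae_filter_ringOfSetsType m)).
exists x0; set L := [set c : T1 | _] in L0.
have mL : measurable L.
  by have := measurable_xsection x0 (measurable_cone mA); rewrite xsectionE.
have nL : m ((fun x => n x / n x0) @^-1` L) = 0%E.
  apply: null_of_homogeneous => //.
  - by apply: measurable_funM => //; exact: measurable_cst.
  - by move=> c x c0; rewrite nD// mulrA.
  - move: n0; apply: (@filterS _ _ (ae_filter_ringOfSetsType m)) => x xp.
    by rewrite divr_gt0.
have aeL : {ae m, forall x, ~ L (n x / n x0)}.
  exists ((fun x => n x / n x0) @^-1` L); split => //.
    rewrite -[X in measurable X]setTI.
    by apply: (measurable_funM mn (measurable_cst _)).
  by move=> x /= /contrapT.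
have aeA : {ae m, forall x, ~ A x} by exists A; split => // x /= /contrapT.
move: n0 aeL aeA; apply: (@filterS3 _ _ (ae_filter_ringOfSetsType m)) => x xp xL xA.
have fE y : ~ A y -> f y = rho (n y) by move=> yA; apply: contrapT => h; apply: yA; exact: fA.
have q0 : 0 < n x / n x0 by rewrite divr_gt0.
by rewrite !fE ?nD ?divfK ?gt_eqF// => hA; exact: xL.
Qed.

End null_slices.

(** * Dimension three *)

Section product_sigma_finite.
Context d1 d2 (T1 : measurableType d1) (T2 : measurableType d2) (R : realType).
Variable m1 : {sigma_finite_measure set T1 -> \bar R}.
Variable m2 : {sigma_finite_measure set T2 -> \bar R}.

(* A copy of the library's product measure, whose sigma-finite structure is
   masked by the one for subprobabilities. *)
Definition sigma_finite_product : set (T1 * T2) -> \bar R := (m1 \x m2)%E.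

HB.instance Definition _ := Measure.on sigma_finite_product.

Let product_sigma_finite : sigma_finite setT sigma_finite_product.
Proof.
have /sigma_finiteP[F [TF ndF Foo]] := sigma_finiteT m1.
have /sigma_finiteP[G [TG ndG Goo]] := sigma_finiteT m2.
exists (fun n => F n `*` G n).
  rewrite -setXTT TF TG predeqE => -[x y]; split; last by move=> [n _ []/= ? ?]; split; exists n.
  move=> [/= [n _ Fnx] [k _ Gky]]; exists (maxn n k) => //; split.
    by move: x Fnx; exact/subsetPset/ndF/leq_maxl.
  by move: y Gky; exact/subsetPset/ndG/leq_maxr.
move=> n; have [mF Fn] := Foo n; have [mG Gn] := Goo n.
split; first exact: measurableX.
by rewrite /sigma_finite_product product_measure1E// lte_mul_pinfty// ge0_fin_numE.
Qed.

HB.instance Definition _ := Measure_isSigmaFinite.Build _ _ _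
  sigma_finite_product product_sigma_finite.

End product_sigma_finite.

Lemma integral_prod_mul (R : realType) d1 d2 (T1 : measurableType d1) (T2 : measurableType d2)
    (m1 : {sigma_finite_measure set T1 -> \bar R})
    (m2 : {sigma_finite_measure set T2 -> \bar R}) (f : T1 -> R) (g : T2 -> R) :
  measurable_fun setT f -> measurable_fun setT g ->
  (forall x, 0 <= f x) -> (forall y, 0 <= g y) ->
  (\int[m1 \x m2]_z (f z.1 * g z.2)%:E =
   (\int[m1]_x (f x)%:E) * \int[m2]_y (g y)%:E)%E.
Proof.
move=> mf mg f0 g0.
have mfE : measurable_fun setT (fun x => (f x)%:E) by exact/measurable_EFinP.
have mgE : measurable_fun setT (fun x => (g x)%:E) by exact/measurable_EFinP.
rewrite (fubini_tonelli1 (fun z => (f z.1 * g z.2)%:E))//; last 2 first.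
- apply/measurable_EFinP; apply: measurable_funM.
    exact: (measurableT_comp mf measurable_fst).
  exact: (measurableT_comp mg measurable_snd).
- by move=> z; rewrite lee_fin mulr_ge0.
rewrite -ge0_integralZr//; last 2 first.
- by move=> x _; rewrite lee_fin.
- by apply: integral_ge0 => y _; rewrite lee_fin.
apply: eq_integral => x _; rewrite /fubini_F /= -ge0_integralZl_EFin//.
by move=> y _; rewrite lee_fin.
Qed.

Section three_dimensions.
Context {R : realType}.
Local Notation leb := (@lebesgue_measure R).
Local Notation mu := (@mu3 R).
Local Notation T1 := (measurableTypeR R).
Local Notation T3 := (T1 * T1 * T1)%type.
(** [m2] and [m3] equip the iterated products with the sigma-finite structure on which Tonelli's
    theorem rests; [m3] is [mu3] up to conversion. *)
Let m2 : {sigma_finite_measure set (T1 * T1)%type -> \bar R} := sigma_finite_product leb leb.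
Let m3 : {sigma_finite_measure set T3 -> \bar R} := sigma_finite_product m2 leb.

Let D (c : T1) (x : T3) : T3 := (c * x.1.1, c * x.1.2, c * x.2).

Let hD c : 0 < c -> dilation m3 (D c) (c^-1 * c^-1 * c^-1).
Proof.
move=> c0; have h := dilation_lebesgue c0.
have H3 := dilation_prod (m1 := m2) (m2 := leb) (dilation_prod h h) h.
exact: H3.
Qed.

Let ms : measurable_fun [set: T3] (@s3 R).
Proof.
apply: measurable_funD; first apply: measurable_funD.
- apply: measurable_funX; exact: (measurableT_comp measurable_fst measurable_fst).
- apply: measurable_funX; exact: (measurableT_comp measurable_snd measurable_fst).
- apply: measurable_funX; exact: measurable_snd.
Qed.

Let b1 : T3 -> R := fun=> 1.

Let mb : measurable_fun setT b1.
Proof. exact: measurable_cst. Qed.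

Let s0 (x : T3) : 0 <= s3 x. Proof. by rewrite !addr_ge0 ?sqr_ge0. Qed.

Let sD c x : s3 (D c x) = c ^+ 2 * s3 x.
Proof. by rewrite /s3 /= !exprMn !mulrDr. Qed.

Let scaling3 (F : R -> R) : measurable_fun setT F ->
  (forall y : R, 0 <= y -> 0 <= F y) -> forall c : R, 0 < c ->
  wint m3 (@s3 R) b1 (fun y => F (c ^+ 2 * y)) =
  ((c^-1 ^+ 3)%:E * wint m3 (@s3 R) b1 F)%E.
Proof.
apply: (@scaling_of_dilation _ _ _ _ _ _ D (fun c => c^-1 * c^-1 * c^-1) 0) => //.
- by move=> c x; rewrite expr0 mul1r.
- by move=> c c0; rewrite expr0 expr1n mulr1 !exprS expr0 mulr1 mulrA.
Qed.

Let gauss3 : (wint m3 (@s3 R) b1 (fun y => expR (- y)) < +oo)%E.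
Proof.
pose h (x : T1) := expR (- x ^+ 2).
have mh : measurable_fun setT h by exact: measurable_gauss_fun.
have h0 x : 0 <= h x by exact: expR_ge0.
have hoo : (\int[leb]_x (h x)%:E < +oo)%E.
  by have := gauss_scaled_lty (@ltr01 R); under eq_integral do rewrite mul1r.
have hge : (0 <= \int[leb]_x (h x)%:E)%E by apply: integral_ge0 => x _; rewrite lee_fin.
have -> : wint m3 (@s3 R) b1 (fun y => expR (- y)) =
    (\int[m3]_z (h z.1.1 * h z.1.2 * h z.2)%:E)%E.
  by apply: eq_integral => z _; rewrite /h -!expRD /s3 expr1n mul1r !opprD.
rewrite (integral_prod_mul m2 leb (f := fun x : T1 * T1 => h x.1 * h x.2))//; last first.
- by move=> x; rewrite mulr_ge0.
- apply: measurable_funM; first exact: (measurableT_comp mh measurable_fst).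
  exact: (measurableT_comp mh measurable_snd).
rewrite integral_prod_mul//.
by do 2![apply: lte_mul_pinfty => //; rewrite ?ge0_fin_numE ?mule_ge0//].
Qed.

Let mD : measurable_fun setT (fun z : T3 * T1 => D z.2 z.1).
Proof.
apply: measurable_fun_pair; first apply: measurable_fun_pair.
- apply: measurable_funM; first exact: measurable_snd.
  exact: (measurableT_comp measurable_fst (measurableT_comp measurable_fst measurable_fst)).
- apply: measurable_funM; first exact: measurable_snd.
  exact: (measurableT_comp measurable_snd (measurableT_comp measurable_fst measurable_fst)).
- apply: measurable_funM; first exact: measurable_snd.
  exact: (measurableT_comp measurable_snd measurable_fst).
Qed.

Let m3T : m3 setT != 0%E.
Proof.
have lT : leb [set: T1] != 0%E.
  by rewrite -set_itvNyy lebesgue_measure_itv.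
have m2T : m2 setT != 0%E.
  by rewrite -setXTT [X in X != _](product_measure1E leb leb)// mule_neq0.
by rewrite -setXTT [X in X != _](product_measure1E m2 leb)// mule_neq0.
Qed.

Let n0 : {ae m3, forall x, 0 < enorm3 x}.
Proof.
(* The norm vanishes at the origin alone, which is enclosed in the null hyperplane where the last
   coordinate is 0. *)
exists ([set: T1 * T1] `*` [set (0 : T1)]); split.
- by apply: measurableX => //; exact: measurable_set1.
- rewrite [LHS](product_measure1E m2 leb)//.
  by rewrite [X in (_ * X)%E]lebesgue_measure_set1 mule0.
- move=> x /= nx; split => //=; apply/eqP/negPn/negP => x0; apply: nx.
  by rewrite sqrtr_gt0 ltr_wpDl ?addr_ge0 ?sqr_ge0// exprn_even_gt0.
Qed.

Let mn : measurable_fun [set: T3] (@enorm3 R).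
Proof. exact: (measurableT_comp measurable_sqrt ms). Qed.

Variable U3 : R -> (R * R * R -> R[i]) -> R * R * R -> R[i].
Hypothesis hU3 : harmonic_propagator3 U3.

Lemma radial_spacetime_identity (psi : R * R * R -> R[i]) : L2 mu psi -> radial psi ->
  weighted_spacetime_integral mu (@enorm3 R) (fun t => U3 t psi)
  = ((4 * pi)%:E * L2norm mu psi ^+ 2)%E.
Proof.
move=> lpsi [rho psirho]; have /L2P[[mr _] [mi _]] := lpsi.
have k0 (c : R) : 0 < c -> 0 < c^-1 * c^-1 * c^-1.
  by move=> c0; rewrite !mulr_gt0 ?invr_gt0.
have nD c x : 0 < c -> enorm3 (D c x) = c * enorm3 x.
  move=> c0; rewrite -[LHS]/(Num.sqrt (s3 (D c x))) sD sqrtrM ?sqr_ge0//.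
  by rewrite sqrtr_sqr gtr0_norm.
have [x0 psi0] := radial_measurable_profile mD hD k0 m3T mn nD n0 psirho.
(* [psi] is read at the point of norm [sqrt y] on the ray through [x0]: a profile that inherits
   measurability from [psi]. *)
pose F (h : R[i] -> R) (y : R) := h (psi (D (Num.sqrt y / enorm3 x0) x0)).
have mF h : measurable_fun [set: T3] (h \o psi) -> measurable_fun setT (F h).
  move=> mh; apply: (measurableT_comp mh).
  apply: (measurableT_comp (f := fun c => D c x0)).
    exact: (measurableT_comp mD (pair1_measurable x0)).
  apply: measurable_funM; [exact: measurable_sqrt|exact: measurable_cst].
apply: (radial_frame_identity hU3 ms mb s0 scaling3 gauss3 (@schwartz_prof3 R)
  (@harmonic_prof3 R) _ lpsi (mF _ mr) (mF _ mi)).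
- by move=> x; exact: sqr_sqrtr (s0 x).
- move: psi0; apply: (@filterS _ _ (ae_filter_ringOfSetsType m3)) => x xE.
  by rewrite mul1r /F -xE.
- move: psi0; apply: (@filterS _ _ (ae_filter_ringOfSetsType m3)) => x xE.
  by rewrite mul1r /F -xE.
Qed.

End three_dimensions.

Theorem theorem4 (R : realType)
    (U1 : R -> (R -> R[i]) -> R -> R[i])
    (U3 : R -> (R * R * R -> R[i]) -> R * R * R -> R[i])
    (hU1 : harmonic_propagator1 U1) (hU3 : harmonic_propagator3 U3) :
  let odd_identity := forall g : R -> R[i], L2 (@mu1 R) g -> odd_fun g ->
    weighted_spacetime_integral (@mu1 R) (@enorm1 R) (fun t => U1 t g)
    = ((4 * pi)%:E * L2norm (@mu1 R) g ^+ 2)%E in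
  let radial_identity := forall psi : R * R * R -> R[i],
    L2 (@mu3 R) psi -> radial psi ->
    weighted_spacetime_integral (@mu3 R) (@enorm3 R) (fun t => U3 t psi)
    = ((4 * pi)%:E * L2norm (@mu3 R) psi ^+ 2)%E in
  odd_identity /\ (odd_identity <-> radial_identity).
Proof.
move=> odd_identity radial_identity.
have odd_id : odd_identity by move=> g; exact: odd_spacetime_identity hU1 g.
(* Both identities are established outright for the given propagators, so each implication holds by
   its conclusion. *)
split=> //; split=> // _ psi; exact: radial_spacetime_identity hU3 psi.
Qed.
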